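(* Let $\omega\in(0,c]$ be an arbitrary constant with $\exp(\omega r)<2$. For every $\theta\in\mathbb{R}$ there exist a constant $M>0$, a function $a\in K_\infty$ and a non-decreasing function $\gamma:\mathbb{R}_+\to\mathbb{R}_+$ such that for every $(x_0,u_0)\in X$ and $d\in L^\infty(\mathbb{R}_+)$ there exists a unique pair of continuous mappings $x,u:[-r,+\infty)\to\mathbb{R}$ with $x\in W^{1,\infty}(\mathbb{R}_+)$, $x(s)=x_0(s)$ and $u(s)=u_0(s)$ for all $s\in[-r,0]$, for which $$\dot x(t)=\theta x(t)+u(t)+d(t)\quad\text{for almost every } t\ge 0,$$ $$u(t)=-\left(2c+p(x_t,u_t)\right)x(t)\quad\text{for all } t\ge 0,$$ and the following estimates hold for all $t\ge 0$: $$|x(t)|\le M\exp\left(-c(t-r)^+\right)|x_0(0)|+\varepsilon+\left(1+\sqrt r\,M\exp\left(-c(t-r)^+\right)\right)\frac{\|d\|_\infty}{2^{1/4}c},$$ $$\|u_t\|_\infty\le \exp(-\omega t)\,a\left(\|x_0\|_\infty+\|\dot x_0\|_\infty+\|u_0\|_\infty\right)+\gamma\left(\|x_0\|_\infty+\|\dot x_0\|_\infty+\|u_0\|_\infty+\|d\|_\infty\right)\|d\|_\infty+\varepsilon\rho,$$ where $\rho:=2|\theta|+\dfrac{1}{2\sqrt2\, r}+c(r+3)$.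
   Context: $\varepsilon,c,r>0$ are fixed constants and $\mathbb{R}_+=[0,+\infty)$. For $b\in\mathbb{R}$, $(b)^+=\max(b,0)$. $K_\infty$ is the class of continuous, strictly increasing, unbounded functions $a:\mathbb{R}_+\to\mathbb{R}_+$ with $a(0)=0$. For a function $v$ defined on an interval containing $[t-r,t]$, $v_t$ denotes the history $v_t(s)=v(t+s)$, $s\in[-r,0]$. For functions on $[-r,0]$: $\langle f,g\rangle=\int_{-r}^0 f(s)g(s)\,ds$, $\|f\|_2=\left(\int_{-r}^0 f^2(s)\,ds\right)^{1/2}$, and $\|f\|_\infty$ is the essential supremum of $|f|$ on $(-r,0)$; $\|d\|_\infty$ is the essential supremum of $|d|$ on $\mathbb{R}_+$. For an interval $I$, $W^{1,\infty}(I)$ is the set of absolutely continuous functions $f:I\to\mathbb{R}$ with $f,f'\in L^\infty(I)$ (identified with their continuous extensions to finite endpoints of $I$). The functional $p$ is $$p(x,u)=\frac{\left(x^2(0)-x^2(-r)-2\langle x,u\rangle\right)^+ + c\,r\,x^2(0)}{2\left(\|x\|_2^2+\left(\varepsilon^2-x^2(0)\right)^+\right)},\qquad (x,u)\in C^0([-r,0];\mathbb{R}^2),$$ and $$X=\left\{(x,u)\in W^{1,\infty}((-r,0))\times C^0([-r,0]) : u(0)=-(p(x,u)+2c)\,x(0)\right\}.$$ *)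

(* Defs.v *)
(* R is an arbitrary realType.
   A function on an interval I is a total function R -> R of which only the
   values on I matter; in particular, two such functions are the same function
   on I when they agree on I. *)
From HB Require Import structures.
From mathcomp Require Import all_boot all_order all_algebra.
From mathcomp Require Import all_classical all_reals all_analysis.

Set Implicit Arguments.
Unset Strict Implicit.
Unset Printing Implicit Defensive.
Import Order.TTheory GRing.Theory Num.Theory.
Import numFieldNormedType.Exports.
Local Open Scope classical_set_scope.
Local Open Scope ring_scope.

Definition abs_continuous_on (R : realType) (I : set R) (f : R -> R) : Prop :=
  forall e : R, 0 < e -> exists2 delta : R, 0 < delta &
    forall (n : nat) (a b : 'I_n -> R),
      (forall i, a i <= b i /\ `[a i, b i]%classic `<=` I) ->
      trivIset setT (fun i => `]a i, b i[%classic) ->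
      \sum_(i < n) (b i - a i) < delta ->
      \sum_(i < n) `|f (b i) - f (a i)| < e.

(* Lfun asks for Borel measurability on the whole line. Going through a
   representative admits every Lebesgue measurable f on I, since these are
   exactly the functions almost everywhere equal on I to a Borel function. *)
Definition Linfty_on (R : realType) (I : set R) (f : R -> R) : Prop :=
  exists2 g : R -> R, g \in Lfun lebesgue_measure +oo%E &
    f = g %[ae lebesgue_measure in I].

(* Real-valued; meaningful when f is essentially bounded on I, because fine
   sends +oo to 0. *)
Definition Linfty_norm (R : realType) (I : set R) (f : R -> R) : R :=
  fine ('N[lebesgue_measure]_+oo[EFin \o (f \_ I)])%E.

(* The last clause says that f' exists almost everywhere on I and belongs to
   L^oo(I). *)
Definition W1infty_on (R : realType) (I : set R) (f : R -> R) : Prop :=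
  [/\ abs_continuous_on I f,
      Linfty_on I f &
      exists2 g : R -> R, g \in Lfun lebesgue_measure +oo%E &
        {ae lebesgue_measure, forall t : R, I t -> is_derive t (1 : R) f (g t)}].

Definition K_infty (R : realType) (a : R -> R) : Prop :=
  [/\ {within `[0, +oo[, continuous a},
      {in `[0, +oo[ &, {homo a : s t / s < t}},
      forall B : R, exists2 s : R, 0 <= s & B < a s &
      a 0 = 0].

Definition pos_part (R : realType) (b : R) : R := Num.max b 0.

Definition history (R : realType) (v : R -> R) (t : R) : R -> R :=
  fun s => v (t + s).

Definition dot_r (R : realType) (r : R) (f g : R -> R) : R :=
  \int[lebesgue_measure]_(s in `[- r, 0]) (f s * g s).

Definition norm2_r (R : realType) (r : R) (f : R -> R) : R :=
  Num.sqrt (\int[lebesgue_measure]_(s in `[- r, 0]) (f s ^+ 2)).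

Definition normoo_r (R : realType) (r : R) (f : R -> R) : R :=
  Linfty_norm `]- r, 0[ f.

(* For x continuous on [-r, 0], r > 0 and eps > 0, the denominator is
   positive. *)
Definition p_fun (R : realType) (eps c r : R) (x u : R -> R) : R :=
  (pos_part (x 0 ^+ 2 - x (- r) ^+ 2 - 2 * dot_r r x u) + c * r * x 0 ^+ 2) /
  (2 * (norm2_r r x ^+ 2 + pos_part (eps ^+ 2 - x 0 ^+ 2))).

(* Continuity of x on the closed interval selects, for the element of
   W^{1,oo}((-r, 0)), its continuous extension to the endpoints. *)
Definition state_space (R : realType) (eps c r : R) (x u : R -> R) : Prop :=
  [/\ W1infty_on `]- r, 0[ x,
      {within `[- r, 0], continuous x},
      {within `[- r, 0], continuous u} &
      u 0 = - (p_fun eps c r x u + 2 * c) * x 0].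

Definition closed_loop_solution (R : realType) (eps c r theta : R)
    (x0 u0 d x u : R -> R) : Prop :=
  [/\ {within `[- r, +oo[, continuous x} /\ {within `[- r, +oo[, continuous u},
      W1infty_on `[0, +oo[ x,
      (forall s : R, s \in `[- r, 0] -> x s = x0 s /\ u s = u0 s),
      {ae lebesgue_measure, forall t : R, 0 <= t ->
         is_derive t (1 : R) x (theta * x t + u t + d t)} &
      forall t : R, 0 <= t ->
        u t = - (2 * c + p_fun eps c r (history x t) (history u t)) * x t].

(* Main.v *)
Require Import Defs.
From HB Require Import structures.
From mathcomp Require Import all_boot all_order all_algebra.
From mathcomp Require Import all_classical all_reals all_analysis.
From mathcomp Require Import measurable_realfun ess_sup_inf ring lra.

(* Integrating (x^2)' = 2 x (theta x + u + d) over [t - r, t] shows that, along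
   solutions, the quantity x(t)^2 - x(t - r)^2 - 2 <x_t, u_t> equals
   2 (theta ||x_t||^2 + <x_t, d_t>), with a correction depending only on the
   initial history while t < r.  So u is eliminated and the feedback becomes a
   causal functional of x.  Once x and the denominator of p are truncated at
   explicit time-dependent levels this functional is Lipschitz, and Picard
   iteration gives a unique global solution; as p >= 0, the a priori bound on
   x^2 and its one-sided Lipschitz bound show that the truncations are inactive.

   For the estimates put V = x^2.  For t >= r and V >= eps^2 the elimination
   gives p >= theta + <x_t, d_t> / ||x_t||^2 + c r V / (2 ||x_t||^2), hence
   V' <= - 3 c V + 2 |d|^2 / c.  For the bound on u only the term
   c r |x|^3 / ||x_t||^2 is delicate.  It is harmless if V <= eps^2 / 2.  When
   d is small, V is nonincreasing as long as V >= eps^2 / 2 lies above the level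
   at which |theta| (eps^2 - V)^+ = c r V / 2: there ||x_t||^2 >= r V, and below
   that level (eps^2 - V)^+ bounds the denominator of p from below.  When d is
   not small, or on [0, 2 r] when the initial history is not small, any bound on
   u that is nondecreasing in the data suffices. *)

(** The feedback law is implicit, since p depends on the history of u itself, and d is merely
    measurable; integrating over the window removes u and leaves d under the integral sign. The
    summand c r x(0)^2 in the numerator of p then acts twice. By 2 V |<x_t, d_t>| <= ||x_t||^2 |d|^2
    / c + c r V^2 it absorbs the disturbance; and where the denominator contains (eps^2 - V)^+, it
    makes up for the part of theta that the gain fails to cancel. The coefficient of eps in the
    bound on u is prescribed, so r V / ||x_t||^2 must be bounded by 1, whereas the growth bound
    alone would give a factor 2 exp((2 |theta| + 1) r). Monotonicity of V on the window yields 1; as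
    it is known from time r on only, the window has to start after r, hence t >= 2 r. Elsewhere
    crude bounds are affordable: beyond a threshold delta for the size of the history or of d, a
    factor at least 1, the ratio of that size to delta, makes them vanish with the data. *)

Set Implicit Arguments.
Unset Strict Implicit.
Unset Printing Implicit Defensive.
Import Order.TTheory GRing.Theory Num.Theory.
Import numFieldNormedType.Exports.
Local Open Scope classical_set_scope.
Local Open Scope ring_scope.

(** * Monotonicity of absolutely continuous functions *)

(* Cousin's lemma. *)
Lemma fine_partition (R : realType) (P : R -> R -> Prop) (a b : R) : a <= b ->
  (forall x, a <= x <= b -> exists2 d : R, 0 < d &
     forall s t, a <= s <= x -> x <= t <= b -> x - s < d -> t - x < d -> P s t) ->
  exists l : seq R,
    path (fun s t => (s <= t) && `[< P s t >]) a l /\ last a l = b.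
Proof.
move=> ab loc.
pose S := [set t | a <= t <= b /\ exists l : seq R,
    path (fun s t => (s <= t) && `[< P s t >]) a l /\ last a l = t].
have Sa : S a by split; [rewrite lexx ab | exists [::]].
have Sub : ubound S b by move=> t [/andP[]].
have hS : has_sup S by split; [exists a | exists b].
set c := sup S.
have ac : a <= c by exact: ub_le_sup (ex_intro _ b Sub) _ Sa.
have cb : c <= b by exact: ge_sup (ex_intro _ a Sa) Sub.
have [d d0 Pd] : exists2 d : R, 0 < d & forall s t, a <= s <= c -> c <= t <= b ->
  c - s < d -> t - c < d -> P s t.
  by apply: loc; rewrite ac cb.
have [s Ss sc] : exists2 s, S s & c - d < s by exact: sup_adherent.
have sc' : s <= c by exact: ub_le_sup (ex_intro _ b Sub) _ Ss.
have ext t : c <= t <= b -> t - c < d -> S t.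
  move=> /andP[ct tb] tcd; split; first by rewrite tb andbT (le_trans ac).
  case: Ss => /andP[as_ sb] [l [pl ll]]; exists (rcons l t); rewrite last_rcons;
    split=> //.
  rewrite rcons_path pl /= ll (le_trans sc' ct) /=; apply/asboolP.
  by apply: Pd; rewrite ?as_ ?ct //; lra.
have [|cltb] := leP b c.
  move=> bc; have cbE : c = b by apply/eqP; rewrite eq_le cb.
  have [_ [l [pl ll]]] : S c by apply: ext; rewrite ?lexx ?cb //; lra.
  by exists l; rewrite ll.
have : S (Num.min b (c + d / 2)).
  apply: ext; first by rewrite le_min ltW //= ge_min lexx /= andbT; lra.
  by rewrite ltrBlDr gt_min; apply/orP; right; lra.
move=> /(ub_le_sup (ex_intro _ b Sub)); rewrite -/c ge_min => /orP[|]; lra.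
Qed.

Lemma path_nth_le (R : realType) (P : R -> R -> bool) (x0 a : R) l i :
  path (fun s t => (s <= t) && P s t) a l -> (i < size l)%N ->
  nth x0 (a :: l) i <= nth x0 (a :: l) i.+1 /\
  P (nth x0 (a :: l) i) (nth x0 (a :: l) i.+1).
Proof. by move=> /(pathP x0) h il; have /andP[] := h i il. Qed.

Lemma path_nth_mono (R : realType) (P : R -> R -> bool) (x0 a : R) l i j :
  path (fun s t => (s <= t) && P s t) a l -> (i <= j)%N -> (j <= size l)%N ->
  nth x0 (a :: l) i <= nth x0 (a :: l) j.
Proof.
move=> pl; elim: j => [|j IH]; first by rewrite leqn0 => /eqP ->.
rewrite leq_eqVlt => /predU1P[-> //|]; rewrite ltnS => ij jl.
by apply: le_trans (IH ij (ltnW jl)) _; have [] := path_nth_le x0 pl jl.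
Qed.

(** The limit of difference quotients in additive form. As h = 0 is allowed, it applies to both ends
    of a partition interval containing t, even if t is one of them. *)
Lemma is_derive_le_near (R : realType) (F : R -> R) (t g e : R) :
  is_derive t (1 : R) F g -> 0 < e ->
  exists2 d : R, 0 < d & forall h, `|h| < d -> `|F (t + h) - F t - g * h| <= e * `|h|.
Proof.
move=> [dF vF] e0; have := dF; rewrite /derivable => /cvgP.
move=> /(@cvgrPdist_le _ _ _ _ (dnbhs_filter _)) /(_ e e0).
have -> : lim (h^-1 *: (((F \o shift t) (h *: (1 : R))) - F t) @[h --> 0^']) = g by
  rewrite -vF.
move=> /nbhs_ballP[d /= d0 H]; exists d => // h hd.
have [->|h0] := eqVneq h 0; first by rewrite addr0 subrr mulr0 subrr normr0 mulr0.
have := H h; rewrite /ball /= sub0r normrN => /(_ hd h0).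
rewrite /= /GRing.scale /= mulr1 addrC -ler_pdivrMr ?normr_gt0 // => {}H.
rewrite -normfV -normrM; apply: le_trans H.
rewrite -normrN le_eqVlt; apply/orP; left; apply/eqP; congr (`|_|).
by rewrite (addrC t); field.
Qed.

Section ac.
Variable R : realType.
Implicit Types (F : R -> R).
Let mu : measure _ _ := @lebesgue_measure R.

(** Converts a small measure of U into the length condition of [abs_continuous_on]. *)
Lemma sum_itv_lengths_le (U : set R) n (a b : 'I_n -> R) :
  measurable U -> (forall i, a i <= b i) -> (forall i, `]a i, b i[ `<=` U) ->
  trivIset setT (fun i => `]a i, b i[%classic) ->
  ((\sum_(i < n) (b i - a i))%:E <= mu U)%E.
Proof.
move=> mU ab abU tr.
have -> : (\sum_(i < n) (b i - a i))%:E =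
    mu (\big[setU/set0]_(i < n) `]a i, b i[%classic).
  rewrite measure_bigsetU_ord //= -sumEFin; apply: eq_bigr => i _.
  rewrite lebesgue_measure_itv /= lte_fin; case: ifP => // /negbT.
  by rewrite -leNgt => ba; have -> : b i = a i by [apply/eqP; rewrite eq_le ba ab];
    rewrite subrr.
apply: le_measure; rewrite ?inE //.
  by apply: bigsetU_measurable => i _.
by elim/big_ind: _ => // A B AU BU x [/AU|/BU].
Qed.

Lemma null_set_in_small_open (N : set R) (d : R) : mu.-negligible N -> 0 < d ->
  exists U : set R, [/\ open U, N `<=` U & (mu U < d%:E)%E].
Proof.
move=> [A [mA A0 NA]] d0.
have [|U [oU AU mUA]] := @lebesgue_regularity_outer R A d mA _ d0.
  by rewrite A0 ltry.
exists U; split=> //; first exact: subset_trans AU.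
have mU : measurable U by exact: open_measurable.
have := measureU2 mu mA (measurableD mU mA); rewrite setDUK // => /le_lt_trans; apply.
by move: A0 => /= ->; rewrite add0e.
Qed.

(* The exceptional null set is covered by an open set of small measure. In a
   sufficiently fine partition the intervals contained in this set contribute
   little by absolute continuity, and on the others the derivative controls the
   increment. *)
Lemma ac_nonincreasing F (a b : R) : a <= b ->
  abs_continuous_on `[a, b] F ->
  {ae mu, forall t, a < t < b -> exists2 g : R, g <= 0 & is_derive t (1 : R) F g} ->
  F b <= F a.
Proof.
move=> ab acF aeF; apply/ler_addgt0Pr => e e0.
(* The added 1 keeps the divisor positive when a = b. *)
pose e' := e / (2 * (b - a + 1)).
have e'0 : 0 < e' by rewrite divr_gt0 // mulr_gt0 //; lra.
have e20 : 0 < e / 2 by rewrite divr_gt0.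
have [d d0 acd] := acF (e / 2) e20.
(* The endpoints join the exceptional set, since no derivative is assumed there. *)
pose N := ~` [set t | a < t < b -> exists2 g : R, g <= 0 & is_derive t (1 : R) F g]
   `|` [set a; b].
have nN : mu.-negligible N.
  by apply: negligibleU => //; apply: negligibleU; apply/negligibleP => //;
    exact: lebesgue_measure_set1.
have [U [oU NU mUd]] := null_set_in_small_open nN d0.
pose P s t := `[s, t] `<=` U \/ F t - F s <= e' * (t - s).
have [|l [pl ll]] := @fine_partition R P a b ab.
  move=> x xab; have [xN|xN] := pselect (N x).
    have /nbhs_ballP[r /= r0 Hr] : nbhs x U by apply: open_nbhs_nbhs; split=> //;
      exact: NU.
    exists r => // s t /andP[as_ sx] /andP[xt tb] xs tx; left => y /=.
    rewrite in_itv /= => /andP[sy yt]; apply: Hr; rewrite /ball /=.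
    by rewrite ltr_norml; apply/andP; split; lra.
  have xab' : a < x < b.
    move: xab; rewrite !le_eqVlt => /andP[/predU1P[xa|->] /predU1P[xb|-> //]] //.
    - by case: xN; right; left.
    - by case: xN; right; left.
    - by case: xN; right; right; rewrite xb.
  have [g g0 Dg] : exists2 g : R, g <= 0 & is_derive x (1 : R) F g.
    by apply: contrapT => h; apply: xN; left => /= /(_ xab').
  have [r r0 Hr] := is_derive_le_near Dg e'0.
  exists r => // s t /andP[as_ sx] /andP[xt tb] xs tx; right.
  have ht : `|t - x| < r by rewrite ger0_norm; lra.
  have hs : `|s - x| < r by rewrite ler0_norm; lra.
  have := Hr _ ht; have := Hr _ hs; rewrite !subrKC !ler_norml.
  rewrite (ger0_norm (_ : 0 <= t - x)) ?(ler0_norm (_ : s - x <= 0)); [|lra|lra].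
  move=> /andP[h2 _] /andP[_ h1]; nra.
pose tt i := nth b (a :: l) i.
pose n := size l.
have tn : tt n = b by rewrite /tt /n -[RHS]ll (last_nth b).
have t0 : tt 0%N = a by [].
have step i : (i < n)%N -> tt i <= tt i.+1 /\ P (tt i) (tt i.+1).
  by move=> il; have [? /asboolP ?] := path_nth_le b pl il.
have mono i j : (i <= j)%N -> (j <= n)%N -> tt i <= tt j by exact: path_nth_mono pl.
pose A (i : 'I_n) := tt i.
(* An interval not contained in U becomes degenerate: all n indices are kept, and its term in the
   sum is 0. *)
pose B (i : 'I_n) := if `[< `[tt i, tt i.+1] `<=` U >] then tt i.+1 else tt i.
have Bl i : A i <= B i.
  by rewrite /A /B; case: ifP => // _; have [] := step i (ltn_ord i).
have Br i : B i <= tt i.+1.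
  by rewrite /B; case: ifP => // _; have [] := step i (ltn_ord i).
have BU i : `]A i, B i[ `<=` U.
  rewrite /A /B; case: asboolP => [h|_].
    by apply: subset_trans h; exact: subset_itv_oo_cc.
  by move=> y /=; rewrite in_itv /= => /andP[h1 h2]; have := lt_trans h1 h2; rewrite ltxx.
have tr : trivIset setT (fun i => `]A i, B i[%classic).
  apply/trivIsetP => i j _ _ ij; rewrite -subset0 => y [] /=; rewrite !in_itv /=.
  move=> /andP[h1 h2] /andP[h3 h4].
  have [ltij|] := ltnP i j.
    have := mono i.+1 j ltij (ltnW (ltn_ord j)); have := Br i; rewrite /A in h3 *; lra.
  rewrite leq_eqVlt => /predU1P[eij|ltji]; first by case/eqP: ij; apply: val_inj.
  have := mono j.+1 i ltji (ltnW (ltn_ord i)); have := Br j; rewrite /A in h1 *; lra.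
have mU : measurable U by exact: open_measurable.
have len : \sum_(i < n) (B i - A i) < d.
  rewrite -lte_fin; apply: le_lt_trans mUd; exact: sum_itv_lengths_le.
have small : \sum_(i < n) `|F (B i) - F (A i)| < e / 2.
  apply: acd => // i; split=> // y /=; rewrite !in_itv /= => /andP[h1 h2].
  have := mono 0%N i (leq0n _) (ltnW (ltn_ord i));
    have := mono i.+1 n (ltn_ord i) (leqnn _).
  have := Br i; rewrite /A in h1; rewrite t0 tn; lra.
have tel (G : R -> R) m : \sum_(i < m) (G (tt i.+1) - G (tt i)) = G (tt m) - G (tt 0%N).
  elim: m => [|m IH]; first by rewrite big_ord0 subrr.
  by rewrite big_ord_recr /= IH; lra.
have main : F b - F a <= e' * (b - a) + \sum_(i < n) `|F (B i) - F (A i)|.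
  rewrite -{1}tn -{1}t0 -(tel F) -{1}tn -{1}t0 -(tel id) mulr_sumr -big_split /=.
  apply: ler_sum => i _; have [ti Pi] := step i (ltn_ord i).
  rewrite /A /B; case: asboolP => [h|h].
    by rewrite ler_wpDl ?ler_norm // mulr_ge0 //= ?subr_ge0 //; exact: ltW.
  by case: Pi => // {}h; rewrite subrr normr0 addr0.
have : e' * (b - a) <= e / 2.
  rewrite /e' invfM mulrA mulrAC ler_pdivrMr ?ler_pM2l ?divr_gt0 //; lra.
lra.
Qed.

End ac.

(** * Integrals of locally bounded measurable functions *)

Section itg.
Variable R : realType.
Implicit Types (f g : R -> R) (a b s t : R).
Local Notation mu := (@lebesgue_measure R).

(** A class stable under sums and products whose members are integrable on every segment, so that
    the rules for [itg] have a single side condition. It contains the continuous functions and the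
    bounded Borel disturbances. *)
Definition loc_bounded f := measurable_fun setT f /\
  forall T, exists B, forall t, `|t| <= T -> `|f t| <= B.

Lemma loc_bounded_cont f : continuous f -> loc_bounded f.
Proof.
move=> cf; split; first exact: continuous_measurable_fun.
move=> T; have [T0|T0] := leP 0 T; last first.
  by exists 0 => t /(le_lt_trans)/(_ T0); rewrite ltNge normr_ge0.
have cg : {within `[- T, T], continuous (fun t => `|f t|)}.
  by apply: continuous_subspaceT => x; apply: continuous_comp;
    [exact: cf|exact: norm_continuous].
have [|c _ H] := EVT_max _ cg; first lra.
by exists `|f c| => t; rewrite ler_norml => tT; apply: H; rewrite in_itv.
Qed.

Lemma loc_boundedD f g : loc_bounded f -> loc_bounded g ->
  loc_bounded (fun t => f t + g t).
Proof.
move=> [mf bf] [mg bg]; split; first exact: measurable_funD.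
move=> T; have [B HB] := bf T; have [C HC] := bg T; exists (B + C) => t tT.
by apply: le_trans (ler_normD _ _) _; apply: lerD; [exact: HB|exact: HC].
Qed.

Lemma loc_boundedM f g : loc_bounded f -> loc_bounded g ->
  loc_bounded (fun t => f t * g t).
Proof.
move=> [mf bf] [mg bg]; split; first exact: measurable_funM.
move=> T; have [B HB] := bf T; have [C HC] := bg T; exists (B * C) => t tT.
by rewrite normrM; apply: ler_pM => //; [exact: HB|exact: HC].
Qed.

Lemma loc_bounded_cst (k : R) : loc_bounded (fun=> k).
Proof. by apply: loc_bounded_cont => x; exact: cvg_cst. Qed.

Lemma loc_boundedZ f (k : R) : loc_bounded f -> loc_bounded (fun t => k * f t).
Proof. by move=> h; apply: loc_boundedM => //; exact: loc_bounded_cst. Qed.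

Lemma loc_boundedN f : loc_bounded f -> loc_bounded (fun t => - f t).
Proof. by move=> /(loc_boundedZ (-1)) h; under eq_fun do rewrite -mulN1r. Qed.

Lemma loc_boundedB f g : loc_bounded f -> loc_bounded g ->
  loc_bounded (fun t => f t - g t).
Proof. by move=> hf hg; apply: loc_boundedD => //; exact: loc_boundedN. Qed.

Lemma loc_boundedX f : loc_bounded f -> loc_bounded (fun t => f t ^+ 2).
Proof. by move=> hf; under eq_fun do rewrite expr2; exact: loc_boundedM. Qed.

Lemma loc_bounded_norm f : loc_bounded f -> loc_bounded (fun t => `|f t|).
Proof.
move=> [mf bf]; split; first exact: measurableT_comp.
by move=> T; have [B HB] := bf T; exists B => t tT; rewrite normr_id HB.
Qed.

(** Not oriented: the value is 0 when b < a. *)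
Definition itg f a b := \int[mu]_(x in `[a, b]) f x.

Lemma loc_bounded_bounded f A : loc_bounded f -> bounded_set A ->
  [bounded f x | x in A].
Proof.
move=> [_ bf] [M [_ HM]]; have [B HB] := bf (M + 1).
exists B; split; rewrite ?num_real // => y By x Ax /=.
by apply: le_trans (ltW By); apply: HB; apply: HM => //; lra.
Qed.

Lemma loc_bounded_integrable f a b : loc_bounded f -> mu.-integrable `[a, b] (EFin \o f).
Proof.
move=> bf; apply: measurable_bounded_integrable.
- exact: measurable_itv.
- by apply: compact_finite_measure; exact: segment_compact.
- by case: bf => mf _; exact: measurable_funTS.
- by apply: loc_bounded_bounded => //; apply: compact_bounded; exact: segment_compact.
Qed.

Lemma fine_mu_itv a b : a <= b -> fine (mu `[a, b]) = b - a.
Proof.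
move=> ab; rewrite lebesgue_measure_itv /= lte_fin; case: ltP => // ba.
by rewrite /=; lra.
Qed.

Lemma itgD f g a b : loc_bounded f -> loc_bounded g ->
  itg (fun t => f t + g t) a b = itg f a b + itg g a b.
Proof. by move=> hf hg; apply: RintegralD => //; exact: loc_bounded_integrable. Qed.

Lemma itgB f g a b : loc_bounded f -> loc_bounded g ->
  itg (fun t => f t - g t) a b = itg f a b - itg g a b.
Proof. by move=> hf hg; apply: RintegralB => //; exact: loc_bounded_integrable. Qed.

Lemma itgZ k f a b : loc_bounded f -> itg (fun t => k * f t) a b = k * itg f a b.
Proof. by move=> hf; apply: RintegralZl => //; exact: loc_bounded_integrable. Qed.

Lemma itg_cst k a b : a <= b -> itg (fun=> k) a b = k * (b - a).
Proof. by move=> ab; rewrite /itg Rintegral_cst // fine_mu_itv. Qed.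

Lemma eq_itg f g a b : (forall t, a <= t <= b -> f t = g t) -> itg f a b = itg g a b.
Proof. by move=> fg; apply: eq_Rintegral => t; rewrite inE /= in_itv /=; exact: fg. Qed.

Lemma le_itg f g a b : loc_bounded f -> loc_bounded g ->
  (forall t, a <= t <= b -> f t <= g t) -> itg f a b <= itg g a b.
Proof.
move=> hf hg fg; apply: le_Rintegral;
  [by []|exact: loc_bounded_integrable|exact: loc_bounded_integrable|].
by move=> t /=; rewrite in_itv /=; exact: fg.
Qed.

Lemma itg_ge0 f a b : (forall t, a <= t <= b -> 0 <= f t) -> 0 <= itg f a b.
Proof. by move=> f0; apply: Rintegral_ge0 => t /=; rewrite in_itv; exact: f0. Qed.

Lemma itg_le_cst f a b k : loc_bounded f -> a <= b -> 
  (forall t, a <= t <= b -> f t <= k) -> itg f a b <= k * (b - a).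
Proof. by move=> hf ab fk; rewrite -itg_cst //; apply: le_itg => //;
  exact: loc_bounded_cst. Qed.

Lemma itg_ge_cst f a b k : loc_bounded f -> a <= b -> 
  (forall t, a <= t <= b -> k <= f t) -> k * (b - a) <= itg f a b.
Proof. by move=> hf ab fk; rewrite -itg_cst //; apply: le_itg => //;
  exact: loc_bounded_cst. Qed.

Lemma norm_itg_le f g a b : loc_bounded f -> loc_bounded g ->
  (forall t, a <= t <= b -> `|f t| <= g t) -> `|itg f a b| <= itg g a b.
Proof.
move=> hf hg fg; apply: le_trans (le_normr_Rintegral _ _) _ => //;
  first exact: loc_bounded_integrable.
by apply: le_itg => //; exact: loc_bounded_norm.
Qed.

Lemma norm_itg_le_cst f a b k : loc_bounded f -> a <= b ->
  (forall t, a <= t <= b -> `|f t| <= k) -> `|itg f a b| <= k * (b - a).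
Proof. by move=> hf ab fk; rewrite -itg_cst //; apply: norm_itg_le => //;
  exact: loc_bounded_cst. Qed.

Lemma itg_chasles f a b c : loc_bounded f -> a <= b -> b <= c ->
  itg f a b + itg f b c = itg f a c.
Proof.
move=> hf ab bc; rewrite /itg -[X in _ + X = _]Rintegral_itv_obnd_cbnd; last first.
  apply: integrableS (loc_bounded_integrable b c hf) => //; exact: subset_itv_oc_cc.
rewrite -(@Rintegral_itvB _ f (BLeft a) (BRight c) b) ?bnd_simp //;
  last exact: loc_bounded_integrable.
by rewrite addrC subrK.
Qed.

Lemma itg_xx f a : itg f a a = 0.
Proof. by rewrite /itg set_itv1 Rintegral_set1. Qed.

Lemma itg_gt f a b : b < a -> itg f a b = 0.
Proof. by move=> ba; rewrite /itg set_itv_ge ?Rintegral_set0 // bnd_simp -ltNge. Qed.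

Lemma itg_lip f a T B s t : loc_bounded f -> (forall t, a <= t <= T -> `|f t| <= B) ->
  a <= s -> s <= t -> t <= T -> `|itg f a t - itg f a s| <= B * (t - s).
Proof.
move=> hf fB as_ st tT.
rewrite -(itg_chasles hf as_ st) addrAC subrr add0r.
by apply: norm_itg_le_cst => // x /andP[sx xt]; apply: fB; apply/andP; split; lra.
Qed.

Lemma itg_continuous f a : loc_bounded f -> continuous (itg f a).
Proof.
(* This radius covers every point between a and a point at distance less than 1 from x. *)
move=> hf x; have [B HB] := hf.2 (`|a| + `|x| + 1).
have B0 : 0 <= B.
  by apply: le_trans (normr_ge0 (f 0)) _; apply: HB; rewrite normr0 !addr_ge0.
apply/cvgrPdist_le => e e0; near=> y.
have xy1 : `|x - y| < 1 by near: y; apply: cvgr_dist_lt.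
have xy : `|x - y| <= e / (B + 1).
  by near: y; apply: cvgr_dist_le => //; rewrite divr_gt0 //; lra.
have hB t : a <= t <= Num.max x y -> `|f t| <= B.
  move=> /andP[at_ tm]; apply: HB; rewrite ler_norml; apply/andP; split.
    have := ler_norm (-a); rewrite normrN; have := normr_ge0 x; lra.
  have := ler_norm x; have := normr_ge0 a; move: tm xy1;
    rewrite le_max ltr_norml => /orP[|] ? /andP[]; lra.
have lip u v : a <= u -> u <= v -> v <= Num.max x y ->
  `|itg f a v - itg f a u| <= B * (v - u).
  by move=> h1 h2 h3; apply: itg_lip hB _ _ _.
have key u v : u <= v -> v <= Num.max x y -> `|itg f a v - itg f a u| <= B * (v - u).
  move=> uv vm; have [au|ua] := leP a u; first exact: lip.
  rewrite (itg_gt _ ua) subr0; have [av|va] := leP a v.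
    have := lip a v (lexx _) av vm; rewrite itg_xx subr0 => /le_trans; apply.
    by rewrite ler_wpM2l //; lra.
  by rewrite itg_gt // normr0 mulr_ge0 // subr_ge0.
have fin : B * `|x - y| <= e.
  apply: (@le_trans _ _ (B * (e / (B + 1)))); first by rewrite ler_wpM2l.
  by rewrite mulrA ler_pdivrMr; nra.
apply: le_trans fin.
have [xy'|xy'] := leP x y.
  rewrite distrC (ler0_norm (_ : x - y <= 0)) ?opprB; last lra.
  by apply: key => //; rewrite le_max lexx orbT.
rewrite (ger0_norm (_ : 0 <= x - y)); last lra.
by apply: key; [exact: ltW|rewrite le_max lexx].
Unshelve. all: by end_near. Qed.

Lemma ae_imp (P Q : R -> Prop) : (forall t, P t -> Q t) ->
  {ae mu, forall t, P t} -> {ae mu, forall t, Q t}.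
Proof. by move=> PQ; apply: filterS; first exact: (ae_filter_ringOfSetsType mu). Qed.

Lemma ae_imp2 (P Q S : R -> Prop) : (forall t, P t -> Q t -> S t) ->
  {ae mu, forall t, P t} -> {ae mu, forall t, Q t} -> {ae mu, forall t, S t}.
Proof. by move=> PQ; apply: filterS2; first exact: (ae_filter_ringOfSetsType mu). Qed.

(** Lebesgue's differentiation theorem; f is only measurable, so the derivative exists only almost
    everywhere. *)
Lemma itg_derive_ae f a : loc_bounded f ->
  {ae mu, forall t, a < t -> is_derive t (1 : R) (itg f a) (f t)}.
Proof.
move=> hf; have lf : locally_integrable setT f.
  split; [exact: hf.1|exact: openT|move=> K _ cK].
  have iK : mu.-integrable K (EFin \o f).
    apply: measurable_bounded_integrable; first exact: compact_measurable.
    - exact: compact_finite_measure.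
    - by apply: measurable_funTS; exact: hf.1.
    - by apply: loc_bounded_bounded => //; exact: compact_bounded.
  by case/integrableP : iK.
have := @FTC1 R f (BLeft a) (fun y => loc_bounded_integrable a y hf) lf.
apply: ae_imp => t H at_; have [|dF <-] := H; first by rewrite /= lte_fin.
by rewrite derive1E; exact: derivableP.
Qed.

End itg.

(** * Primitives: fundamental theorem, product rule, Gronwall's inequality *)

Section primitive.
Variable R : realType.
Implicit Types (f g F G : R -> R) (a b s t : R).
Local Notation mu := (@lebesgue_measure R).

Lemma ac_subset (I J : set R) F : J `<=` I ->
  abs_continuous_on I F -> abs_continuous_on J F.
Proof.
move=> JI acF e e0; have [d d0 H] := acF e e0; exists d => // n a b ab tr ln.
by apply: H => // i; have [? abJ] := ab i; split=> //; exact: subset_trans JI.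
Qed.

Lemma ac_add (I : set R) F G : abs_continuous_on I F -> abs_continuous_on I G ->
  abs_continuous_on I (fun t => F t + G t).
Proof.
move=> acF acG e e0; have e20 : 0 < e / 2 by rewrite divr_gt0.
have [d d0 Hd] := acF _ e20; have [d' d'0 Hd'] := acG _ e20.
exists (Num.min d d'); first by rewrite lt_min d0.
move=> n a b ab tr; rewrite lt_min => /andP[l1 l2].
have := Hd n a b ab tr l1; have := Hd' n a b ab tr l2.
set S1 := (X in X < _ -> _); set S2 := (X in _ -> X < _ -> _).
move=> h1 h2; apply: (@le_lt_trans _ _ (S2 + S1)); last lra.
rewrite -big_split /=; apply: ler_sum => i _.
apply: le_trans (ler_normD _ _); rewrite le_eqVlt; apply/orP; left; apply/eqP.
by congr (`|_|); ring.
Qed.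

Lemma ac_opp (I : set R) F : abs_continuous_on I F ->
  abs_continuous_on I (fun t => - F t).
Proof.
move=> acF e e0; have [d d0 H] := acF e e0; exists d => // n a b ab tr ln.
apply: le_lt_trans (H n a b ab tr ln); apply: ler_sum => i _.
by rewrite -opprD normrN.
Qed.

Lemma ac_lipschitz (I : set R) F (K : R) :
  (forall s t, I s -> I t -> s <= t -> `|F t - F s| <= K * (t - s)) ->
  abs_continuous_on I F.
Proof.
move=> lip e e0; exists (e / (`|K| + 1)); first by rewrite divr_gt0 // ltr_wpDl.
move=> n a b ab tr ln.
apply: (@le_lt_trans _ _ (\sum_(i < n) (`|K| + 1) * (b i - a i))).
  apply: ler_sum => i _; have [abi Ii] := ab i.
  apply: le_trans (lip _ _ _ _ abi) _; [apply: Ii|apply: Ii|];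
    rewrite /= ?in_itv /= ?lexx ?abi //.
  by rewrite ler_wpM2r ?subr_ge0 //; have := ler_norm K; lra.
by rewrite -mulr_sumr mulrC -ltr_pdivlMr // ltr_wpDl.
Qed.

Lemma itg_ac f a b : loc_bounded f -> abs_continuous_on `[a, b] (itg f a).
Proof.
move=> hf; have [B HB] := hf.2 (`|a| + `|b|); apply: (@ac_lipschitz _ _ B) => s t.
rewrite /= !in_itv /= => /andP[as_ sb] /andP[at_ tb] st.
apply: itg_lip tb => // x /andP[ax xb]; apply: HB; rewrite ler_norml.
have := ler_norm b; have := ler_norm (- a); rewrite normrN.
by have := normr_ge0 a; have := normr_ge0 b; move=> *; apply/andP; split; lra.
Qed.

(** Both F - [itg f a] and its opposite are absolutely continuous with derivative 0 almost
    everywhere, hence nonincreasing. *)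
Lemma ac_FTC F f a b : a <= b -> abs_continuous_on `[a, b] F -> loc_bounded f ->
  {ae mu, forall t, a < t < b -> is_derive t (1 : R) F (f t)} ->
  F b - F a = itg f a b.
Proof.
move=> ab acF hf dF; have dI := itg_derive_ae a hf; have acI := itg_ac a b hf.
have h1 : F b + - itg f a b <= F a + - itg f a a.
  apply: (@ac_nonincreasing _ (fun t => F t + - itg f a t) a b ab).
    by apply: ac_add => //; exact: ac_opp.
  apply: ae_imp2 dF dI => t H1 H2 /andP[at_ tb]; exists 0 => //; rewrite -(subrr (f t)).
  by apply: is_deriveB; [apply: H1; rewrite at_|exact: H2].
have h2 : - F b + itg f a b <= - F a + itg f a a.
  apply: (@ac_nonincreasing _ (fun t => - F t + itg f a t) a b ab).
    by apply: ac_add => //; exact: ac_opp.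
  apply: ae_imp2 dF dI => t H1 H2 /andP[at_ tb]; exists 0 => //; rewrite -(addNr (f t)).
  by apply: is_deriveD; [apply: is_deriveN; apply: H1; rewrite at_|exact: H2].
by move: h1 h2; rewrite itg_xx; lra.
Qed.

(** Restricted to nonnegative times because before 0 a trajectory is a prescribed history that
    solves no equation. *)
Definition primitive F f := loc_bounded f /\ forall s t, 0 <= s -> s <= t ->
  F t - F s = itg f s t.

Lemma primitive_lip F f T : primitive F f -> exists K, forall s t, 0 <= s -> s <= t ->
  t <= T ->
  `|F t - F s| <= K * (t - s).
Proof.
move=> [hf Ff]; have [B HB] := hf.2 T; exists B => s t s0 st tT; rewrite Ff //.
by apply: norm_itg_le_cst => // x /andP[sx xt]; apply: HB; rewrite ger0_norm; lra.
Qed.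

Lemma primitive_derive F f : primitive F f ->
  {ae mu, forall t, 0 < t -> is_derive t (1 : R) F (f t)}.
Proof.
move=> [hf Ff]; apply: ae_imp (itg_derive_ae 0 hf) => t H t0.
apply: (@near_eq_is_derive _ _ _ (fun x => cst (F 0) x + itg f 0 x)); last first.
  by rewrite -[f t]add0r; apply: is_deriveD; exact: H.
near=> x; have x0 : 0 < x by near: x; exact: lt_nbhsr.
by rewrite -Ff ?lexx ?ltW //= addrC subrK.
Unshelve. all: by end_near. Qed.

Lemma primitive_of_ac F f : loc_bounded f ->
  (forall b, 0 <= b -> abs_continuous_on `[0, b] F) ->
  {ae mu, forall t, 0 < t -> is_derive t (1 : R) F (f t)} -> primitive F f.
Proof.
move=> hf acF dF; split=> // s t s0 st; apply: ac_FTC => //.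
  apply: (@ac_subset `[0, t]); last by apply: acF; exact: le_trans st.
  by move=> x /=; rewrite !in_itv /= => /andP[h ->]; rewrite (le_trans s0).
by apply: ae_imp dF => x H /andP[sx _]; apply: H; exact: le_lt_trans sx.
Qed.

Lemma primitiveD F f G g : primitive F f -> primitive G g ->
  primitive (fun t => F t + G t) (fun t => f t + g t).
Proof.
move=> [hf Ff] [hg Gg]; split; first exact: loc_boundedD.
by move=> s t s0 st; rewrite itgD // -Ff // -Gg //; ring.
Qed.

Lemma primitive_cst k : primitive (fun=> k) (fun=> 0).
Proof. by split; [exact: loc_bounded_cst|move=> s t _ st;
  rewrite itg_cst // subrr mul0r]. Qed.

Lemma primitive_bound F f T : primitive F f -> exists K, forall t, 0 <= t <= T ->
  `|F t| <= K.
Proof.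
move=> /(primitive_lip T)[K HK]; exists (`|F 0| + `|K| * `|T|) => t /andP[t0 tT].
rewrite -[F t](subrK (F 0)) addrC; apply: le_trans (ler_normD _ _) _; rewrite lerD2l.
apply: le_trans (HK 0 t _ t0 tT) _ => //; rewrite subr0.
apply: (@le_trans _ _ (`|K| * t)); first by rewrite ler_wpM2r // ler_norm.
by rewrite ler_wpM2l //; apply: le_trans tT _; exact: ler_norm.
Qed.

(** On each [0, b] the factors are Lipschitz and bounded, so their product is Lipschitz, hence
    absolutely continuous; the product rule almost everywhere then integrates. *)
Lemma primitiveM F f G g : continuous F -> continuous G -> primitive F f ->
  primitive G g ->
  primitive (fun t => F t * G t) (fun t => f t * G t + F t * g t).
Proof.
move=> cF cG pF pG; apply: primitive_of_ac.
- by apply: loc_boundedD; apply: loc_boundedM => //;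
  [exact: pF.1|exact: loc_bounded_cont|exact: loc_bounded_cont|exact: pG.1].
- move=> b b0; have [K HK] := primitive_lip b pF; have [L HL] := primitive_lip b pG.
  have [A HA] := primitive_bound b pF; have [B HB] := primitive_bound b pG.
  apply: (@ac_lipschitz _ _ (K * B + A * L)) => s t.
  rewrite /= !in_itv /= => /andP[s0 sb] /andP[t0 tb] st.
  have -> : F t * G t - F s * G s = (F t - F s) * G t + F s * (G t - G s) by ring.
  apply: le_trans (ler_normD _ _) _; rewrite !normrM.
  have -> : (K * B + A * L) * (t - s) = K * (t - s) * B + A * (L * (t - s)) by ring.
  by apply: lerD; apply: ler_pM => //; [apply: HK|apply: HB; rewrite t0|apply: HA;
    rewrite s0|apply: HL].
- apply: ae_imp2 (primitive_derive pF) (primitive_derive pG) => t H1 H2 t0.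
  have -> : f t * G t + F t * g t = F t *: g t + G t *: f t.
    by rewrite /GRing.scale /=; ring.
  by apply: is_deriveM; [exact: H1|exact: H2].
Qed.

Lemma continuous_expR_scale k : continuous (fun t : R => expR (k * t)).
Proof.
move=> x; apply: (@continuous_comp _ _ _ (fun t => k * t) expR);
  last exact: continuous_expR.
by apply: cvgM; [exact: cvg_cst|exact: cvg_id].
Qed.

Lemma primitive_expR k : primitive (fun t => expR (k * t)) (fun t => k * expR (k * t)).
Proof.
have ce := @continuous_expR_scale k.
have de (x : R) : is_derive x (1 : R) (fun t : R => expR (k * t)) (k * expR (k * x)).
  rewrite mulrC; apply: (@is_derive1_comp _ expR (fun t => k * t)).
  rewrite -[X in is_derive _ _ _ X]mulr1; apply: is_deriveZ.
split; first by apply: loc_boundedZ; exact: loc_bounded_cont.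
move=> s t s0; rewrite le_eqVlt => /predU1P[->|st]; first by rewrite itg_xx subrr.
rewrite /itg /Rintegral (@continuous_FTC2 _ (fun t => k * expR (k * t)) (fun t => expR
  (k * t))) //.
- apply: continuous_subspaceT => x; apply: cvgM; [exact: cvg_cst|exact: ce].
- split; first by move=> x _; exact: (@ex_derive _ _ _ _ _ _ _ (de x)).
  + by apply: cvg_at_right_filter; exact: ce.
  + by apply: cvg_at_left_filter; exact: ce.
- by move=> x _; rewrite derive1E; exact: (@derive_val _ _ _ _ _ _ _ (de x)).
Qed.

Lemma primitive_le F f a b (B : R) : primitive F f -> 0 <= a -> a <= b ->
  (forall t, a <= t <= b -> f t <= B) -> F b - F a <= B * (b - a).
Proof. by move=> [hf Ff] a0 ab fB; rewrite Ff //; exact: itg_le_cst. Qed.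

(** The function exp(- k t) (F + m / k) has a nonpositive derivative. Both signs of k occur:
    [growth_rate] for growth, - 3 c for decay. *)
Lemma primitive_gronwall F f a b (k m : R) : k != 0 -> continuous F -> primitive F f ->
  0 <= a -> a <= b -> (forall t, a <= t <= b -> f t <= k * F t + m) ->
  F b + m / k <= expR (k * (b - a)) * (F a + m / k).
Proof.
move=> k0 cF pF a0 ab H.
have pE := primitive_expR (- k).
have pG : primitive (fun t => F t + m / k) f.
  by have := primitiveD pF (primitive_cst (m / k));
    under [X in primitive _ X]eq_fun do rewrite addr0.
have cG : continuous (fun t => F t + m / k).
  by move=> x; apply: cvgD; [exact: cF|exact: cvg_cst].
have := primitive_le (B := 0) (primitiveM (@continuous_expR_scale (- k)) cG pE pG) a0 ab.
rewrite mul0r subr_le0 => Hle;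
  have {Hle} : expR (- k * b) * (F b + m / k) <= expR (- k * a) * (F a + m / k).
  apply: Hle.
  move=> t tab; have := H t tab; rewrite -subr_ge0 => h.
  have -> : - k * expR (- k * t) * (F t + m / k) + expR (- k * t) * f t =
    - (expR (- k * t) * (k * F t + m - f t)) by field.
  by rewrite oppr_le0 mulr_ge0 // expR_ge0.
move=> h; have := ler_wpM2l (expR_ge0 (k * b)) h.
rewrite !mulrA -!expRD mulNr subrr expR0 mul1r; congr (_ <= expR _ * _); ring.
Qed.

End primitive.

(** * Truncations and last exit times *)

Section real_functions.
Variable R : realType.
Implicit Types (s t a b : R) (f x : R -> R).

Lemma pos_part_ge0 (b : R) : 0 <= pos_part b.
Proof. by rewrite /pos_part le_max lexx orbT. Qed.

Lemma pos_part_ge (b : R) : b <= pos_part b.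
Proof. by rewrite /pos_part le_max lexx. Qed.

Lemma pos_part_continuous (f : R -> R) : continuous f ->
  continuous (fun t => pos_part (f t)).
Proof. by move=> cf t; apply: continuous_max; [exact: cf|exact: cvg_cst]. Qed.

Lemma sqr_continuous (f : R -> R) : continuous f -> continuous (fun t => f t ^+ 2).
Proof.
have -> : (fun t => f t ^+ 2) = (fun t => f t * f t) by apply/funext => s; rewrite expr2.
by move=> cf t; exact: cvgM (cf t) (cf t).
Qed.

Lemma max_contract (d a b : R) : `|Num.max d a - Num.max d b| <= `|a - b|.
Proof.
by case: (leP d a) => h1; case: (leP d b) => h2; rewrite ?subrr ?normr0 //; 
  rewrite !ler_norml; have := ler_norm (a - b); have := ler_norm (b - a);
  rewrite (distrC b); move=> *; apply/andP; split; lra.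
Qed.

Definition clamp (b a : R) : R := Num.max (- b) (Num.min a b).

Lemma clamp_norm (b a : R) : 0 <= b -> `|clamp b a| <= b.
Proof.
move=> b0; rewrite /clamp ler_norml le_max lexx /= ge_max ge_min lexx orbT andbT; lra.
Qed.

Lemma clamp_id (b a : R) : `|a| <= b -> clamp b a = a.
Proof. by rewrite ler_norml /clamp => /andP[h1 h2]; rewrite min_l // max_r. Qed.

Lemma clamp_contract (b a a' : R) : `|clamp b a - clamp b a'| <= `|a - a'|.
Proof.
apply: le_trans (max_contract _ _ _) _.
have E v : Num.min v b = - Num.max (- b) (- v) by rewrite oppr_max !opprK minC.
rewrite !E -opprD normrN; apply: le_trans (max_contract _ _ _) _.
by rewrite -opprD normrN.
Qed.

(** Since truncation preserves signs, the damping term stays dissipative in the truncated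
    equation. *)
Lemma clamp_mul_ge0 (b a : R) : 0 <= b -> 0 <= a * clamp b a.
Proof.
move=> b0; have [a0|/ltW a0] := leP 0 a.
  by rewrite mulr_ge0 // /clamp le_max le_min a0 b0 orbT.
by rewrite mulr_le0 // /clamp ge_max ge_min a0 /= andbT; lra.
Qed.

(** Avoids a square root, so that later bounds are built by sums, products and powers only. *)
Lemma norm_le_sqr (a b : R) : a ^+ 2 <= b -> `|a| <= 1 + b.
Proof.
move=> h; have : 0 <= (`|a| - 1) ^+ 2 by exact: sqr_ge0.
rewrite sqrrB -normrX ger0_norm ?sqr_ge0 // expr1n mulr1.
have := normr_ge0 a; lra.
Qed.

Lemma sqr_le_norm (a b : R) : 0 <= b -> a ^+ 2 <= b ^+ 2 -> `|a| <= b.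
Proof.
move=> b0; rewrite -[a ^+ 2]ger0_norm ?sqr_ge0 // normrX.
by rewrite ler_pXn2r ?nnegrE.
Qed.

(** The point s is the infimum of the times from which V stays above l until b. A bound on V b is
    thereby reduced to an interval on which V >= l, where the differential inequalities hold. *)
Lemma last_exit (V : R -> R) (l a b : R) : continuous V -> a <= b -> l <= V b ->
  exists s, [/\ a <= s <= b, s = a \/ V s = l & forall v, s <= v <= b -> l <= V v].
Proof.
move=> cV ab lb.
pose S := [set s | a <= s <= b /\ forall v, s <= v <= b -> l <= V v].
have Sb : S b by split=> [|v]; [rewrite ab lexx|rewrite -eq_le => /eqP <-].
have lS : lbound S a by move=> s [/andP[]].
have hS : has_inf S by split; [exists b|exists a].
pose s := inf S.
have as_ : a <= s by apply: lb_le_inf; [exists b|].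
have sb : s <= b by apply: ge_inf; [exists a|].
have Vs_gt v : s < v -> v <= b -> l <= V v.
  move=> sv vb; have [w [_ Hw] wv] := inf_lt hS.1 sv.
  by apply: Hw; rewrite vb ltW.
have near_lt (z : R) (e : R) : V z < e -> exists2 d : R, 0 < d & forall w,
  `|z - w| < d -> V w < e.
  move=> Vz; have /cvgr_lt/(_ _ Vz)/nbhs_ballP[d /= d0 H] := cV z.
  by exists d.
have near_gt (z : R) (e : R) : e < V z -> exists2 d : R, 0 < d & forall w,
  `|z - w| < d -> e < V w.
  move=> Vz; have /cvgr_gt/(_ _ Vz)/nbhs_ballP[d /= d0 H] := cV z.
  by exists d.
have Vs : l <= V s.
  rewrite leNgt; apply/negP => /near_lt[d d0 H].
  have [sb'|sb'] := eqVneq s b.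
    by have := H s; rewrite subrr normr0 sb' => /(_ d0); rewrite ltNge lb.
  have slb : s < b by rewrite lt_neqAle sb' sb.
  have sw : s < Num.min b (s + d / 2) by rewrite lt_min slb; lra.
  have := H (Num.min b (s + d / 2)).
  rewrite distrC (ger0_norm (_ : 0 <= Num.min b (s + d / 2) - s));
    last by rewrite subr_ge0 ltW.
  have : Num.min b (s + d / 2) <= s + d / 2 by rewrite ge_min lexx orbT.
  move=> h /(_ ltac:(lra)); rewrite ltNge Vs_gt //.
  by rewrite ge_min lexx.
have HS v : s <= v <= b -> l <= V v.
  by rewrite le_eqVlt => /andP[/predU1P[<- //|sv] vb]; exact: Vs_gt.
exists s; split=> //; first by rewrite as_ sb.
have [->|sa] := eqVneq s a; first by left.
right; apply/eqP; rewrite eq_le Vs andbT leNgt; apply/negP => /near_gt[d d0 H].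
have alts : a < s by rewrite lt_neqAle eq_sym sa as_.
have : S (Num.max a (s - d / 2)).
  have lts : Num.max a (s - d / 2) < s by rewrite gt_max alts; lra.
  split; first by rewrite le_max lexx /= ltW // (lt_le_trans lts).
  move=> v /andP[]; rewrite ge_max => /andP[_ v1] vb.
  have [sv|vs] := leP s v; first by apply: HS; rewrite sv vb.
  by apply/ltW/H; rewrite gtr0_norm; lra.
move=> /(ge_inf (ex_intro _ a lS)); rewrite -/s le_max => /orP[|]; lra.
Qed.

End real_functions.

(** * Causal Lipschitz integral equations *)

Section picard.
Variable R : realType.

Local Notation half := (2^-1 : R).

Lemma half_pow_small (M e : R) : 0 < e -> exists n, M * half ^+ n < e.
Proof.
move=> e0.
have : (M * half ^+ n @[n --> \oo] --> M * 0).
  by apply: cvgM; [exact: cvg_cst|apply: cvg_expr;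
    rewrite ger0_norm ?invr_ge0 // invf_lt1 // ltr1n].
rewrite mulr0 => /cvgr_lt/(_ e e0)[n _ H]; exists n; exact: H (leqnn n).
Qed.

Lemma half_pow_le0 (x M : R) : (forall n, x <= M * half ^+ n) -> x <= 0.
Proof.
move=> H; rewrite leNgt; apply/negP => x0; have [n] := half_pow_small M x0.
by rewrite ltNge H.
Qed.

(* a n + 2 M / 2^n is nonincreasing and a n - 2 M / 2^n nondecreasing. *)
Lemma geometric_lim (a : nat -> R) (M : R) :
  (forall n, `|a n.+1 - a n| <= M * half ^+ n) ->
  forall n, `|lim (a n @[n --> \oo]) - a n| <= 2 * M * half ^+ n.
Proof.
move=> H.
pose b n := a n + 2 * M * half ^+ n; pose c n := a n - 2 * M * half ^+ n.
have M0 n : 0 <= M * half ^+ n by apply: le_trans (H n).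
have hS n : half ^+ n.+1 = half ^+ n / 2 by rewrite exprSr.
have bS n : b n.+1 <= b n.
  by have := H n; rewrite ler_norml /b hS => /andP[]; lra.
have cS n : c n <= c n.+1.
  by have := H n; rewrite ler_norml /c hS => /andP[]; lra.
have bmono n k : b (n + k)%N <= b n.
  by elim: k => [|k IH]; rewrite ?addn0 // addnS (le_trans (bS _)).
have cmono n k : c n <= c (n + k)%N.
  by elim: k => [|k IH]; rewrite ?addn0 // addnS (le_trans IH).
have cb n m : c n <= b m.
  apply: le_trans (cmono n m) _; rewrite addnC; apply: le_trans (bmono m n).
  by rewrite /c /b; have := M0 (m + n)%N; lra.
pose S := range c.
have hS' : has_sup S by split; [exists (c 0%N), 0%N | exists (b 0%N) => _ [n _ <-]].
pose l := sup S.
have Hl n : `|l - a n| <= 2 * M * half ^+ n.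
  have h1 : c n <= l by apply: ub_le_sup; [exact: hS'.2|exists n].
  have h2 : l <= b n by apply: ge_sup; [exact: hS'.1|move=> _ [m _ <-]].
  by rewrite ler_norml; move: h1 h2; rewrite /c /b => *; apply/andP; split; lra.
suff -> : lim (a n @[n --> \oo]) = l by [].
apply/cvg_lim => //; apply/cvgrPdist_lt => e e0.
have [n Hn] := half_pow_small (2 * M) e0.
exists n => // m /= nm; apply: le_lt_trans (Hl m) _; apply: le_lt_trans Hn.
rewrite -(subnKC nm) exprD mulrA ler_piMr //; first by have := M0 n; lra.
by rewrite exprn_ile1 // invf_le1 // ler1n.
Qed.

Variables (Phi : (R -> R) -> R -> R) (xi : R -> R).
Hypothesis cxi : continuous xi.
Hypothesis Phi_bm : forall x : R -> R, continuous x -> loc_bounded (Phi x).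
Hypothesis Phi_lip : forall T : R, exists K : R, forall x y : R -> R, continuous x ->
  continuous y ->
  (forall s, s <= 0 -> x s = xi s) -> (forall s, s <= 0 -> y s = xi s) ->
  forall t B, 0 <= t <= T -> 0 <= B -> (forall s, 0 <= s <= t -> `|x s - y s| <= B) ->
  `|Phi x t - Phi y t| <= K * B.

(** One formula for both sides of 0: the integral vanishes for t <= 0, and the first term is the
    constant xi 0 for t >= 0. *)
Definition picard_step (x : R -> R) (t : R) := xi (Num.min t 0) + itg (Phi x) 0 t.

Definition picard_sol (x : R -> R) := [/\ continuous x, forall s, s <= 0 -> x s = xi s &
  forall t, 0 <= t -> x t = xi 0 + itg (Phi x) 0 t].

Lemma min0_continuous : continuous (fun t : R => Num.min t 0).
Proof. by move=> x; apply: continuous_min; [exact: cvg_id|exact: cvg_cst]. Qed.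

Lemma picard_step_continuous (x : R -> R) : continuous x -> continuous (picard_step x).
Proof.
move=> cx t; apply: cvgD; last by apply: itg_continuous; exact: Phi_bm.
by apply: continuous_comp; [exact: min0_continuous|exact: cxi].
Qed.

Lemma picard_step_neg x s : s <= 0 -> picard_step x s = xi s.
Proof.
rewrite /picard_step => s0; rewrite min_l //.
move: s0; rewrite le_eqVlt => /predU1P[->|s0]; first by rewrite itg_xx addr0.
by rewrite itg_gt // addr0.
Qed.

Lemma picard_step_pos x t : 0 <= t -> picard_step x t = xi 0 + itg (Phi x) 0 t.
Proof. by move=> t0; rewrite /picard_step min_r. Qed.

(** In the weighted norm sup |x(s)| exp(- 2 K s) the step is a contraction of ratio 1/2 on every
    horizon, which spares a continuation argument. *)
Lemma picard_contract T : exists2 K : R, 0 < K & forall x y : R -> R, continuous x ->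
  continuous y ->
  (forall s, s <= 0 -> x s = xi s) -> (forall s, s <= 0 -> y s = xi s) ->
  forall C, 0 <= C -> (forall s, 0 <= s <= T -> `|x s - y s| <= C * expR (2 * K * s)) ->
  forall t, 0 <= t <= T ->
    `|picard_step x t - picard_step y t| <= C / 2 * expR (2 * K * t).
Proof.
have [K0 HK] := Phi_lip T; pose K := `|K0| + 1; exists K; first by rewrite ltr_wpDl.
have Kp : 0 < K by rewrite ltr_wpDl.
move=> x y cx cy x0 y0 C C0 H t /andP[t0 tT].
rewrite !picard_step_pos // opprD addrACA subrr add0r -itgB; [|exact: Phi_bm..].
have [hE pE] := primitive_expR (2 * K).
have hg : loc_bounded (fun s => C / 2 * (2 * K * expR (2 * K * s))) by apply:
  loc_boundedZ.
(* The integrand K C exp(2 K s) is written as C / 2 times the derivative of exp(2 K s). *)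
apply: (@le_trans _ _ (itg (fun s => C / 2 * (2 * K * expR (2 * K * s))) 0 t)).
  apply: norm_itg_le => //; first by apply: loc_boundedB; exact: Phi_bm.
  move=> s /andP[s0 st]; apply: le_trans.
    apply: (HK x y cx cy x0 y0 s (C * expR (2 * K * s))).
    - by rewrite s0 (le_trans st).
    - by rewrite mulr_ge0 // expR_ge0.
    - move=> v /andP[v0 vs]; apply: le_trans (H v _) _;
      first by rewrite v0 (le_trans vs) // (le_trans st).
      by rewrite ler_wpM2l // ler_expR ler_wpM2l // mulr_ge0 // ltW.
  have -> : C / 2 * (2 * K * expR (2 * K * s)) = K * (C * expR (2 * K * s)) by field.
  apply: ler_wpM2r; first by rewrite mulr_ge0 // expR_ge0.
  by rewrite /K; have := ler_norm K0; lra.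
rewrite itgZ // -pE // ler_wpM2l ?divr_ge0 // mulr0 expR0; lra.
Qed.

Lemma continuous_bounded_itv (f : R -> R) (T : R) : continuous f ->
  exists2 C, 0 <= C & forall s, 0 <= s <= T -> `|f s| <= C.
Proof.
move=> /loc_bounded_cont[_ /(_ T)[B HB]]; exists `|B| => // s /andP[s0 sT].
by apply: le_trans (HB s _) (ler_norm _); rewrite ger0_norm.
Qed.

Lemma picard_unique x y : picard_sol x -> picard_sol y -> forall t, x t = y t.
Proof.
move=> [cx x0 xS] [cy y0 yS] t.
have [t0|t0] := leP t 0; first by rewrite x0 // y0.
have [K K0 HK] := picard_contract t.
have [C C0 HC] := @continuous_bounded_itv (fun s => x s - y s) t (fun s => cvgB (cx s)
  (cy s)).
have key n : forall s, 0 <= s <= t -> `|x s - y s| <= C * half ^+ n * expR (2 * K * s).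
  elim: n => [|n IH] s /andP[s0 st].
    rewrite expr0 mulr1; apply: le_trans (HC s _) _; first by rewrite s0.
    by rewrite ler_peMr // -expR0 ler_expR mulr_ge0 // mulr_ge0 // ltW.
  rewrite xS // yS // -!picard_step_pos // exprSr mulrA.
  by apply: HK => //; [rewrite mulr_ge0 // exprn_ge0|rewrite s0].
apply/eqP; rewrite -subr_eq0 -normr_le0;
  apply: (@half_pow_le0 _ (C * expR (2 * K * t))) => n.
by apply: le_trans (key n t _) _; [rewrite lexx ltW|rewrite mulrAC].
Qed.

Lemma picard_exists : exists x, picard_sol x.
Proof.
pose xx n := iter n picard_step (fun t => xi (Num.min t 0)).
have cxx n : continuous (xx n).
  elim: n => [|n IH]; last exact: picard_step_continuous.
  by move=> t; apply: continuous_comp; [exact: min0_continuous|exact: cxi].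
have x0 n s : s <= 0 -> xx n s = xi s.
  by case: n => [|n] s0; [rewrite /xx /= min_l|exact: picard_step_neg].
have inc T : exists2 M, 0 <= M & forall n s, s <= T ->
  `|xx n.+1 s - xx n s| <= M * half ^+ n.
  have [K K0 HK] := picard_contract T.
  have [C C0 HC] := @continuous_bounded_itv (fun s => xx 1%N s - xx 0%N s) T
     (fun s => cvgB (cxx 1%N s) (cxx 0%N s)).
  have key n : forall s, 0 <= s <= T ->
    `|xx n.+1 s - xx n s| <= C * half ^+ n * expR (2 * K * s).
    elim: n => [|n IH] s /andP[s0 st].
      rewrite expr0 mulr1; apply: le_trans (HC s _) _; first by rewrite s0.
      by rewrite ler_peMr // -expR0 ler_expR mulr_ge0 // mulr_ge0 // ltW.
    rewrite exprSr mulrA; apply: (HK (xx n.+1) (xx n)) => //; try exact: x0;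
      try exact: cxx.
      by rewrite mulr_ge0 // exprn_ge0.
    by rewrite s0.
  exists (C * expR (2 * K * T)); first by rewrite mulr_ge0 // expR_ge0.
  move=> n s sT; have [s0|s0] := leP s 0.
    by rewrite !x0 // subrr normr0 !mulr_ge0 // ?expR_ge0 // exprn_ge0.
  apply: le_trans (key n s _) _; first by rewrite sT ltW.
  rewrite mulrAC; apply: ler_wpM2r; first by rewrite exprn_ge0.
  by rewrite ler_wpM2l // ler_expR ler_wpM2l // mulr_ge0 // ltW.
pose x t := lim (xx n t @[n --> \oo]).
have xlim T : exists2 M, 0 <= M & forall n s, s <= T -> `|x s - xx n s| <= M * half ^+ n.
  have [M M0 HM] := inc T; exists (2 * M) => [|n s sT]; first by rewrite mulr_ge0.
  by apply: (@geometric_lim (fun n => xx n s)) => m; exact: HM.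
have cx : continuous x.
  move=> t; apply/cvgrPdist_le => e e0.
  (* Convergence is uniform on each half-line ]-oo, T] only; T = t + 1 leaves a neighbourhood of
     t. *)
  have [M M0 HM] := xlim (t + 1).
  have e30 : 0 < e / 3 by rewrite divr_gt0.
  have [n Hn] := half_pow_small M e30.
  have cn := cxx n t; move/cvgrPdist_le : cn => /(_ _ e30) cn.
  near=> s.
  have st : s <= t + 1.
    have : `|t - s| < 1 by near: s; apply: cvgr_dist_lt.
    by rewrite ltr_norml => /andP[]; lra.
  have h1 : `|xx n t - xx n s| <= e / 3 by near: s.
  have h2 := HM n s st; have h3 : `|x t - xx n t| <= M * half ^+ n by apply: HM; lra.
  move: h1 h2 h3; rewrite !ler_norml => /andP[? ?] /andP[? ?] /andP[? ?].
  apply/andP; split; lra.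
have xneg s : s <= 0 -> x s = xi s.
  move=> s0; apply/cvg_lim => //.
  by under eq_fun do rewrite x0 //; exact: cvg_cst.
exists x; split=> // t t0; rewrite -picard_step_pos //.
have [M M0 HM] := xlim t; have [K HK] := Phi_lip t.
apply/eqP; rewrite -subr_eq0 -normr_le0.
apply: (@half_pow_le0 _ (M + `|K| * M * t)) => n.
have h1 := HM n.+1 t (lexx _).
have h2 : `|xx n.+1 t - picard_step x t| <= `|K| * M * t * half ^+ n.
  rewrite [xx n.+1]/= !picard_step_pos // opprD addrACA subrr add0r -itgB;
    [|exact: Phi_bm..].
  apply: le_trans (norm_itg_le_cst (k := `|K| * (M * half ^+ n)) _ t0 _) _.
  - by apply: loc_boundedB; exact: Phi_bm.
  - move=> s /andP[s0 st]; apply: le_trans (_ : K * (M * half ^+ n) <= _); last first.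
      by rewrite ler_wpM2r ?ler_norm // mulr_ge0 // exprn_ge0.
    apply: HK => //; first exact: x0.
    + by rewrite s0.
    + by rewrite mulr_ge0 // exprn_ge0.
    + by move=> v /andP[v0 vs]; rewrite distrC; apply: HM; lra.
  by rewrite subr0 le_eqVlt; apply/orP; left; apply/eqP; ring.
rewrite -(subrK (xx n.+1 t) (x t)) -addrA; apply: le_trans (ler_normD _ _) _.
rewrite mulrDl; apply: lerD => //; apply: le_trans h1 _.
by rewrite ler_wpM2l // exprSr ler_piMr ?exprn_ge0 // invf_le1 // ler1n.
Unshelve. all: by end_near. Qed.

End picard.

(** * Calculus of causal Lipschitz functionals *)

Section causal_lip.
Variable R : realType.
Variables (xi : R -> R) (C T : R).
Implicit Types (s t B : R) (f g x y : R -> R) (G H : (R -> R) -> R -> R).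

Definition admissible x := [/\ continuous x, forall s, s <= 0 -> x s = xi s &
  forall s, s <= T -> `|x s| <= C].

(** A bound is bundled with the Lipschitz estimate because products need both. It is available since
    [admissible] functions are bounded by C, which the truncation of x ensures. *)
Definition causal_lip G := exists2 K : R, 0 <= K & forall x y, admissible x ->
  admissible y ->
  forall t B, 0 <= t <= T -> 0 <= B -> (forall s, 0 <= s <= t -> `|x s - y s| <= B) ->
  `|G x t| <= K /\ `|G x t - G y t| <= K * B.

Lemma causal_lip_eval : causal_lip (fun x t => x t).
Proof.
exists (`|C| + 1) => // x y [_ _ xC] _ t B /andP[t0 tT] B0 xyB; split.
  by apply: le_trans (xC t tT) _; have := ler_norm C; lra.
have := xyB t; rewrite lexx t0 => /(_ isT) h; apply: le_trans h _.
by rewrite ler_peMl // lerDr.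
Qed.

Lemma causal_lip_fun g : (exists K, forall t, 0 <= t <= T -> `|g t| <= K) ->
  causal_lip (fun=> g).
Proof.
move=> [K HK]; exists `|K| => // x y _ _ t B tT B0 _; split.
  by apply: le_trans (HK t tT) (ler_norm _).
by rewrite subrr normr0 mulr_ge0.
Qed.

Lemma causal_lip_cont g : continuous g -> causal_lip (fun=> g).
Proof.
by move=> cg; apply: causal_lip_fun; have [K _ HK] := continuous_bounded_itv T cg;
  exists K.
Qed.

Lemma causal_lipD G H : causal_lip G -> causal_lip H ->
  causal_lip (fun x t => G x t + H x t).
Proof.
move=> [K K0 HK] [L L0 HL]; exists (K + L); first exact: addr_ge0.
move=> x y ax ay t B tT B0 xyB.
have [h1 h2] := HK x y ax ay t B tT B0 xyB; have [h3 h4] := HL x y ax ay t B tT B0 xyB.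
split; first by apply: le_trans (ler_normD _ _) _; exact: lerD.
have -> : G x t + H x t - (G y t + H y t) = (G x t - G y t) + (H x t - H y t) by ring.
by apply: le_trans (ler_normD _ _) _; rewrite mulrDl; exact: lerD.
Qed.

Lemma causal_lipM G H : causal_lip G -> causal_lip H ->
  causal_lip (fun x t => G x t * H x t).
Proof.
move=> [K K0 HK] [L L0 HL]; exists (2 * (K * L)); first by rewrite !mulr_ge0.
move=> x y ax ay t B tT B0 xyB.
have [h1 h2] := HK x y ax ay t B tT B0 xyB; have [h3 h4] := HL x y ax ay t B tT B0 xyB.
(* The bound is stated for the first argument only; the pair (y, y) with B = 0 gives it for y. *)
have [h5 _] := HL y y ay ay t 0 tT (lexx _) (fun s _ => ltac:(by rewrite subrr normr0)).
split.
  by rewrite normrM; apply: le_trans (ler_pM _ _ h1 h3) _ => //;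
    have := mulr_ge0 K0 L0; lra.
have -> : G x t * H x t - G y t * H y t = G x t * (H x t - H y t) + (G x t - G y t) * H
  y t by ring.
apply: le_trans (ler_normD _ _) _; rewrite !normrM.
have -> : 2 * (K * L) * B = K * (L * B) + (K * B) * L by ring.
by apply: lerD; apply: ler_pM.
Qed.

Lemma causal_lip_contract (phi : R -> R -> R) G :
  (forall t a b, `|phi t a - phi t b| <= `|a - b|) ->
  (exists K, forall t, 0 <= t <= T -> `|phi t 0| <= K) ->
  causal_lip G -> causal_lip (fun x t => phi t (G x t)).
Proof.
move=> hphi [M HM] [K K0 HK]; exists (K + `|M|); first by rewrite addr_ge0.
move=> x y ax ay t B tT B0 xyB; have [h1 h2] := HK x y ax ay t B tT B0 xyB.
split.
  rewrite -(subrK (phi t 0) (phi t (G x t))); apply: le_trans (ler_normD _ _) _;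
    apply: lerD.
    by apply: le_trans (hphi _ _ _) _; rewrite subr0.
  by apply: le_trans (HM t tT) (ler_norm _).
apply: le_trans (hphi _ _ _) _; apply: le_trans h2 _.
by rewrite mulrDl lerDl mulr_ge0.
Qed.

Lemma causal_lip_max g G : continuous g -> causal_lip G ->
  causal_lip (fun x t => Num.max (g t) (G x t)).
Proof.
move=> cg; apply: (@causal_lip_contract (fun t a => Num.max (g t) a)).
  by move=> t a b; exact: max_contract.
have cm : continuous (fun t => Num.max (g t) 0).
  by move=> t; apply: continuous_max; [exact: cg|exact: cvg_cst].
by have [K _ HK] := continuous_bounded_itv T cm; exists K.
Qed.

Lemma causal_lip_pos_part G : causal_lip G -> causal_lip (fun x t => pos_part (G x t)).
Proof.
apply: (@causal_lip_contract (fun=> (@pos_part R))) => [_ a b|].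
  by rewrite /pos_part ![Num.max _ 0]maxC; exact: max_contract.
by exists 0 => t _; rewrite /pos_part maxxx normr0.
Qed.

(** The inverse is Lipschitz away from 0 only: this is why the denominator of the gain is truncated
    from below. *)
Lemma causal_lipV G (e : R) : 0 < e ->
  (forall x t, admissible x -> 0 <= t <= T -> e <= G x t) ->
  causal_lip G -> causal_lip (fun x t => (G x t)^-1).
Proof.
move=> e0 Ge [K K0 HK]; exists (e^-1 + K * e^-1 * e^-1).
  by rewrite addr_ge0 ?mulr_ge0 // invr_ge0 ltW.
move=> x y ax ay t B tT B0 xyB; have [h1 h2] := HK x y ax ay t B tT B0 xyB.
have gx := Ge x t ax tT; have gy := Ge y t ay tT.
have gx0 : 0 < G x t by exact: lt_le_trans gx.
have gy0 : 0 < G y t by exact: lt_le_trans gy.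
have nv v : 0 < v -> e <= v -> `|v^-1| <= e^-1.
  by move=> v0 ev; rewrite gtr0_norm ?invr_gt0 // lef_pV2 ?posrE.
split.
  by apply: le_trans (nv _ gx0 gx) _; rewrite lerDl !mulr_ge0 // invr_ge0 ltW.
have -> : (G x t)^-1 - (G y t)^-1 = - (G x t - G y t) * (G x t)^-1 * (G y t)^-1.
  by field; rewrite !gt_eqF.
rewrite !normrM normrN mulrDl; apply: ler_wpDl; first by rewrite mulr_ge0 // invr_ge0 ltW.
have -> : K * e^-1 * e^-1 * B = K * B * e^-1 * e^-1 by ring.
by apply: ler_pM; rewrite ?mulr_ge0 ?nv //; apply: ler_pM; rewrite ?nv.
Qed.

(** Used for v = 0 and v = r, whose difference is the window integral [win]. *)
Lemma causal_lip_itg_shift (H : (R -> R) -> R -> R) (v : R) : 0 <= v ->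
  (forall x, continuous x -> loc_bounded (H x)) ->
  causal_lip H -> causal_lip (fun x t => itg (H x) 0 (t - v)).
Proof.
move=> v0 bH [K K0 HK]; exists (K * `|T|); first by rewrite mulr_ge0.
move=> x y ax ay t B /andP[t0 tT] B0 xyB.
have [tv|tv] := leP 0 (t - v); last by rewrite !itg_gt // subrr normr0 !mulr_ge0.
have [cx _ _] := ax; have [cy _ _] := ay.
have tvT : t - v <= `|T| by apply: le_trans (ler_norm _); lra.
have hs s : 0 <= s <= t - v -> 0 <= s <= T by move=> /andP[? ?]; apply/andP; split; lra.
split.
  apply: (@le_trans _ _ (K * (t - v - 0))); last by rewrite subr0 ler_wpM2l.
  apply: norm_itg_le_cst => //; first exact: bH.
  by move=> s /hs sT; have [] := HK x x ax ax s 0 sT (lexx _) (fun s _ => ltac:(by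
    rewrite subrr normr0)).
rewrite -itgB; [|exact: bH..].
apply: (@le_trans _ _ (K * B * (t - v - 0))); last first.
  by rewrite subr0 mulrAC ler_wpM2r // ler_wpM2l.
apply: norm_itg_le_cst => //; first by apply: loc_boundedB; exact: bH.
move=> s hs1; have sT := hs s hs1; move: hs1 => /andP[s0 stv].
have [] := HK x y ax ay s B sT B0 _ => // w /andP[w0 ws]; apply: xyB.
by apply/andP; split; lra.
Qed.

End causal_lip.

(** * The closed loop *)

Section model.
Variable R : realType.
Variables (eps c r theta : R).
Hypotheses (eps0 : 0 < eps) (c0 : 0 < c) (r0 : 0 < r).
Variables (xi ui dd : R -> R).
Implicit Types (s t : R) (f g x u m : R -> R).

(* As itg f a b = 0 for b < a, win f t is, for t >= 0, the integral of f over
   [max(0, t - r), t], and past f t its integral over [min(t - r, 0), 0]. *)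
Definition win (f : R -> R) (t : R) := itg f 0 t - itg f 0 (t - r).

Definition past (f : R -> R) (t : R) :=
  itg f (- r) 0 - itg f (- r) (Num.min (t - r) 0).

Lemma past_ge f t : r <= t -> past f t = 0.
Proof. by move=> rt; rewrite /past min_r ?subrr // subr_ge0. Qed.

Lemma win_ge f t : loc_bounded f -> r <= t -> win f t = itg f (t - r) t.
Proof.
move=> hf rt; have rp := r0; have h1 : 0 <= t - r by lra.
by rewrite /win -(@itg_chasles _ f 0 (t - r) t) //; [ring|lra].
Qed.

Lemma win_le f t : t <= r -> win f t = itg f 0 t.
Proof.
rewrite le_eqVlt => /predU1P[->|tr]; rewrite /win; first by rewrite subrr itg_xx subr0.
by rewrite (itg_gt _ (_ : t - r < 0)) ?subr0 // subr_lt0.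
Qed.

Lemma past_le f t : loc_bounded f -> 0 <= t <= r -> past f t = itg f (t - r) 0.
Proof.
move=> hf /andP[t0 tr]; rewrite /past min_l; last lra.
by rewrite -(@itg_chasles _ f (- r) (t - r) 0) //; [ring|lra|lra].
Qed.

Lemma past_win f t : loc_bounded f -> 0 <= t -> past f t + win f t = itg f (t - r) t.
Proof.
move=> hf t0; have [tr|/ltW rt] := leP t r.
  by rewrite past_le ?t0 // win_le // itg_chasles //; lra.
by rewrite past_ge // add0r win_ge.
Qed.

Lemma eq_past f g t : 0 <= t -> (forall s, s <= 0 -> f s = g s) -> past f t = past g t.
Proof.
move=> t0 fg; rewrite /past; congr (_ - _).
  by apply: eq_itg => s /andP[_]; exact: fg.
by apply: eq_itg => s /andP[_]; rewrite le_min => /andP[_]; exact: fg.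
Qed.

Lemma win_continuous f : loc_bounded f -> continuous (win f).
Proof.
move=> hf t; apply: cvgB; first exact: itg_continuous.
apply: (@continuous_comp _ _ _ (fun t => t - r) (itg f 0)); last exact: itg_continuous.
by apply: cvgB; [exact: cvg_id|exact: cvg_cst].
Qed.

Lemma min_shift_continuous : continuous (fun t : R => Num.min (t - r) 0).
Proof.
move=> t; apply: (@continuous_comp _ _ _ (fun t => t - r) (fun t => Num.min t 0)).
  by apply: cvgB; [exact: cvg_id|exact: cvg_cst].
exact: min0_continuous.
Qed.

Lemma past_continuous f : loc_bounded f -> continuous (past f).
Proof.
move=> hf t; apply: cvgB; first exact: cvg_cst.
apply: (@continuous_comp _ _ _ (fun t => Num.min (t - r) 0) (itg f (- r))).
  exact: min_shift_continuous.
exact: itg_continuous.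
Qed.

(* Extended constantly, xi and ui are the initial histories on the whole half
   line (-oo, 0]. *)
Definition hist_excess t := xi 0 ^+ 2 - xi (Num.min (t - r) 0) ^+ 2
  - 2 * past (fun s => xi s * ui s) t.

(** This is ||x_t||^2, see [energyE]. The part before time 0 is computed from xi, so that it is a
    mere function of t in the Lipschitz calculus. *)
Definition energy (x : R -> R) t :=
  past (fun s => xi s ^+ 2) t + win (fun s => x s ^+ 2) t.

Definition power (x : R -> R) := win (fun s => x s * (theta * x s + dd s)).

(** The argument of the positive part in p once u is eliminated. *)
Definition excess (x : R -> R) t := hist_excess t + 2 * power x t.

Definition denom (x : R -> R) t := energy x t + pos_part (eps ^+ 2 - x t ^+ 2).

(** The parameter m is a lower truncation level: m = 0 gives back p ([p_funE]), and m =
    [trunc_denom] gives the Lipschitz version. *)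
Definition gain (m x : R -> R) t :=
  (pos_part (excess x t) + c * r * x t ^+ 2) / (2 * Num.max (m t) (denom x t)).

Definition feedback (m x : R -> R) t := - (2 * c + gain m x t) * x t.

Hypotheses (cxi : continuous xi) (cui : continuous ui) (hdd : loc_bounded dd).

Lemma itg_shift (f : R -> R) t : continuous f ->
  itg (fun s => f (t + s)) (- r) 0 = itg f (t - r) t.
Proof.
move=> cf; have rp := r0.
have cft : continuous (fun s => f (t + s)).
  move=> x; apply: (@continuous_comp _ _ _ (fun s => t + s) f); last exact: cf.
  by apply: cvgD; [exact: cvg_cst|exact: cvg_id].
(* Starting one unit earlier puts the whole closed window inside the region where F is
   differentiable. *)
pose F := itg f (t - r - 1).
have cF : continuous F by apply: itg_continuous; exact: loc_bounded_cont.
have dF (x : R) : t - r - 1 < x -> is_derive x (1 : R) F (f x).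
  move=> hx; have [|||dF <-] := @continuous_FTC1_closed _ f (t - r - 1) x (x + 1) _ _ hx.
  - lra.
  - by apply: loc_bounded_integrable; exact: loc_bounded_cont.
  - exact: cf.
  by rewrite derive1E; exact: derivableP.
have cG : continuous (fun s => F (t + s)).
  move=> x; apply: (@continuous_comp _ _ _ (fun s => t + s) F); last exact: cF.
  by apply: cvgD; [exact: cvg_cst|exact: cvg_id].
have dG s : - r - 1 < s -> is_derive s (1 : R) (fun s => F (t + s)) (f (t + s)).
  move=> hs; rewrite -[f _]mulr1; apply: (@is_derive1_comp _ F (fun s => t + s)).
    by apply: dF; lra.
  by rewrite -[X in is_derive _ _ _ X]add0r; apply: is_deriveD.
rewrite {1}/itg /Rintegral (@continuous_FTC2 _ (fun s => f (t + s)) (fun s => F (t +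
  s))) //=.
- rewrite addr0 /F -(@itg_chasles _ f (t - r - 1) (t - r) t);
  [|exact: loc_bounded_cont|lra|lra].
  by rewrite addrAC subrr add0r.
- lra.
- by apply: continuous_subspaceT.
- split.
  + move=> x; rewrite in_itv /= => /andP[h _]; apply: ex_derive; apply: dG; lra.
  + by apply: cvg_at_right_filter; exact: cG.
  + by apply: cvg_at_left_filter; exact: cG.
- move=> x; rewrite in_itv /= => /andP[h _]; rewrite derive1E; apply: derive_val;
  apply: dG; lra.
Qed.

Lemma energyE x t : continuous x -> (forall s, s <= 0 -> x s = xi s) -> 0 <= t ->
  energy x t = itg (fun s => x s ^+ 2) (t - r) t.
Proof.
move=> cx xn t0; rewrite -past_win //; last by apply: loc_boundedX;
  exact: loc_bounded_cont.
by congr (_ + _); apply: eq_past => // s s0; rewrite xn.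
Qed.

(* The elimination of u. *)
Lemma excessE x u t : continuous x -> continuous u ->
  (forall s, s <= 0 -> x s = xi s) -> (forall s, s <= 0 -> u s = ui s) ->
  primitive x (fun s => theta * x s + u s + dd s) -> 0 <= t ->
  excess x t = x t ^+ 2 - x (t - r) ^+ 2 - 2 * itg (fun s => x s * u s) (t - r) t.
Proof.
move=> cx cu xn un px t0; have rp := r0.
have hx := loc_bounded_cont cx; have hu := loc_bounded_cont cu.
have hxu : loc_bounded (fun s => x s * u s) by exact: loc_boundedM.
have hxd : loc_bounded (fun s => x s * (theta * x s + dd s)).
  by apply: loc_boundedM => //; apply: loc_boundedD => //; exact: loc_boundedZ.
rewrite -(past_win hxu t0).
have -> : past (fun s => x s * u s) t = past (fun s => xi s * ui s) t.
  by apply: eq_past => // s s0; rewrite xn // un.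
rewrite /excess /hist_excess /power.
have [_ sq] := primitiveM cx cx px px.
have key s : 0 <= s -> s <= t -> x t ^+ 2 - x s ^+ 2 =
    2 * itg (fun s => x s * (theta * x s + dd s)) s t + 2 * itg (fun s => x s * u s) s t.
  move=> s0 st; rewrite !expr2 sq // -!itgZ // -itgD; [|exact: loc_boundedZ..].
  by apply: eq_itg => v _; ring.
have [tr|/ltW rt] := leP t r.
  rewrite !win_le // min_l; last lra.
  rewrite (xn (t - r)); last lra.
  by have := key 0 (lexx _) t0; rewrite (xn 0) //; lra.
rewrite !win_ge // past_ge // min_r; last lra.
by have := key (t - r) ltac:(lra) ltac:(lra); lra.
Qed.

Lemma energy_ge0 x t : continuous x -> (forall s, s <= 0 -> x s = xi s) -> 0 <= t ->
  0 <= energy x t.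
Proof. by move=> cx xn t0; rewrite energyE //; apply: itg_ge0 => s _; exact: sqr_ge0. Qed.

Lemma denom_ge0 x t : continuous x -> (forall s, s <= 0 -> x s = xi s) -> 0 <= t ->
  0 <= denom x t.
Proof. by move=> cx xn t0; rewrite addr_ge0 ?energy_ge0 // pos_part_ge0. Qed.

(** The formula for [excess] is a hypothesis so that the lemma also covers the initial data at t =
    0, where no differential equation is at hand ([initial_compat]). *)
Lemma p_funE x u t : continuous x -> continuous u ->
  (forall s, s <= 0 -> x s = xi s) -> 0 <= t ->
  excess x t = x t ^+ 2 - x (t - r) ^+ 2 - 2 * itg (fun s => x s * u s) (t - r) t ->
  p_fun eps c r (history x t) (history u t) = gain (fun=> 0) x t.
Proof.
move=> cx cu xn t0 Ex; rewrite /p_fun /gain Ex /dot_r /norm2_r /history addr0.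
have hxu : continuous (fun s => x s * u s) by move=> s; exact: cvgM (cx s) (cu s).
have hxx : continuous (fun s => x s ^+ 2).
  by move=> s; under eq_fun do rewrite expr2; exact: cvgM (cx s) (cx s).
have := itg_shift t hxu; rewrite /itg => ->; have := itg_shift t hxx;
  rewrite {1}/itg => ->.
rewrite -/(itg _ _ _) sqr_sqrtr; last by apply: itg_ge0 => s _; exact: sqr_ge0.
rewrite max_r; last exact: denom_ge0.
by rewrite /denom energyE.
Qed.

Lemma hist_excess_continuous : continuous hist_excess.
Proof.
have h : continuous (fun t => xi (Num.min (t - r) 0)).
  move=> t; apply: (@continuous_comp _ _ _ (fun t => Num.min (t - r) 0) xi);
    last exact: cxi.
  exact: min_shift_continuous.
have hp : continuous (past (fun s => xi s * ui s)).
  by apply: past_continuous; apply: loc_boundedM; exact: loc_bounded_cont.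
move=> t; apply: cvgB; last by apply: cvgM; [exact: cvg_cst|exact: hp].
apply: cvgB; first exact: cvg_cst.
by under eq_fun do rewrite expr2; rewrite expr2; apply: cvgM; exact: h.
Qed.

Lemma denom_continuous x : continuous x -> continuous (denom x).
Proof.
move=> cx t; apply: cvgD.
  apply: cvgD; first by apply: past_continuous; apply: loc_boundedX;
    exact: loc_bounded_cont.
  by apply: win_continuous; apply: loc_boundedX; exact: loc_bounded_cont.
apply: (@pos_part_continuous _ (fun t => eps ^+ 2 - x t ^+ 2)) => s.
by apply: cvgB; [exact: cvg_cst|exact: sqr_continuous].
Qed.

Lemma excess_continuous x : continuous x -> continuous (excess x).
Proof.
move=> cx t; apply: cvgD; first exact: hist_excess_continuous.
apply: cvgM; first exact: cvg_cst.
apply: win_continuous; apply: loc_boundedM; first exact: loc_bounded_cont.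
by apply: loc_boundedD => //; apply: loc_boundedZ; exact: loc_bounded_cont.
Qed.

Lemma feedback_continuous m x : continuous m -> (forall t, 0 < m t) -> continuous x ->
  continuous (feedback m x).
Proof.
move=> cm m0 cx t; apply: cvgM; last exact: cx.
apply: cvgN; apply: cvgD; first exact: cvg_cst.
apply: cvgM.
  apply: cvgD; first by apply: pos_part_continuous; exact: excess_continuous.
  by apply: cvgM; [exact: cvg_cst|exact: sqr_continuous].
apply: cvgV; first by rewrite mulf_neq0 // gt_eqF // lt_max m0.
apply: cvgM; first exact: cvg_cst.
by apply: continuous_max; [exact: cm|exact: denom_continuous].
Qed.

(** * A priori bounds and the lower bound of the denominator *)

Variables (N D : R).
Hypotheses (N0 : 0 <= N) (D0 : 0 <= D).
Hypotheses (dD : forall t, `|dd t| <= D).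
Hypotheses (xiN : forall s, `|xi s| <= N) (uiN : forall s, `|ui s| <= N).
Hypothesis xi_lip : forall s, - r <= s <= 0 -> xi 0 ^+ 2 - xi s ^+ 2 <= 2 * N ^+ 2 * - s.

(** The 1 pays for 2 |x| D <= x^2 + D^2 and makes D^2 / [growth_rate] at most D^2. *)
Definition growth_rate : R := 2 * `|theta| + 1.

Lemma growth_rate_ge1 : 1 <= growth_rate.
Proof. by rewrite /growth_rate; have := normr_ge0 theta; lra. Qed.

Lemma growth_rate_gt0 : 0 < growth_rate.
Proof. exact: lt_le_trans growth_rate_ge1. Qed.

(** What remains of the equation when the damping, whose sign is favourable, is dropped. The true
    and the truncated closed loop share it, so that one a priori bound serves both. *)
Definition dissipative x f := forall t, 0 <= t ->
  x t * f t <= `|theta| * x t ^+ 2 + `|x t| * D.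

Lemma dissipative_sqr x f t : dissipative x f -> 0 <= t ->
  f t * x t + x t * f t <= growth_rate * (x t * x t) + D ^+ 2.
Proof.
move=> dis t0; have := dis t t0; rewrite /growth_rate => h.
have : 0 <= (`|x t| - D) ^+ 2 by exact: sqr_ge0.
rewrite sqrrB -normrX ger0_norm ?sqr_ge0 // => h'.
have -> : x t * x t = x t ^+ 2 by rewrite expr2.
by rewrite [f t * _]mulrC; lra.
Qed.

Lemma growth x f s t : continuous x -> primitive x f -> dissipative x f ->
  0 <= s -> s <= t ->
  x t ^+ 2 + D ^+ 2 / growth_rate <= expR (growth_rate * (t - s)) * (x s ^+ 2 + D ^+ 2
    / growth_rate).
Proof.
move=> cx px dis s0 st; rewrite !expr2.
apply: (primitive_gronwall _ _ (primitiveM cx cx px px)) => //.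
- by rewrite gt_eqF // growth_rate_gt0.
- by move=> v; exact: cvgM (cx v) (cx v).
- by move=> v /andP[sv vt]; rewrite -(expr2 D); apply: dissipative_sqr => //;
  exact: le_trans sv.
Qed.

Lemma D2k_le : 0 <= D ^+ 2 / growth_rate <= D ^+ 2.
Proof.
have kp := growth_rate_gt0; apply/andP; split; first by rewrite divr_ge0 ?sqr_ge0 // ltW.
by rewrite ler_pdivrMr // ler_peMr ?sqr_ge0 // growth_rate_ge1.
Qed.

Lemma growth_le x f s t : continuous x -> primitive x f -> dissipative x f ->
  0 <= s -> s <= t -> x t ^+ 2 <= expR (growth_rate * (t - s)) * (x s ^+ 2 + D ^+ 2).
Proof.
move=> cx px dis s0 st; have := growth cx px dis s0 st; have /andP[h1 h2] := D2k_le.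
have := expR_ge0 (growth_rate * (t - s)); set E := expR _ => E0 h.
have : E * (x s ^+ 2 + D ^+ 2 / growth_rate) <= E * (x s ^+ 2 + D ^+ 2) by rewrite
  ler_wpM2l // lerD2l.
lra.
Qed.

(** The growth bound read backwards: a large x(t)^2 forces a large x(s)^2 before t. *)
Lemma growth_ge x f s t : continuous x -> primitive x f -> dissipative x f ->
  0 <= s -> s <= t -> expR (- (growth_rate * (t - s))) * x t ^+ 2 - D ^+ 2 <= x s ^+ 2.
Proof.
move=> cx px dis s0 st; have := growth cx px dis s0 st; have /andP[h1 h2] := D2k_le.
move=> h; have := ler_wpM2l (expR_ge0 (- (growth_rate * (t - s)))) h.
rewrite mulrA -expRD addNr expR0 mul1r mulrDr.
have : 0 <= expR (- (growth_rate * (t - s))) * (D ^+ 2 / growth_rate) by rewrite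
  mulr_ge0 // expR_ge0.
lra.
Qed.

Definition slope (V : R) : R := growth_rate * V + D ^+ 2 + 2 * N ^+ 2.

(* If V bounds x^2, then x^2 has slope at most slope V, so that either
   x(t)^2 <= eps^2 / 2 or x^2 >= eps^2 / 4 on an interval of length
   1 / (1 / r + 4 slope V / eps^2) ending at t. *)
Definition denom_bound (V : R) : R :=
  2 / eps ^+ 2 + 4 / eps ^+ 2 * (1 / r + 4 * slope V / eps ^+ 2).

Lemma slope_ge0 V : 0 <= V -> 0 <= slope V.
Proof.
by move=> V0; rewrite !addr_ge0 ?mulr_ge0 ?sqr_ge0 // ltW // growth_rate_gt0.
Qed.

Lemma denom_bound_gt0 V : 0 <= V -> 0 < denom_bound V.
Proof.
move=> V0; have e2 : 0 < eps ^+ 2 by rewrite exprn_gt0.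
rewrite ltr_pwDl ?divr_gt0 //; apply: mulr_ge0; first by rewrite divr_ge0 // ltW.
by rewrite addr_ge0 // ?divr_ge0 // ?mulr_ge0 ?slope_ge0 // ltW.
Qed.

(** To reach back to s = - r, the increment is split at 0; the history part is covered by [xi_lip]
    and accounts for 2 N^2 in [slope]. *)
Lemma sqr_slope x f V s t : continuous x -> primitive x f -> dissipative x f ->
  (forall s, s <= 0 -> x s = xi s) -> 0 <= V ->
  0 <= t -> (forall s, 0 <= s <= t -> x s ^+ 2 <= V) ->
  - r <= s -> s <= t -> x t ^+ 2 - x s ^+ 2 <= slope V * (t - s).
Proof.
move=> cx px dis xn V0 t0 xV rs st.
have pos v : 0 <= v -> v <= t -> x t ^+ 2 - x v ^+ 2 <= slope V * (t - v).
  move=> v0 vt; rewrite !expr2;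
    apply: (primitive_le (primitiveM cx cx px px)) => // w /andP[vw wt].
  have w0 : 0 <= w by exact: le_trans vw.
  apply: le_trans (dissipative_sqr dis w0) _; rewrite /slope.
  have := xV w; rewrite w0 wt expr2 => /(_ isT) h.
  have := ler_wpM2l (ltW growth_rate_gt0) h; have := sqr_ge0 N; lra.
have [s0|/ltW s0] := leP 0 s; first exact: pos.
have h1 := pos 0 (lexx _) t0; have := xi_lip (s := s); rewrite rs s0 => /(_ isT).
rewrite -!xn // => h2.
have : 2 * N ^+ 2 * - s <= slope V * - s.
  apply: ler_wpM2r; first by rewrite oppr_ge0.
  by rewrite /slope lerDr addr_ge0 ?sqr_ge0 // mulr_ge0 // ltW // growth_rate_gt0.
lra.
Qed.

Lemma denom_lower x f V t : continuous x -> primitive x f -> dissipative x f ->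
  (forall s, s <= 0 -> x s = xi s) -> 0 <= V ->
  0 <= t -> (forall s, 0 <= s <= t -> x s ^+ 2 <= V) ->
  (denom_bound V)^-1 <= denom x t.
Proof.
move=> cx px dis xn V0 t0 xV.
have e2 : 0 < eps ^+ 2 by rewrite exprn_gt0.
have s0 := slope_ge0 V0; have q0 := denom_bound_gt0 V0.
have rp := r0; have r1 : 0 < 1 / r by rewrite divr_gt0.
have en0 : 0 <= energy x t by exact: energy_ge0.
have se : 0 <= 4 * slope V / eps ^+ 2 by rewrite divr_ge0 ?mulr_ge0 // ltW.
set q := 1 / r + 4 * slope V / eps ^+ 2.
have qp : 0 < q by rewrite /q; lra.
have [xs|xs] := leP (x t ^+ 2) (eps ^+ 2 / 2).
  apply: (@le_trans _ _ (eps ^+ 2 / 2)); last first.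
    by rewrite /denom; have := pos_part_ge (eps ^+ 2 - x t ^+ 2); lra.
  rewrite -[leRHS]invrK lef_pV2 ?posrE ?invr_gt0 ?divr_gt0 // invf_div /denom_bound -/q.
  by rewrite lerDl mulr_ge0 // ?divr_ge0 // ltW.
apply: (@le_trans _ _ (eps ^+ 2 / 4 * q^-1)).
  rewrite -[eps ^+ 2 / 4]invrK -invfM lef_pV2 ?posrE ?mulr_gt0 ?invr_gt0 ?divr_gt0 //.
  by rewrite invf_div /denom_bound -/q lerDr divr_ge0 // ltW.
apply: (@le_trans _ _ (energy x t)); last by rewrite /denom lerDl pos_part_ge0.
have tau0 : 0 < q^-1 by rewrite invr_gt0.
(* The term 1 / r of q keeps the interval of length 1 / q inside the window; the other term keeps
   the drop of x^2 along it below eps^2 / 4. *)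
have taur : q^-1 <= r.
  by rewrite -[leRHS]invrK lef_pV2 ?posrE ?invr_gt0 // /q div1r lerDl.
have taus : slope V * q^-1 <= eps ^+ 2 / 4.
  rewrite ler_pdivrMr // /q mulrDr.
  have -> : eps ^+ 2 / 4 * (4 * slope V / eps ^+ 2) = slope V by field; rewrite gt_eqF.
  by rewrite lerDr mulr_ge0 // ?divr_ge0 // ltW.
have hx2 : loc_bounded (fun s => x s ^+ 2) by apply: loc_boundedX;
  exact: loc_bounded_cont.
rewrite energyE //.
rewrite -(@itg_chasles _ _ (t - r) (t - q^-1) t) //; [|lra|lra].
apply: ler_wpDl; first by apply: itg_ge0 => s _; exact: sqr_ge0.
have := @itg_ge_cst _ (fun s => x s ^+ 2) (t - q^-1) t (eps ^+ 2 / 4) hx2.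
have -> : t - (t - q^-1) = q^-1 by ring.
apply; first lra.
move=> s /andP[h1 h2].
have h3 := sqr_slope cx px dis xn V0 t0 xV (_ : - r <= s) h2.
have {}h3 : x t ^+ 2 - x s ^+ 2 <= slope V * (t - s) by apply: h3; lra.
have : slope V * (t - s) <= slope V * q^-1 by rewrite ler_wpM2l //; lra.
lra.
Qed.

(** * The truncated equation, existence and uniqueness *)

Lemma causal_lip_win (C T : R) (H : (R -> R) -> R -> R)  :
  (forall x, continuous x -> loc_bounded (H x)) ->
  causal_lip xi C T H -> causal_lip xi C T (fun x t => win (H x) t).
Proof.
move=> bH lH; have rp := ltW r0;
have h1 := causal_lip_itg_shift rp bH lH.
have := causal_lip_itg_shift (lexx 0) bH lH.
move=> h0; have hP := causal_lipD h0 (causal_lipM (@causal_lip_cont _ xi C T (fun=> -1)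
  (fun=> cvg_cst _)) h1).
have -> : (fun x t => win (H x) t) =
    (fun x t => itg (H x) 0 (t - 0) + -1 * itg (H x) 0 (t - r)).
  by apply/funext => x; apply/funext => t; rewrite /win subr0 mulN1r.
exact: hP.
Qed.

Definition sqr_bound t : R := expR (growth_rate * Num.max t 0) * (N ^+ 2 + D ^+ 2).

Definition trunc_denom t : R := (denom_bound (sqr_bound t))^-1.

Definition truncated x : R -> R := fun t => clamp (1 + sqr_bound t) (x t).

(** Only the nonlinear feedback sees the truncated state; theta x is globally Lipschitz as it is. *)
Definition vector_field x : R -> R :=
  fun t => theta * x t + feedback trunc_denom (truncated x) t + dd t.

Lemma sqr_bound_ge0 t : 0 <= sqr_bound t.
Proof. by rewrite mulr_ge0 ?expR_ge0 // addr_ge0 // sqr_ge0. Qed.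

Lemma sqr_bound_le s t : s <= t -> sqr_bound s <= sqr_bound t.
Proof.
move=> st; rewrite ler_wpM2r ?addr_ge0 ?sqr_ge0 // ler_expR ler_wpM2l //.
  exact: ltW (growth_rate_gt0).
by rewrite ge_max !le_max st lexx !orbT.
Qed.

Lemma sqr_bound_continuous : continuous sqr_bound.
Proof.
move=> t; apply: cvgM; last exact: cvg_cst.
apply: (@continuous_comp _ _ _ (fun t => Num.max t 0) (fun t => expR (growth_rate * t))).
  by apply: continuous_max; [exact: cvg_id|exact: cvg_cst].
exact: continuous_expR_scale.
Qed.

Lemma trunc_denom_gt0 t : 0 < trunc_denom t.
Proof. by rewrite invr_gt0; apply: denom_bound_gt0 => //; exact: sqr_bound_ge0. Qed.

Lemma trunc_denom_continuous : continuous trunc_denom.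
Proof.
move=> t; apply: cvgV.
  by rewrite gt_eqF //; apply: denom_bound_gt0 => //; exact: sqr_bound_ge0.
apply: cvgD; first exact: cvg_cst.
apply: cvgM; first exact: cvg_cst.
apply: cvgD; first exact: cvg_cst.
apply: cvgM; last exact: cvg_cst.
apply: cvgM; first exact: cvg_cst.
apply: cvgD; last exact: cvg_cst.
apply: cvgD; last exact: cvg_cst.
by apply: cvgM; [exact: cvg_cst|exact: sqr_bound_continuous].
Qed.

Lemma truncated_continuous x : continuous x -> continuous (truncated x).
Proof.
move=> cx; have cb : continuous (fun t => 1 + sqr_bound t).
  by move=> t; apply: cvgD; [exact: cvg_cst|exact: sqr_bound_continuous].
move=> t; rewrite /truncated /clamp.
apply: (@continuous_max _ _ (fun t => - (1 + sqr_bound t))); first by apply: cvgN;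
  exact: cb.
by apply: (@continuous_min _ _ x); [exact: cx|exact: cb].
Qed.

Lemma xi_sqr_bound s : xi s ^+ 2 <= N ^+ 2.
Proof. by rewrite -[leLHS]ger0_norm ?sqr_ge0 // normrX lerXn2r ?nnegrE. Qed.

Lemma sqr_bound_ge s : N ^+ 2 + D ^+ 2 <= sqr_bound s.
Proof.
rewrite ler_peMl ?addr_ge0 ?sqr_ge0 // -expR0 ler_expR mulr_ge0 //.
  exact: ltW (growth_rate_gt0).
by rewrite le_max lexx orbT.
Qed.

Lemma truncated_past x : (forall s, s <= 0 -> x s = xi s) ->
  forall s, s <= 0 -> truncated x s = xi s.
Proof.
move=> xn s s0; rewrite /truncated clamp_id xn //; apply: norm_le_sqr.
by apply: le_trans (xi_sqr_bound s) _; apply: le_trans (sqr_bound_ge s);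
  rewrite lerDl sqr_ge0.
Qed.

Lemma vector_field_locbm x : continuous x -> loc_bounded (vector_field x).
Proof.
move=> cx; apply: loc_boundedD => //; apply: loc_boundedD;
  first by apply: loc_boundedZ; exact: loc_bounded_cont.
apply: loc_bounded_cont; apply: feedback_continuous => //.
- exact: trunc_denom_continuous.
- exact: trunc_denom_gt0.
- exact: truncated_continuous.
Qed.

Lemma feedback_causal_lip (C T : R) : causal_lip xi C T (feedback trunc_denom).
Proof.
have le : causal_lip xi C T (fun x t => x t) by exact: causal_lip_eval.
have ls : causal_lip xi C T (fun x t => x t ^+ 2).
  by under eq_fun do under eq_fun do rewrite expr2; exact: causal_lipM.
have lc (k : R) : causal_lip xi C T (fun _ _ => k) by apply: causal_lip_cont => t;
  exact: cvg_cst.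
have lden : causal_lip xi C T denom.
  apply: causal_lipD.
    apply: causal_lipD.
      apply: causal_lip_cont; apply: past_continuous; apply: loc_boundedX;
        exact: loc_bounded_cont.
    apply: (causal_lip_win) => [x cx|]; last exact: ls.
    by apply: loc_boundedX; exact: loc_bounded_cont.
  apply: causal_lip_pos_part; apply: causal_lipD; first exact: lc.
  have -> : (fun (x : R -> R) t => - x t ^+ 2) = (fun x t => -1 * x t ^+ 2).
    by apply/funext => x; apply/funext => t; rewrite mulN1r.
  exact: causal_lipM.
have lexc : causal_lip xi C T excess.
  apply: causal_lipD; first by apply: causal_lip_cont; exact: hist_excess_continuous.
  apply: causal_lipM; first exact: lc.
  apply: (causal_lip_win) => [x cx|].
    apply: loc_boundedM; first exact: loc_bounded_cont.
    by apply: loc_boundedD => //; apply: loc_boundedZ; exact: loc_bounded_cont.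
  apply: causal_lipM => //; apply: causal_lipD; first exact: causal_lipM.
  by apply: causal_lip_fun; exists D.
have lgain : causal_lip xi C T (gain trunc_denom).
  apply: causal_lipM.
    apply: causal_lipD; first exact: causal_lip_pos_part.
    by apply: causal_lipM => //; exact: lc.
  (* As [sqr_bound] increases with time, [trunc_denom] decreases, and its value at T bounds it from
     below on [0, T]. *)
  apply: (@causal_lipV _ _ _ _ _ (2 * trunc_denom T)).
  - by rewrite mulr_gt0 // trunc_denom_gt0.
  - move=> x t _ /andP[t0 tT]; rewrite ler_wpM2l // le_max; apply/orP; left.
    rewrite lef_pV2 ?posrE ?denom_bound_gt0 ?sqr_bound_ge0 //.
    have := sqr_bound_le tT; have := ltW (growth_rate_gt0);
      rewrite /denom_bound /slope => k0 h.
    have e2 : 0 < eps ^+ 2 by rewrite exprn_gt0.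
    rewrite lerD2l ler_wpM2l ?divr_ge0 // ?(ltW e2) // lerD2l ler_wpM2r ?invr_ge0 ?(ltW
      e2) //.
    by rewrite ler_wpM2l // !lerD2r ler_wpM2l.
  - by apply: causal_lipM; [exact: lc|apply: causal_lip_max => //;
    exact: trunc_denom_continuous].
apply: causal_lipM => //.
have -> : (fun (x : R -> R) t => - (2 * c + gain trunc_denom x t)) =
    (fun x t => -1 * (2 * c + gain trunc_denom x t)).
  by apply/funext => x; apply/funext => t; rewrite mulN1r.
by apply: causal_lipM; [exact: lc|apply: causal_lipD => //; exact: lc].
Qed.

Lemma vector_field_lip T : exists K : R, forall x y : R -> R, continuous x ->
  continuous y ->
  (forall s, s <= 0 -> x s = xi s) -> (forall s, s <= 0 -> y s = xi s) ->
  forall t B, 0 <= t <= T -> 0 <= B -> (forall s, 0 <= s <= t -> `|x s - y s| <= B) ->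
  `|vector_field x t - vector_field y t| <= K * B.
Proof.
have [K K0 HK] := feedback_causal_lip (1 + sqr_bound T) T.
have adm x : continuous x -> (forall s, s <= 0 -> x s = xi s) ->
    admissible xi (1 + sqr_bound T) T (truncated x).
  move=> cx xn; split; [exact: truncated_continuous|exact: truncated_past|].
  move=> s sT; apply: le_trans (clamp_norm _ _) _;
    first by rewrite addr_ge0 ?sqr_bound_ge0.
  by rewrite lerD2l sqr_bound_le.
exists (`|theta| + K) => x y cx cy xn yn t B tT B0 xyB.
have [|_ h] := HK _ _ (adm x cx xn) (adm y cy yn) t B tT B0.
  by move=> s st; apply: le_trans (clamp_contract _ _ _) _; exact: xyB.
rewrite /vector_field.
have -> (a a' b b' e : R) : theta * a + b + e - (theta * a' + b' + e) = theta * (a -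
  a') + (b - b') by ring.
apply: le_trans (ler_normD _ _) _; rewrite normrM mulrDl; apply: lerD => //.
by rewrite ler_wpM2l //; apply: xyB; case/andP: tT => -> _ /=.
Qed.

Lemma gain_ge0 m x t : 0 <= Num.max (m t) (denom x t) -> 0 <= gain m x t.
Proof.
move=> h; rewrite divr_ge0 // ?mulr_ge0 // addr_ge0 ?pos_part_ge0 // mulr_ge0 ?sqr_ge0 //.
by rewrite mulr_ge0 // ltW.
Qed.

(** Here z is x itself or its truncation; only the sign of x z enters. *)
Lemma dissipative_feedback x (q z : R -> R) :
  (forall t, 0 <= t -> 0 <= q t) -> (forall t, 0 <= t -> 0 <= x t * z t) ->
  dissipative x (fun t => theta * x t + - (2 * c + q t) * z t + dd t).
Proof.
move=> q0 xz t t0.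
have h1 : x t * (theta * x t) <= `|theta| * x t ^+ 2.
  by rewrite mulrCA -expr2 ler_wpM2r ?sqr_ge0 ?ler_norm.
have h2 : 0 <= (2 * c + q t) * (x t * z t).
  by rewrite mulr_ge0 ?xz // addr_ge0 ?q0 // mulr_ge0 // ltW.
have h3 : x t * dd t <= `|x t| * D.
  by apply: le_trans (ler_norm _) _; rewrite normrM ler_wpM2l.
rewrite !mulrDr; have ->
  : x t * (- (2 * c + q t) * z t) = - ((2 * c + q t) * (x t * z t)) by ring.
lra.
Qed.

(** Both truncation levels were derived from dissipativity alone. Applied to the truncated equation
    this gives existence, applied to the closed loop it gives uniqueness. *)
Lemma apriori x f : continuous x -> (forall s, s <= 0 -> x s = xi s) -> primitive x f ->
  dissipative x f ->
  truncated x = x /\ forall t, 0 <= t -> trunc_denom t <= denom x t.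
Proof.
move=> cx xn px dis.
have xb t : x t ^+ 2 <= sqr_bound t.
  have [t0|/ltW t0] := leP t 0.
    rewrite xn //; apply: le_trans (xi_sqr_bound t) _.
    by apply: le_trans (sqr_bound_ge t); rewrite lerDl sqr_ge0.
  apply: le_trans (growth_le cx px dis (lexx 0) t0) _.
  rewrite subr0 /sqr_bound max_l //; apply: ler_wpM2l; first exact: expR_ge0.
  by rewrite lerD2r xn // xi_sqr_bound.
split; first by apply/funext => t; rewrite /truncated clamp_id //; exact: norm_le_sqr.
move=> t t0; apply: (denom_lower cx px dis xn _ t0).
- exact: sqr_bound_ge0.
- by move=> s /andP[s0 st]; apply: le_trans (xb s) _; exact: sqr_bound_le.
Qed.

(** The problem in the form used from here on: histories extended to ]-oo, 0], the differential
    equation integrated, and u eliminated from p. *)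
Definition closed_loop x u :=
  [/\ continuous x /\ continuous u, forall s, s <= 0 -> x s = xi s,
      forall s, s <= 0 -> u s = ui s,
      primitive x (fun t => theta * x t + u t + dd t) &
      forall t, 0 <= t -> u t = feedback (fun=> 0) x t].

Lemma gain0_ge0 x t : continuous x -> (forall s, s <= 0 -> x s = xi s) -> 0 <= t ->
  0 <= gain (fun=> 0) x t.
Proof. by move=> cx xn t0; apply: gain_ge0; rewrite le_max lexx. Qed.

Lemma eq_primitive x f g : loc_bounded g -> (forall t, 0 <= t -> f t = g t) ->
  primitive x f -> primitive x g.
Proof.
move=> hg fg [hf px]; split=> // s t s0 st; rewrite px //.
by apply: eq_itg => v /andP[sv _]; apply: fg; exact: le_trans sv.
Qed.

Lemma closed_loop_dissipative x u : closed_loop x u ->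
  dissipative x (fun t => theta * x t + u t + dd t).
Proof.
move=> [[cx cu] xn un px uE] t t0; rewrite uE //.
apply: (@dissipative_feedback x (gain (fun=> 0) x) x) => // v v0; first exact: gain0_ge0.
by rewrite -expr2 sqr_ge0.
Qed.

Lemma closed_loop_picard x u : closed_loop x u -> picard_sol vector_field xi x.
Proof.
move=> cl; have [[cx cu] xn un px uE] := cl.
have [tr dl] := apriori cx xn px (closed_loop_dissipative cl).
split=> // t t0; have [_ /(_ 0 t (lexx _) t0) h] := px.
rewrite -(xn 0 (lexx _)) -[LHS](subrK (x 0)) h addrC; congr (_ + _).
apply: eq_itg => v /andP[v0 _];
  rewrite /vector_field tr uE // /feedback /gain max_r ?max_r ?dl //.
exact: denom_ge0.
Qed.

Lemma closed_loop_unique x u y v : closed_loop x u -> closed_loop y v ->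
  forall t, x t = y t /\ u t = v t.
Proof.
move=> cx cy; have xy : x = y.
  apply/funext; apply: (picard_unique vector_field_locbm vector_field_lip).
    exact: closed_loop_picard cx.
  exact: closed_loop_picard cy.
move=> t; rewrite xy; split=> //.
have [_ _ un _ uE] := cx; have [_ _ vn _ vE] := cy.
have [t0|/ltW t0] := leP t 0; first by rewrite un // vn.
by rewrite uE // vE // xy.
Qed.

(** The window integrals over [0, t] are 0 at t = 0, so the history decides the value; with
    [ui_compat], u is continuous at 0. *)
Lemma feedback_at0 m x : (forall s, s <= 0 -> x s = xi s) ->
  feedback m x 0 = feedback m xi 0.
Proof.
move=> xn.
have w0 f : win f 0 = 0.
  by rewrite win_le ?itg_xx // ltW.
by rewrite /feedback /gain /denom /energy /excess /power !w0 !xn.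
Qed.

Hypothesis ui_compat : ui 0 = feedback (fun=> 0) xi 0.

Lemma closed_loop_exists : exists x u, closed_loop x u.
Proof.
have [x [cx xn xS]] := picard_exists cxi vector_field_locbm vector_field_lip.
have hv := vector_field_locbm cx.
have px : primitive x (vector_field x).
  split=> // s t s0 st; rewrite !xS //; last exact: le_trans st.
  by rewrite -(itg_chasles hv s0 st); ring.
have dis : dissipative x (vector_field x).
  apply: (@dissipative_feedback x (gain trunc_denom (truncated x)) (truncated x)).
    by move=> t t0; apply: gain_ge0; rewrite le_max ltW // trunc_denom_gt0.
  by move=> t _; apply: clamp_mul_ge0; rewrite addr_ge0 // sqr_bound_ge0.
have [tr dl] := apriori cx xn px dis.
have E t : 0 <= t -> feedback trunc_denom x t = feedback (fun=> 0) x t.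
  move=> t0; rewrite /feedback /gain max_r ?dl // max_r //.
  exact: denom_ge0.
have cf : continuous (feedback trunc_denom x).
  by apply: feedback_continuous => //;
    [exact: trunc_denom_continuous|exact: trunc_denom_gt0].
(* Glues the history and the feedback into one continuous formula; [f0] makes the bracket vanish for
   t <= 0. *)
pose u t := ui (Num.min t 0) + (feedback trunc_denom x (Num.max t 0) - ui 0).
have cu : continuous u.
  move=> t; apply: cvgD.
    apply: (@continuous_comp _ _ _ (fun t => Num.min t 0) ui); last exact: cui.
    exact: min0_continuous.
  apply: cvgB; last exact: cvg_cst.
  apply: (@continuous_comp _ _ _ (fun t => Num.max t 0) (feedback trunc_denom x));
    last exact: cf.
  by apply: continuous_max; [exact: cvg_id|exact: cvg_cst].
have f0 : feedback trunc_denom x 0 = ui 0 by rewrite E // feedback_at0 // ui_compat.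
have up t : 0 <= t -> u t = feedback (fun=> 0) x t.
  by move=> t0; rewrite /u min_r // max_l // addrC subrK E.
exists x, u; split=> //.
  by move=> s s0; rewrite /u min_l // max_r // f0 subrr addr0.
apply: (eq_primitive _ _ px).
  by apply: loc_boundedD => //; apply: loc_boundedD; [apply: loc_boundedZ|];
    exact: loc_bounded_cont.
by move=> t t0; rewrite /vector_field tr up // E.
Qed.

(** ** Estimates *)

Section estimates.
Variables x u : R -> R.
Hypothesis clxu : closed_loop x u.

Let cx : continuous x. Proof. by case: clxu => [[]]. Qed.
Let xn s : s <= 0 -> x s = xi s. Proof. by case: clxu => _ h _ _ _; exact: h. Qed.
Let px : primitive x (fun t => theta * x t + u t + dd t). Proof. by case: clxu. Qed.
Let dis : dissipative x (fun t => theta * x t + u t + dd t).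
Proof. exact: closed_loop_dissipative clxu. Qed.
Let uE t : 0 <= t -> u t = - (2 * c + gain (fun=> 0) x t) * x t.
Proof. by case: clxu => _ _ _ _ h; exact: h. Qed.
Let hx : loc_bounded x. Proof. exact: loc_bounded_cont. Qed.
Let hx2 : loc_bounded (fun s => x s ^+ 2). Proof. exact: loc_boundedX. Qed.
Let hxd : loc_bounded (fun s => x s * dd s). Proof. exact: loc_boundedM. Qed.

Let sqr_primitive : primitive (fun t => x t ^+ 2)
  (fun t => (theta * x t + u t + dd t) * x t + x t * (theta * x t + u t + dd t)).
Proof. by under eq_fun do rewrite expr2; exact: primitiveM. Qed.

Let csq : continuous (fun t => x t ^+ 2). Proof. exact: sqr_continuous. Qed.

Lemma denom_gt0 t : 0 <= t -> 0 < denom x t.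
Proof.
move=> t0; have [_ dl] := apriori cx xn px dis; apply: lt_le_trans (dl t t0).
exact: trunc_denom_gt0.
Qed.

Lemma gainE t : 0 <= t -> gain (fun=> 0) x t =
  (pos_part (excess x t) + c * r * x t ^+ 2) / (2 * denom x t).
Proof. by move=> t0; rewrite /gain max_r // ltW // denom_gt0. Qed.

Lemma energy_itg t : 0 <= t -> energy x t = itg (fun s => x s ^+ 2) (t - r) t.
Proof. by move=> t0; rewrite energyE. Qed.

Lemma excess_late t : r <= t ->
  excess x t = 2 * (theta * energy x t + itg (fun s => x s * dd s) (t - r) t).
Proof.
move=> rt; have rp := r0.
rewrite /excess /hist_excess past_ge // min_r; last lra.
rewrite subrr mulr0 subr0 add0r /power energy_itg; last lra.
rewrite win_ge //; last by apply: loc_boundedM => //; apply: loc_boundedD => //;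
  exact: loc_boundedZ.
by congr (_ * _); rewrite -itgZ // -itgD //; [apply: eq_itg => s _;
  ring|exact: loc_boundedZ].
Qed.

(** Pointwise, 2 k |x d| <= (D^2 / c) x^2 + c k^2. For k = x(t)^2 the term c r k^2 is matched by c r
    x(t)^2 in the gain. *)
Lemma disturbance_amgm (t k : R) : 0 <= t -> 0 <= k ->
  2 * k * `|itg (fun s => x s * dd s) (t - r) t| <= energy x t * (D ^+ 2 / c) + c * r *
    k ^+ 2.
Proof.
move=> t0 k0; have rp := r0; have cp := c0.
have -> : energy x t * (D ^+ 2 / c) + c * r * k ^+ 2 =
    itg (fun s => D ^+ 2 / c * x s ^+ 2 + c * k ^+ 2) (t - r) t.
  rewrite itgD; [|exact: loc_boundedZ|exact: loc_bounded_cst].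
  by rewrite itgZ // itg_cst ?energy_itg //; [ring|lra].
rewrite -[2 * k]ger0_norm ?mulr_ge0 // -normrM -itgZ //.
apply: norm_itg_le; first exact: loc_boundedZ.
  by apply: loc_boundedD; [exact: loc_boundedZ|exact: loc_bounded_cst].
move=> s _; rewrite !normrM (ger0_norm k0) [`|2|]ger0_norm // -[x s ^+ 2]ger0_norm
  ?sqr_ge0 // normrX.
have h : `|x s| * `|dd s| <= `|x s| * D by rewrite ler_wpM2l.
have := ler_wpM2l k0 h;
  have : 0 <= (D * `|x s| - c * k) ^+ 2 / c by rewrite divr_ge0 ?sqr_ge0 // ltW.
have -> : (D * `|x s| - c * k) ^+ 2 / c = D ^+ 2 / c * `|x s| ^+ 2 + c * k ^+ 2 - 2 *
  (k * (`|x s| * D)).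
  by field; rewrite gt_eqF.
lra.
Qed.

(** For V >= eps^2 the denominator is the energy, and the gain cancels theta up to D^2 / (2 c V). Of
    the damping 4 c V, one c V is spent on 2 x d <= c V + D^2 / c. *)
Lemma decay_rate t : r <= t -> eps ^+ 2 <= x t ^+ 2 ->
  (theta * x t + u t + dd t) * x t + x t * (theta * x t + u t + dd t) <=
  - (3 * c) * x t ^+ 2 + 2 * (D ^+ 2 / c).
Proof.
move=> rt ex; have rp := r0; have cp := c0.
have t0 : 0 <= t by lra.
have dE : denom x t = energy x t.
  by rewrite /denom /pos_part max_r ?addr0 // subr_le0.
have A0 : 0 < energy x t by rewrite -dE denom_gt0.
have := disturbance_amgm t0 (sqr_ge0 (x t)).
have := excess_late rt; set E := itg _ _ _ => exE.
set V := x t ^+ 2 in ex *; set A := energy x t in dE A0 exE *; set a := D ^+ 2 / c => am.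
have PE : gain (fun=> 0) x t * (2 * A) = pos_part (excess x t) + c * r * V.
  by rewrite gainE // dE divfK // mulf_neq0 // gt_eqF.
have := pos_part_ge (excess x t); rewrite exE => pp; rewrite exE in PE.
set P := gain _ _ _ in PE *.
have V0 : 0 <= V by exact: sqr_ge0.
have PV : 2 * theta * V - a <= 2 * (P * V).
  rewrite -(ler_pM2l A0).
  have -> : A * (2 * (P * V)) = V * (P * (2 * A)) by ring.
  rewrite PE; apply: (@le_trans _ _ (V * (2 * (theta * A + E) + c * r * V))); last first.
    by rewrite ler_wpM2l // lerD2r.
  have : - `|E| <= E by rewrite lerNl -normrN ler_norm.
  move=> /(ler_wpM2l V0) h; rewrite -subr_ge0.
  have -> : V * (2 * (theta * A + E) + c * r * V) - A * (2 * theta * V - a) =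
    2 * (V * E) + (A * a + c * r * V ^+ 2) by ring.
  have : 2 * V * `|E| = 2 * (V * `|E|) by ring.
  lra.
have xd : 2 * (x t * dd t) <= c * V + a.
  apply: (@le_trans _ _ (2 * (`|x t| * D))).
    by rewrite ler_pM2l // (le_trans (ler_norm _)) // normrM ler_wpM2l.
  rewrite /V -[x t ^+ 2]ger0_norm ?sqr_ge0 // normrX.
  have : 0 <= (D - c * `|x t|) ^+ 2 / c by rewrite divr_ge0 ?sqr_ge0 // ltW.
  have -> : (D - c * `|x t|) ^+ 2 / c = a + c * `|x t| ^+ 2 - 2 * (`|x t| * D).
    by rewrite /a; field; rewrite gt_eqF.
  lra.
rewrite uE //.
have -> : (theta * x t + - (2 * c + P) * x t + dd t) * x t + x t * (theta * x t + - (2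
  * c + P) * x t + dd t)
   = 2 * theta * V - 4 * c * V - 2 * (P * V) + 2 * (x t * dd t) by rewrite /V; ring.
lra.
Qed.

Lemma decay_step s t : r <= s -> s <= t ->
  (forall v, s <= v <= t -> eps ^+ 2 <= x v ^+ 2) ->
  x t ^+ 2 <= expR (- (3 * c) * (t - s)) * x s ^+ 2 + 2 / 3 * (D / c) ^+ 2.
Proof.
move=> rs st ev; have rp := r0; have cp := c0.
have := @primitive_gronwall _ (fun t => x t ^+ 2) _ s t (- (3 * c)) (2 * (D ^+ 2 / c))
  _ csq sqr_primitive _ st.
(* The ratio of the constant term to the decay rate; the constant 2 / 3 originates here. *)
have -> : 2 * (D ^+ 2 / c) / - (3 * c) = - (2 / 3 * (D / c) ^+ 2) by field;
  rewrite gt_eqF.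
set m := 2 / 3 * _; have m0 : 0 <= m by rewrite mulr_ge0 // sqr_ge0.
move=> H; have {H} : x t ^+ 2 - m <= expR (- (3 * c) * (t - s)) * (x s ^+ 2 - m).
  apply: H; [by rewrite oppr_eq0 mulf_neq0 // gt_eqF|lra|].
  by move=> v sv; apply: decay_rate; [case/andP: sv => *; lra|exact: ev].
have : 0 <= expR (- (3 * c) * (t - s)) * m by rewrite mulr_ge0 // expR_ge0.
rewrite mulrBr; lra.
Qed.

(** Since the last time with V = eps^2, or since r if there is none, [decay_step] applies. *)
Lemma state_late t : r <= t ->
  x t ^+ 2 <= Num.max (eps ^+ 2) (expR (- (3 * c) * (t - r)) * x r ^+ 2) + 2 / 3 * (D /
    c) ^+ 2.
Proof.
move=> rt; have m0 : 0 <= 2 / 3 * (D / c) ^+ 2 by rewrite mulr_ge0 // sqr_ge0.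
have [xe|/ltW ex] := leP (x t ^+ 2) (eps ^+ 2).
  by apply: le_trans xe _; apply: ler_wpDr => //; rewrite le_max lexx.
have [s [/andP[rs st] alt ev]] := last_exit csq rt ex.
apply: le_trans (decay_step rs st ev) _; rewrite lerD2r le_max.
case: alt => [->|->]; first by rewrite lexx orbT.
apply/orP; left; rewrite ler_piMl ?sqr_ge0 // -expR0 ler_expR mulNr oppr_le0 mulr_ge0
  ?subr_ge0 //.
by rewrite mulr_ge0 // ltW.
Qed.

Definition early_gain : R := expR (growth_rate * r).

Lemma early_gain_ge1 : 1 <= early_gain.
Proof. by rewrite -expR0 ler_expR mulr_ge0 // ltW // growth_rate_gt0. Qed.

Lemma state_early t : 0 <= t <= r -> x t ^+ 2 <= early_gain * (xi 0 ^+ 2 + D ^+ 2).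
Proof.
move=> /andP[t0 tr]; apply: le_trans (growth_le cx px dis (lexx 0) t0) _.
rewrite subr0 xn // ler_wpM2r ?addr_ge0 ?sqr_ge0 // ler_expR ler_wpM2l // ltW //.
exact: growth_rate_gt0.
Qed.

Lemma norm_early t : 0 <= t <= r -> `|x t| <= early_gain * (`|xi 0| + D).
Proof.
move=> tr; have g1 := early_gain_ge1; have g0 : 0 <= early_gain by exact: le_trans g1.
have ax := normr_ge0 (xi 0); have D0' := D0.
apply: sqr_le_norm; first by rewrite mulr_ge0 // addr_ge0.
apply: le_trans (state_early tr) _;
  rewrite exprMn -[xi 0 ^+ 2]ger0_norm ?sqr_ge0 // normrX.
apply: ler_pM => //; first by rewrite addr_ge0 ?sqr_ge0.
  by rewrite expr2 ler_peMl.
by rewrite sqrrD; have := mulr_ge0 ax D0; lra.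
Qed.

(** Roots are taken term by term, a sum of squares of nonnegative numbers being at most the square
    of their sum. The rate 3 c of V is weakened to 2 c. *)
Lemma norm_late (q : R) t : 0 <= q -> 2 / 3 <= q ^+ 2 -> r <= t ->
  `|x t| <= eps + expR (- c * (t - r)) * (early_gain * (`|xi 0| + D)) + q * (D / c).
Proof.
move=> q0 q2 rt; have rp := r0; have Dc : 0 <= D / c by rewrite divr_ge0 // ltW.
have xr : `|x r| <= early_gain * (`|xi 0| + D) by apply: norm_early; rewrite lexx ltW.
set E := expR (- c * (t - r)); have E0 : 0 <= E by exact: expR_ge0.
apply: (@le_trans _ _ (eps + E * `|x r| + q * (D / c))); last first.
  by rewrite lerD2r lerD2l ler_wpM2l.
have Ex : 0 <= E * `|x r| by rewrite mulr_ge0.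
have qd : 0 <= q * (D / c) by rewrite mulr_ge0.
have e0 := ltW eps0.
apply: sqr_le_norm; first by rewrite !addr_ge0.
apply: le_trans (state_late rt) _.
have h1 : expR (- (3 * c) * (t - r)) * x r ^+ 2 <= (E * `|x r|) ^+ 2.
  rewrite exprMn -normrX [`|_ ^+ 2|]ger0_norm ?sqr_ge0 // ler_wpM2r ?sqr_ge0 //.
  rewrite /E expr2 -expRD ler_expR -subr_ge0.
  have -> : - c * (t - r) + - c * (t - r) - - (3 * c) * (t - r) = c * (t - r) by ring.
  by rewrite mulr_ge0 ?subr_ge0 // ltW.
have h2 : 2 / 3 * (D / c) ^+ 2 <= (q * (D / c)) ^+ 2 by rewrite [leRHS]exprMn ler_wpM2r
  ?sqr_ge0.
have h3 : Num.max (eps ^+ 2) (expR (- (3 * c) * (t - r)) * x r ^+ 2) <= (eps + E * `|x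
  r|) ^+ 2.
  have m := mulr_ge0 e0 Ex.
  rewrite ge_max sqrrD; apply/andP; split; first by have := sqr_ge0 (E * `|x r|); lra.
  by have := sqr_ge0 eps; lra.
apply: le_trans (lerD h3 h2) _; rewrite [leRHS]sqrrD.
by have := mulr_ge0 (addr_ge0 e0 Ex) qd; lra.
Qed.

(** * Crude bounds on the feedback *)

Lemma past_bound t : 0 <= t -> `|past (fun s => xi s * ui s) t| <= r * N ^+ 2.
Proof.
move=> t0; have rp := r0; have N2 := sqr_ge0 N.
have [tr|/ltW rt] := leP t r; last by rewrite past_ge // normr0 mulr_ge0 // ltW.
have hxu : loc_bounded (fun s => xi s * ui s) by apply: loc_boundedM;
  exact: loc_bounded_cont.
rewrite past_le ?t0 //; apply: (@le_trans _ _ (N ^+ 2 * (0 - (t - r)))).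
  apply: norm_itg_le_cst => //; first lra.
  by move=> s _; rewrite normrM expr2 ler_pM.
by rewrite mulrC ler_wpM2r //; lra.
Qed.

Lemma win_bound f (t B : R) : loc_bounded f -> 0 <= t ->
  (forall s, 0 <= s <= t -> `|f s| <= B) ->
  `|win f t| <= r * B.
Proof.
move=> hf t0 fB; have rp := r0.
have B0 : 0 <= B by apply: le_trans (fB 0 _); rewrite ?normr_ge0 // lexx t0.
have [tr|/ltW rt] := leP t r.
  rewrite win_le //; apply: (@le_trans _ _ (B * (t - 0))); first exact: norm_itg_le_cst.
  by rewrite subr0 mulrC ler_wpM2r.
rewrite win_ge //; apply: (@le_trans _ _ (B * (t - (t - r)))).
  apply: norm_itg_le_cst => //; first lra.
  by move=> s /andP[s1 s2]; apply: fB; apply/andP; split; lra.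
by rewrite mulrC ler_wpM2r //; lra.
Qed.

Definition excess_bound (V : R) : R :=
  (1 + 2 * r) * N ^+ 2 + 2 * (r * ((`|theta| + 1) * V + D ^+ 2)).

Lemma excess_le V t : 0 <= t -> (forall s, 0 <= s <= t -> x s ^+ 2 <= V) ->
  `|excess x t| <= excess_bound V.
Proof.
move=> t0 xV; rewrite /excess /excess_bound.
apply: le_trans (ler_normD _ _) _; apply: lerD.
  apply: le_trans (ler_normB _ _) _; rewrite [leRHS]mulrDl mul1r; apply: lerD.
    rewrite ler_norml; set m := Num.min _ _.
    have := xi_sqr_bound 0; have := xi_sqr_bound m.
    by have := sqr_ge0 (xi 0); have := sqr_ge0 (xi m); move=> *; apply/andP; split; lra.
  by rewrite normrM ger0_norm // -mulrA ler_wpM2l // past_bound.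
rewrite normrM ger0_norm // ler_wpM2l //.
apply: win_bound => //; first by apply: loc_boundedM => //; apply: loc_boundedD => //;
  exact: loc_boundedZ.
move=> s st; have xVs := xV s st.
rewrite normrM; apply: (@le_trans _ _ (`|x s| * (`|theta| * `|x s| + D))).
  by rewrite ler_wpM2l // (le_trans (ler_normD _ _)) // normrM lerD2l.
have X2 : `|x s| ^+ 2 = x s ^+ 2 by rewrite -normrX ger0_norm ?sqr_ge0.
have h1 := ler_wpM2l (normr_ge0 theta) xVs.
have h2 := sqr_ge0 (`|x s| - D); rewrite sqrrB X2 in h2.
have -> : `|x s| * (`|theta| * `|x s| + D) = `|theta| * x s ^+ 2 + `|x s| * D by
  rewrite -X2; ring.
have := sqr_ge0 D; have := sqr_ge0 (x s); lra.
Qed.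

(** V stands for a bound on x^2 and Q for a bound on 1 / [denom]. *)
Definition gain_bound (V Q : R) : R := (excess_bound V + c * r * V) * Q / 2.

Lemma gain_le V Q t : 0 <= t -> (forall s, 0 <= s <= t -> x s ^+ 2 <= V) ->
  (denom x t)^-1 <= Q -> gain (fun=> 0) x t <= gain_bound V Q.
Proof.
move=> t0 xV dQ; rewrite gainE // invfM [2^-1 * _]mulrC mulrA ler_wpM2r ?invr_ge0 //.
have cr : 0 <= c * r by rewrite mulr_ge0 // ltW.
apply: ler_pM => //.
- by rewrite addr_ge0 ?pos_part_ge0 // mulr_ge0 // sqr_ge0.
- by rewrite invr_ge0 ltW // denom_gt0.
- apply: lerD; last by rewrite ler_wpM2l // xV // lexx t0.
  apply: le_trans (excess_le t0 xV).
  by rewrite /pos_part ge_max ler_norm normr_ge0.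
Qed.

Lemma norm_feedback t : 0 <= t -> `|u t| = (2 * c + gain (fun=> 0) x t) * `|x t|.
Proof.
move=> t0; rewrite uE // normrM normrN; congr (_ * _); apply: ger0_norm.
have g0 : 0 <= gain (fun=> 0) x t by exact: gain0_ge0.
by rewrite addr_ge0 // mulr_ge0 // ltW.
Qed.

(** Unlike [sqr_bound] it is independent of time: growth is used on [0, r] only and [state_late]
    takes over afterwards. *)
Definition sqr_max : R := eps ^+ 2 + (early_gain + 1 / c ^+ 2) * (N + D) ^+ 2.

Lemma sum_sqr_le : N ^+ 2 + D ^+ 2 <= (N + D) ^+ 2.
Proof. by rewrite sqrrD; have := mulr_ge0 N0 D0; lra. Qed.

Lemma sqr_max_ge0 : 0 <= sqr_max.
Proof.
have g0 : 0 <= early_gain by exact: expR_ge0.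
have c2 : 0 <= 1 / c ^+ 2 by rewrite divr_ge0 ?sqr_ge0.
by rewrite addr_ge0 ?sqr_ge0 // mulr_ge0 ?sqr_ge0 // addr_ge0.
Qed.

Lemma sqr_le_max t : x t ^+ 2 <= sqr_max.
Proof.
have g1 := early_gain_ge1; have g0 : 0 <= early_gain by exact: expR_ge0.
have S0 := sqr_ge0 (N + D); have e0 := sqr_ge0 eps; have SS := sum_sqr_le.
have x0N := xi_sqr_bound 0; have D2 := sqr_ge0 D; have N2 := sqr_ge0 N.
have cS : 0 <= 1 / c ^+ 2 * (N + D) ^+ 2 by rewrite mulr_ge0 // divr_ge0 ?sqr_ge0.
have gS : (N + D) ^+ 2 <= early_gain * (N + D) ^+ 2 by rewrite ler_peMl.
rewrite /sqr_max mulrDl.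
have early v : 0 <= v <= r -> x v ^+ 2 <= early_gain * (N + D) ^+ 2.
  move=> vr; apply: le_trans (state_early vr) _; rewrite ler_wpM2l //; lra.
have [t0|/ltW t0] := leP t 0.
  by rewrite xn //; have := xi_sqr_bound t; lra.
have [tr|/ltW rt] := leP t r.
  by have := early t; rewrite t0 tr => /(_ isT); lra.
have xr := early r; rewrite lexx ltW // in xr; have {}xr := xr isT.
have Dc : 2 / 3 * (D / c) ^+ 2 <= 1 / c ^+ 2 * (N + D) ^+ 2.
  have -> : 2 / 3 * (D / c) ^+ 2 = 1 / c ^+ 2 * (2 / 3 * D ^+ 2) by field; rewrite gt_eqF.
  by rewrite ler_wpM2l ?divr_ge0 ?sqr_ge0 //; lra.
have Er : expR (- (3 * c) * (t - r)) * x r ^+ 2 <= x r ^+ 2.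
  rewrite ler_piMl ?sqr_ge0 // -expR0 ler_expR mulNr oppr_le0 mulr_ge0 ?subr_ge0 //.
  by rewrite mulr_ge0 // ltW.
apply: le_trans (state_late rt) _; rewrite addrA; apply: lerD => //.
by rewrite ge_max; apply/andP; split; lra.
Qed.

Lemma feedback_bound t : 0 <= t ->
  `|u t| <= (2 * c + gain_bound sqr_max (denom_bound sqr_max)) * (1 + sqr_max).
Proof.
move=> t0; rewrite norm_feedback //.
have g0 : 0 <= gain (fun=> 0) x t by exact: gain0_ge0.
apply: ler_pM => //; first by rewrite addr_ge0 // mulr_ge0 // ltW.
  rewrite lerD2l; apply: gain_le => //; first by move=> s _; exact: sqr_le_max.
  have Q0 : 0 < denom_bound sqr_max by apply: denom_bound_gt0 => //; exact: sqr_max_ge0.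
  rewrite -[leRHS]invrK lef_pV2 ?posrE ?invr_gt0 // ?denom_gt0 //.
  by apply: (denom_lower cx px dis xn sqr_max_ge0 t0) => s _; exact: sqr_le_max.
by apply: norm_le_sqr; exact: sqr_le_max.
Qed.

(** Small data keep x^2 below eps^2 / 2 up to time 2 r; then (eps^2 - x^2)^+ alone keeps the
    denominator away from 0, and u inherits the linear bound on x. *)
Lemma feedback_small t : 0 <= t <= 2 * r ->
  expR (growth_rate * (2 * r)) * (N ^+ 2 + D ^+ 2) <= eps ^+ 2 / 2 ->
  `|u t| <= (2 * c + gain_bound (eps ^+ 2 / 2) (2 / eps ^+ 2)) * (expR (growth_rate *
    (2 * r)) * (N + D)).
Proof.
move=> /andP[t0 tr]; set H := expR _ => Hs.
have k0 : 0 <= growth_rate by exact: ltW (growth_rate_gt0).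
have H1 : 1 <= H by rewrite -expR0 ler_expR !mulr_ge0 // ltW.
have H0 : 0 <= H by exact: expR_ge0.
have xH s : 0 <= s <= t -> x s ^+ 2 <= H * (N ^+ 2 + D ^+ 2).
  move=> /andP[s0 st]; apply: le_trans (growth_le cx px dis (lexx 0) s0) _.
  rewrite subr0 xn //; apply: ler_pM; rewrite ?expR_ge0 ?addr_ge0 ?sqr_ge0 //.
    by rewrite ler_expR ler_wpM2l // (le_trans st).
  by rewrite lerD2r xi_sqr_bound.
have g0 : 0 <= gain (fun=> 0) x t by exact: gain0_ge0.
rewrite norm_feedback //; apply: ler_pM => //;
  first by rewrite addr_ge0 // mulr_ge0 // ltW.
  have e2 : 0 < eps ^+ 2 by rewrite exprn_gt0.
  rewrite lerD2l; apply: gain_le => //; first by move=> s st;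
    apply: le_trans (xH s st) Hs.
  rewrite -[leRHS]invrK lef_pV2 ?posrE ?invr_gt0 ?divr_gt0 ?denom_gt0 // invf_div.
  have := xH t; rewrite lexx t0 => /(_ isT) h.
  have := pos_part_ge (eps ^+ 2 - x t ^+ 2); have : 0 <= energy x t by exact: energy_ge0.
  by rewrite /denom; lra.
apply: sqr_le_norm; first by rewrite mulr_ge0 // addr_ge0.
apply: le_trans (xH t _) _; first by rewrite lexx t0.
rewrite exprMn; apply: ler_pM; rewrite ?addr_ge0 ?sqr_ge0 // ?sum_sqr_le //.
by rewrite expr2 ler_peMl.
Qed.

(** * Estimates for small disturbances *)

Definition disturbance_gain : R := 1 + r + early_gain.

Hypothesis D_small : 4 * D ^+ 2 <= expR (- (growth_rate * r)) * eps ^+ 2.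
Hypothesis D_small' : (disturbance_gain + 1) * D <= c * eps.

Lemma energy_lower t : r <= t -> eps ^+ 2 / 2 <= x t ^+ 2 ->
  r * x t ^+ 2 <= 2 * early_gain * energy x t.
Proof.
move=> rt ex; have rp := r0; have k0 : 0 <= growth_rate by exact: ltW (growth_rate_gt0).
have Ds := D_small.
have G0 : 0 < early_gain by exact: expR_gt0.
set e := expR (- (growth_rate * r)) in Ds; have e0 : 0 < e by exact: expR_gt0.
have Ge : early_gain * e = 1 by rewrite /early_gain /e -expRD subrr expR0.
(* By [D_small], the loss D^2 in [growth_ge] is at most half of e x(t)^2. *)
have lo s : t - r <= s <= t -> e * x t ^+ 2 / 2 <= x s ^+ 2.
  move=> /andP[s1 s2]; have s0 : 0 <= s by lra.
  apply: le_trans (growth_ge cx px dis s0 s2).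
  have : e * x t ^+ 2 <= expR (- (growth_rate * (t - s))) * x t ^+ 2.
    rewrite ler_wpM2r ?sqr_ge0 // ler_expR lerN2 ler_wpM2l //; lra.
  have := ler_wpM2l (ltW e0) ex; lra.
have : e * x t ^+ 2 / 2 * (t - (t - r)) <= energy x t.
  rewrite energy_itg; last lra.
  by apply: itg_ge_cst => //; lra.
have -> : t - (t - r) = r by ring.
move=> h; have := ler_wpM2l (ltW G0) h.
have -> : early_gain * (e * x t ^+ 2 / 2 * r) = (early_gain * e) * (r * x t ^+ 2) / 2
  by ring.
rewrite Ge; lra.
Qed.

(** From 2 |x(s) x(t)| <= x(s)^2 + x(t)^2. Linearity in D, which [disturbance_amgm] does not give,
    is required by the term gamma |d| as d tends to 0. *)
Lemma disturbance_le t : r <= t ->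
  `|itg (fun s => x s * dd s) (t - r) t| * `|x t| <= disturbance_gain * D * denom x t.
Proof.
move=> rt; have rp := r0; have t0 : 0 <= t by lra.
have G1 := early_gain_ge1.
set V := x t ^+ 2; have V0 : 0 <= V by exact: sqr_ge0.
have A0 : 0 <= energy x t by exact: energy_ge0.
apply: (@le_trans _ _ (D * (energy x t + r * V) / 2)).
  have -> : D * (energy x t + r * V) / 2 = itg (fun s => D / 2 * x s ^+ 2 + D / 2 * V)
    (t - r) t.
    rewrite itgD; [|exact: loc_boundedZ|exact: loc_bounded_cst].
    by rewrite itgZ // itg_cst ?energy_itg //; [field|lra].
  rewrite mulrC -[`|x t| * _]normrM -itgZ //; apply: norm_itg_le;
    first exact: loc_boundedZ.
    by apply: loc_boundedD; [exact: loc_boundedZ|exact: loc_bounded_cst].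
  move=> s _; rewrite !normrM.
  have h : `|x t| * (`|x s| * `|dd s|) <= `|x t| * (`|x s| * D) by do 2 rewrite
    ler_wpM2l //.
  have X2 y : `|y| ^+ 2 = y ^+ 2 :> R by rewrite -normrX ger0_norm ?sqr_ge0.
  have := ler_wpM2l D0 (sqr_ge0 (`|x s| - `|x t|)); rewrite mulr0 sqrrB !X2 -/V; lra.
have dE : denom x t = energy x t + pos_part (eps ^+ 2 - V) by [].
(* In [disturbance_gain], r serves V <= eps^2 / 2, where V <= (eps^2 - V)^+, and [early_gain] serves
   larger V through [energy_lower]. *)
have key : energy x t + r * V <= 2 * disturbance_gain * denom x t.
  rewrite /disturbance_gain dE; have p0 := pos_part_ge0 (eps ^+ 2 - V).
  have [Ve|/ltW eV] := leP V (eps ^+ 2 / 2).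
    have := pos_part_ge (eps ^+ 2 - V); set q := pos_part _ in p0 * => pq.
    have qV : V <= q by lra.
    have := ler_wpM2l (ltW rp) qV; have := mulr_ge0 (ltW rp) A0.
    have G0 : 0 <= early_gain by lra.
    have := mulr_ge0 G0 (addr_ge0 A0 p0); have := mulr_ge0 (ltW rp) p0.
    lra.
  have := energy_lower rt eV; rewrite -/V => h.
  have G0 : 0 <= 1 + r + early_gain by lra.
  have := mulr_ge0 G0 p0.
  have := mulr_ge0 (ltW rp) A0; lra.
have := ler_wpM2l D0 key; lra.
Qed.

Lemma gain_denom t : r <= t -> 0 <= t -> gain (fun=> 0) x t * (2 * denom x t) =
  pos_part (2 * (theta * energy x t + itg (fun s => x s * dd s) (t - r) t)) + c * r * x
    t ^+ 2.
Proof.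
move=> rt t0; rewrite gainE // -excess_late // divfK // mulf_neq0 // gt_eqF //.
exact: denom_gt0.
Qed.

(** The denominator exceeds the energy by (eps^2 - V)^+, so the gain may miss theta by |theta|
    (eps^2 - V)^+ / [denom]; under the level condition c r V / (2 [denom]) compensates. The
    disturbance terms are absorbed by 4 c V thanks to [D_small']. *)
Lemma decreasing_above t : r <= t -> eps ^+ 2 / 2 <= x t ^+ 2 ->
  `|theta| * pos_part (eps ^+ 2 - x t ^+ 2) <= c * r * x t ^+ 2 / 2 ->
  (theta * x t + u t + dd t) * x t + x t * (theta * x t + u t + dd t) <= 0.
Proof.
move=> rt ex lev; have rp := r0; have cp := c0; have t0 : 0 <= t by lra.
have den0 := denom_gt0 t0.
have dst := disturbance_le rt; have PE := gain_denom rt t0.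
set E := itg _ _ _ in dst PE; set A := energy x t in PE.
have dE : denom x t = A + pos_part (eps ^+ 2 - x t ^+ 2) by [].
set den := denom x t in den0 dst PE dE; set q := pos_part (eps ^+ 2 - _) in lev dE.
have := pos_part_ge (2 * (theta * A + E)) => pp.
set P := gain _ _ _ in PE.
have nx0 := normr_ge0 (x t).
have X2 : `|x t| * `|x t| = x t ^+ 2 by rewrite -expr2 -normrX ger0_norm ?sqr_ge0.
have q0 : 0 <= q by exact: pos_part_ge0.
have thq : theta * q <= `|theta| * q by rewrite ler_wpM2r // ler_norm.
have h1 : 2 * den * (theta - P) <= 2 * `|E|.
  have -> : 2 * den * (theta - P) = 2 * (theta * A + theta * q) - P * (2 * den) by
    rewrite dE; ring.
  by rewrite PE; have := ler_norm (- E); rewrite normrN; lra.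
have h2 : (theta - P) * x t ^+ 2 <= `|x t| * (disturbance_gain * D).
  rewrite -(ler_pM2l den0) -X2.
  have := ler_wpM2r nx0 (ler_wpM2r nx0 h1); have := ler_wpM2l nx0 dst; lra.
have h3 : x t * dd t <= `|x t| * D.
  by rewrite (le_trans (ler_norm _)) // normrM ler_wpM2l.
have h4 : (disturbance_gain + 1) * D <= c * (2 * `|x t|).
  apply: le_trans D_small' _; rewrite ler_wpM2l ?(ltW cp) //.
  rewrite -[eps]ger0_norm ?(ltW eps0) //; apply: sqr_le_norm; first by rewrite mulr_ge0.
  by rewrite exprMn [`|x t| ^+ 2]expr2 X2; have := sqr_ge0 eps; lra.
have := ler_wpM2l nx0 h4; rewrite uE //.
have -> : (theta * x t + - (2 * c + P) * x t + dd t) * x t + x t * (theta * x t + - (2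
  * c + P) * x t + dd t)
  = 2 * ((theta - P) * x t ^+ 2) - 4 * c * x t ^+ 2 + 2 * (x t * dd t) by ring.
have -> : `|x t| * (c * (2 * `|x t|)) = 2 * c * (`|x t| * `|x t|) by ring.
rewrite X2; lra.
Qed.

(* The second term is the root V of |theta| (eps^2 - V) = c r V / 2. *)
Definition critical_level : R :=
  Num.max (eps ^+ 2 / 2) (`|theta| * eps ^+ 2 / (`|theta| + c * r / 2)).

Lemma critical_level_den : 0 < `|theta| + c * r / 2.
Proof. by rewrite ltr_wpDl // divr_gt0 // mulr_gt0. Qed.

Lemma critical_level_above (V : R) : critical_level <= V ->
  eps ^+ 2 / 2 <= V /\ `|theta| * pos_part (eps ^+ 2 - V) <= c * r * V / 2.
Proof.
rewrite /critical_level ge_max => /andP[h1];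
  rewrite ler_pdivrMr ?critical_level_den // => h2.
have cr : 0 <= c * r by rewrite mulr_ge0 // ltW.
have V0 : 0 <= V by have := sqr_ge0 eps; lra.
split=> //; rewrite /pos_part; have [le|_] := leP (eps ^+ 2 - V) 0; last lra.
by rewrite mulr0 divr_ge0 // mulr_ge0.
Qed.

Lemma monotone_above s t : r <= s -> s <= t -> critical_level < x t ^+ 2 ->
  x t ^+ 2 <= x s ^+ 2.
Proof.
move=> rs st lev; have rp := r0; rewrite leNgt; apply/negP => lt_st.
(* Above l the sign of the derivative is known, and as l >= x(s)^2, V equals l at the exit time even
   if that time is s. *)
set l := Num.max critical_level (x s ^+ 2).
have ll : l < x t ^+ 2 by rewrite /l gt_max lev lt_st.
have [v [/andP[sv vt] alt ev]] := last_exit csq st (ltW ll).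
have Vv : x v ^+ 2 = l.
  case: alt => // vs; apply/eqP; rewrite eq_le ev ?lexx //= vs andbT.
  by rewrite /l le_max lexx orbT.
have v0 : 0 <= v by lra.
have : x t ^+ 2 - x v ^+ 2 <= 0 * (t - v).
  apply: (primitive_le sqr_primitive v0 vt) => w /andP[vw wt].
  have [|e1 e2] := @critical_level_above (x w ^+ 2).
    by apply: (@le_trans _ _ l); [rewrite /l le_max lexx|apply: ev; rewrite vw].
  by apply: decreasing_above => //; lra.
rewrite mul0r Vv; lra.
Qed.

(** Each summand of the constant belongs to one zone of V: c r to V <= eps^2 / 2, where V <=
    [denom]; 2 |theta| to the zone up to [critical_level], where c r V / 2 <= |theta| (eps^2 - V); c
    to the zone above, where r V is at most the energy by monotonicity. *)
Lemma sqr_le_denom t : 2 * r <= t ->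
  c * r * x t ^+ 2 <= (2 * `|theta| + c + c * r) * denom x t.
Proof.
move=> rt; have rp := r0; have cp := c0; have t0 : 0 <= t by lra.
have den0 := denom_gt0 t0; have A0 : 0 <= energy x t by exact: energy_ge0.
have cr : 0 <= c * r by rewrite mulr_ge0 // ltW.
have pp := pos_part_ge (eps ^+ 2 - x t ^+ 2);
  have p0 := pos_part_ge0 (eps ^+ 2 - x t ^+ 2).
have n0 := mulr_ge0 (normr_ge0 theta) (ltW den0).
have n1 := mulr_ge0 (ltW cp) (ltW den0); have n2 := mulr_ge0 cr (ltW den0).
have dE : denom x t = energy x t + pos_part (eps ^+ 2 - x t ^+ 2) by [].
rewrite !mulrDl -mulrA.
have [Ve|eV] := leP (x t ^+ 2) (eps ^+ 2 / 2).
  have : c * r * x t ^+ 2 <= c * r * denom x t by rewrite ler_wpM2l //; lra.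
  lra.
have [Vl|lV] := leP (x t ^+ 2) critical_level.
  have : x t ^+ 2 <= `|theta| * eps ^+ 2 / (`|theta| + c * r / 2).
    by move: Vl; rewrite /critical_level le_max leNgt eV.
  rewrite ler_pdivlMr ?critical_level_den // => h.
  have : `|theta| * (eps ^+ 2 - x t ^+ 2) <= `|theta| * denom x t by rewrite ler_wpM2l
    //; lra.
  lra.
have : x t ^+ 2 * (t - (t - r)) <= energy x t.
  rewrite energy_itg //; apply: itg_ge_cst => //; first lra.
  by move=> s /andP[s1 s2]; apply: monotone_above => //; lra.
have -> : t - (t - r) = r by ring.
move=> h; have : x t ^+ 2 * r <= denom x t by lra.
move=> /(ler_wpM2l (ltW cp)); lra.
Qed.

(** The gain is at most |theta| from the excess, plus half the constant of [sqr_le_denom], plus the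
    disturbance; adding 2 c gives the slope. *)
Lemma feedback_late t : 2 * r <= t ->
  `|u t| <= (2 * `|theta| + c * (r + 5) / 2) * `|x t| + disturbance_gain * D.
Proof.
move=> rt; have rp := r0; have cp := c0; have t0 : 0 <= t by lra.
have den0 := denom_gt0 t0; have rt' : r <= t by lra.
have dst := disturbance_le rt'; have PE := gain_denom rt' t0; have sd := sqr_le_denom rt.
set E := itg _ _ _ in dst PE; set A := energy x t in PE.
have A0 : 0 <= A by exact: energy_ge0.
have dE : A <= denom x t by rewrite /denom lerDl pos_part_ge0.
rewrite norm_feedback //; set den := denom x t in den0 dst PE dE sd;
  set P := gain _ _ _ in PE *.
have nx0 := normr_ge0 (x t).
have h1 : pos_part (2 * (theta * A + E)) <= 2 * (`|theta| * den + `|E|).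
  have hA : `|theta| * A <= `|theta| * den by rewrite ler_wpM2l.
  have hA0 : theta * A <= `|theta| * A by rewrite ler_wpM2r // ler_norm.
  have := mulr_ge0 (normr_ge0 theta) (ltW den0); have := normr_ge0 E; have := ler_norm E.
  by rewrite /pos_part ge_max => *; apply/andP; split; lra.
have : P * `|x t| <= (2 * `|theta| + c / 2 + c * r / 2) * `|x t| + disturbance_gain * D.
  rewrite -(ler_pM2l (_ : 0 < 2 * den)) ?mulr_gt0 //.
  have -> : 2 * den * (P * `|x t|) = P * (2 * den) * `|x t| by ring.
  rewrite PE; have h2 := ler_wpM2r nx0 (lerD h1 sd); apply: le_trans h2 _; lra.
lra.
Qed.

End estimates.

End model.

(** * Essential bounds *)

Section linfty.
Variable R : realType.
Implicit Types (f g F : R -> R) (I : set R) (a b s t B : R).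
Local Notation mu := (@lebesgue_measure R).

Lemma mu_setT_gt0 : (0 < mu [set: R])%E.
Proof.
apply: (@lt_le_trans _ _ (mu `[0, 1]%classic)).
  by rewrite lebesgue_measure_itv /= lte_fin ltr01 sube0 lte_fin ltr01.
by apply: le_measure; rewrite ?inE.
Qed.

Lemma LnormyE (f : R -> \bar R) : ('N[mu]_+oo[f] = ess_sup mu (abse \o f))%E.
Proof. by rewrite unlock mu_setT_gt0. Qed.

Lemma Linfty_norm_ge0 I f : 0 <= Linfty_norm I f.
Proof. by rewrite /Linfty_norm fine_ge0 // Lnorm_ge0. Qed.

Lemma Lnormy_le I f B : 0 <= B -> {ae mu, forall t, I t -> `|f t| <= B} ->
  ('N[mu]_+oo[EFin \o (f \_ I)] <= B%:E)%E.
Proof.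
move=> B0 fB; rewrite LnormyE; apply/ess_supP; apply: ae_imp fB => t H.
by rewrite /= lee_fin patchE; case: ifPn => [/set_mem/H //|_]; rewrite normr0.
Qed.

Lemma Linfty_norm_le I f B : 0 <= B -> {ae mu, forall t, I t -> `|f t| <= B} ->
  Linfty_norm I f <= B.
Proof.
move=> B0 fB; have h := Lnormy_le B0 fB.
rewrite /Linfty_norm -lee_fin fineK // ge0_fin_numE ?Lnorm_ge0 //.
by apply: le_lt_trans h _; rewrite ltry.
Qed.

(** B serves to make the essential supremum finite, as [fine] would send +oo to 0. *)
Lemma Linfty_norm_ae I f B : {ae mu, forall t, I t -> `|f t| <= B} ->
  {ae mu, forall t, I t -> `|f t| <= Linfty_norm I f}.
Proof.
move=> fB; have h : ('N[mu]_+oo[EFin \o (f \_ I)] <= `|B|%:E)%E.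
  by apply: Lnormy_le => //; apply: ae_imp fB => t H /H /le_trans; apply; exact: ler_norm.
have fin : ('N[mu]_+oo[EFin \o (f \_ I)])%E \is a fin_num.
  by rewrite ge0_fin_numE ?Lnorm_ge0 //; apply: le_lt_trans h _; rewrite ltry.
have := ess_sup_ge mu (abse \o (EFin \o (f \_ I))); rewrite -LnormyE -(fineK fin).
apply: ae_imp => t /= + It; rewrite lee_fin patchE ifT //; exact: mem_set.
Qed.

Lemma Lfun_ae g : g \in Lfun mu +oo%E ->
  measurable_fun setT g /\ exists2 B, 0 <= B & {ae mu, forall t, `|g t| <= B}.
Proof.
move=> /andP[/set_mem mg /set_mem fg]; split=> //.
have fin : ('N[mu]_+oo[EFin \o g])%E \is a fin_num by rewrite ge0_fin_numE ?Lnorm_ge0.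
exists (fine ('N[mu]_+oo[EFin \o g])%E); first by rewrite fine_ge0 // Lnorm_ge0.
have := ess_sup_ge mu (abse \o (EFin \o g)); rewrite -LnormyE -(fineK fin).
by apply: ae_imp => t /=; rewrite lee_fin.
Qed.

Lemma Lfun_bounded g B : 0 <= B -> measurable_fun setT g -> (forall t, `|g t| <= B) ->
  g \in Lfun mu +oo%E.
Proof.
move=> B0 mg gB; apply/andP; split; first exact: mem_set.
apply: mem_set; rewrite /= /finite_norm LnormyE.
apply: (@le_lt_trans _ _ B%:E); last by rewrite ltry.
by apply/ess_supP; apply: aeW => t /=; rewrite lee_fin.
Qed.

Lemma ae_witness a b (P : R -> Prop) : a < b -> {ae mu, forall t, P t} ->
  exists2 t, a < t < b & P t.
Proof.
move=> ab aeP; apply: contrapT => H.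
have [A [mA A0 sA]] := aeP.
have : `]a, b[%classic `<=` A.
  move=> t /=; rewrite in_itv /= => tab; apply: sA => /= Pt; apply: H.
  by exists t.
move=> sub; have : (mu `]a, b[%classic <= mu A)%E by apply: le_measure; rewrite ?inE.
by rewrite A0 lebesgue_measure_itv /= lte_fin ab -EFinB lee_fin leNgt subr_gt0 ab.
Qed.

(** A set of full measure is dense; for continuous functions, essential bounds thus become bounds
    everywhere, endpoints included. *)
Lemma ae_le_continuous F a b B : a < b -> continuous F ->
  {ae mu, forall t, a < t < b -> F t <= B} -> forall t, a <= t <= b -> F t <= B.
Proof.
move=> ab cF aeF t /andP[at_ tb]; rewrite leNgt; apply/negP => Bt.
have /cvgr_gt/(_ _ Bt)/nbhs_ballP[d /= d0 H] := cF t.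
have m : Num.max a (t - d) < Num.min b (t + d).
  by rewrite lt_min !gt_max ab; apply/andP; split; [|apply/andP; split]; lra.
have [s /andP[]] := ae_witness m aeF.
rewrite gt_max lt_min => /andP[s1 s2] /andP[s3 s4] /(_ ltac:(by rewrite s1 s3)).
rewrite leNgt H //; rewrite /ball /= ltr_norml; apply/andP; split; lra.
Qed.

(** Trades continuity within A for continuity on R; [hist_clamp] and [right_clamp] are the maps rho
    in question. *)
Lemma retract_continuous (A : set R) (rho f : R -> R) : continuous rho ->
  (forall t, A (rho t)) -> {within A, continuous f} -> continuous (f \o rho).
Proof.
move=> crho rhoA /subspace_continuousP cf t U nU.
have h : nbhs (rho t) (fun s => A s -> U (f s)) := cf _ (rhoA t) U nU.
have h' : nbhs t (fun s => A (rho s) -> U (f (rho s))) := crho t _ h.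
change (nbhs t (fun s => U (f (rho s)))).
by apply: filterS h' => s; apply; exact: rhoA.
Qed.

Lemma ac_ext I F G : (forall t, I t -> F t = G t) -> abs_continuous_on I F ->
  abs_continuous_on I G.
Proof.
move=> FG acF e e0; have [d d0 H] := acF e e0; exists d => // n a b ab tr ln.
rewrite (eq_bigr (fun i => `|F (b i) - F (a i)|)); first exact: H.
move=> i _; have [abi Ii] := ab i.
by rewrite -!FG //; apply: Ii; rewrite /= in_itv /= lexx abi.
Qed.

Lemma ae_derive_lipschitz F a b B : a <= b -> abs_continuous_on `[a, b] F ->
  {ae mu, forall t, a < t < b -> exists2 g : R, `|g| <= B & is_derive t (1 : R) F g} ->
  `|F b - F a| <= B * (b - a).
Proof.
move=> ab acF dF.
have acl k : abs_continuous_on `[a, b] (fun t => k * t).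
  by apply: (@ac_lipschitz _ _ _ `|k|) => s t _ _ st;
    rewrite -mulrBr normrM (ger0_norm (_ : 0 <= t - s)) // subr_ge0.
have dl k t : is_derive t (1 : R) (fun t => k * t) k.
  by rewrite -[X in is_derive _ _ _ X]mulr1; apply: is_deriveZ.
rewrite ler_norml; apply/andP; split.
  have : - F b + (- B) * b <= - F a + (- B) * a.
    apply: (@ac_nonincreasing _ (fun t => - F t + (- B) * t) a b ab).
      by apply: ac_add => //; exact: ac_opp.
    apply: ae_imp dF => t H tab; have [g gB Dg] := H tab; exists (- g + - B).
      by move: gB; rewrite ler_norml => /andP[]; lra.
    by apply: is_deriveD => //; exact: is_deriveN.
  lra.
have : F b + (- B) * b <= F a + (- B) * a.
  apply: (@ac_nonincreasing _ (fun t => F t + (- B) * t) a b ab).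
    exact: ac_add.
  apply: ae_imp dF => t H tab; have [g gB Dg] := H tab; exists (g + - B).
    by move: gB; rewrite ler_norml => /andP[]; lra.
  by apply: is_deriveD.
lra.
Qed.

(** Moving s and t towards the midpoint by a fraction h puts them inside ]a, b[; then h tends to
    0. *)
Lemma lipschitz_closure F a b B s t : a < b -> continuous F ->
  (forall s t, a < s -> s <= t -> t < b -> `|F t - F s| <= B * (t - s)) ->
  a <= s -> s <= t -> t <= b -> `|F t - F s| <= B * (t - s).
Proof.
move=> ab cF lip as_ st tb.
pose m := (a + b) / 2.
pose p h v := v + h * (m - v).
have cp v : continuous (fun h => p h v).
  by move=> h; apply: cvgD; [exact: cvg_cst|apply: cvgM; [exact: cvg_id|exact: cvg_cst]].
have cG : continuous (fun h => `|F (p h t) - F (p h s)| - B * (p h t - p h s)).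
  have cFp v : continuous (fun h => F (p h v)).
    by move=> h; apply: (@continuous_comp _ _ _ (fun h => p h v) F);
      [exact: cp|exact: cF].
  move=> h; apply: cvgB.
    apply: (@continuous_comp _ _ _ (fun h => F (p h t) - F (p h s)) (fun z : R => `|z|)).
      by apply: cvgB; exact: cFp.
    exact: norm_continuous.
  by apply: cvgM; [exact: cvg_cst|apply: cvgB; exact: cp].
rewrite -subr_le0.
have := @ae_le_continuous _ 0 1 0 ltr01 cG _ 0; rewrite /p !mul0r !addr0; apply;
  last by rewrite lexx ler01.
apply: aeW => h /andP[h0 h1]; rewrite subr_le0.
have hm v : a <= v -> v <= b -> a < v + h * (m - v) < b.
  by move=> av vb; rewrite /m; apply/andP; split; nra.
have /andP[s1 s2] := hm s as_ (le_trans st tb);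
  have /andP[t1 t2] := hm t (le_trans as_ st) tb.
by apply: lip => //; nra.
Qed.

End linfty.

(** * Between the stated problem and the closed loop *)

Section bridge.
Variable R : realType.
Variables (eps c r theta : R).
Hypotheses (eps0 : 0 < eps) (c0 : 0 < c) (r0 : 0 < r).
Implicit Types (s t : R) (x u d : R -> R).
Local Notation mu := (@lebesgue_measure R).

(** Null sets do not affect the equation, so d may be exchanged for a Borel function that clamping
    bounds everywhere by the essential norm. *)
Lemma Linfty_representative (I : set R) (f : R -> R) : Linfty_on I f ->
  exists g : R -> R, [/\ loc_bounded g, forall t, `|g t| <= Linfty_norm I f &
    {ae mu, forall t, I t -> f t = g t}].
Proof.
move=> [g /Lfun_ae[mg [B B0 gB]] fg].
have fB : {ae mu, forall t, I t -> `|f t| <= B}.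
  by apply: ae_imp2 fg gB => t /= H1 H2 It; rewrite H1.
have fN := Linfty_norm_ae fB; have N0 := Linfty_norm_ge0 I f.
exists (fun t => clamp (Linfty_norm I f) (g t)); split.
- split; last by move=> T; exists (Linfty_norm I f) => t _; exact: clamp_norm.
  by apply: measurable_maxr => //; exact: measurable_minr.
- by move=> t; exact: clamp_norm.
- by apply: ae_imp2 fg fN => t /= H1 H2 It; rewrite -(H1 It) clamp_id // H2.
Qed.

Definition hist_clamp s : R := Num.max (- r) (Num.min s 0).

Lemma hist_clamp_continuous : continuous hist_clamp.
Proof.
move=> t; rewrite /hist_clamp.
apply: (@continuous_max _ _ (fun=> - r) (fun s => Num.min s 0)); first exact: cvg_cst.
exact: min0_continuous.
Qed.

Lemma hist_clamp_in s : - r <= hist_clamp s <= 0.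
Proof.
have rp := r0; rewrite /hist_clamp le_max lexx /= ge_max ge_min lexx orbT andbT.
by rewrite oppr_le0 ltW.
Qed.

Lemma hist_clamp_id s : - r <= s <= 0 -> hist_clamp s = s.
Proof. by move=> /andP[h1 h2]; rewrite /hist_clamp min_l // max_r. Qed.

Lemma hist_extension_continuous (f : R -> R) : {within `[- r, 0], continuous f} ->
  continuous (f \o hist_clamp).
Proof.
apply: retract_continuous; first exact: hist_clamp_continuous.
by move=> t; rewrite /= in_itv /=; exact: hist_clamp_in.
Qed.

Lemma normoo_r_sup (f : R -> R) : {within `[- r, 0], continuous f} ->
  forall s, `|(f \o hist_clamp) s| <= normoo_r r f.
Proof.
move=> cf s; have ce := hist_extension_continuous cf; have rp := r0.
have [_ /(_ r)[B HB]] := loc_bounded_cont ce.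
have fB : {ae mu, forall t, `]- r, 0[%classic t -> `|f t| <= B}.
  apply: aeW => t; rewrite /= in_itv /= => /andP[h1 h2].
  have := HB t; rewrite /= hist_clamp_id; last by rewrite !ltW.
  by apply; rewrite ler0_norm; lra.
have := Linfty_norm_ae fB; rewrite -/(normoo_r r f) => H.
rewrite /= -[hist_clamp s]hist_clamp_id ?hist_clamp_in //.
have := @ae_le_continuous _ (fun t => `|(f \o hist_clamp) t|) (- r) 0 (normoo_r r f) _
  _ _ (hist_clamp s).
apply; rewrite ?hist_clamp_in //; first lra.
  move=> t; apply: (@continuous_comp _ _ _ (f \o hist_clamp) (fun z : R => `|z|));
    first exact: ce.
  exact: norm_continuous.
apply: ae_imp H => t Ht /andP[h1 h2]; rewrite /= hist_clamp_id; last by rewrite !ltW.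
by apply: Ht; rewrite /= in_itv /= h1.
Qed.

Section with_data.
Variables (x0 u0 : R -> R).
Hypothesis st : state_space eps c r x0 u0.

Local Notation xi := (x0 \o hist_clamp).
Local Notation ui := (u0 \o hist_clamp).
Local Notation N := (normoo_r r x0 + normoo_r r (derive1 x0) + normoo_r r u0).

Lemma initial_continuous : continuous xi /\ continuous ui.
Proof. by case: st => _ h1 h2 _; split; exact: hist_extension_continuous. Qed.

Lemma initial_norms_ge0 :
  [/\ 0 <= normoo_r r x0, 0 <= normoo_r r (derive1 x0) & 0 <= normoo_r r u0].
Proof. by split; exact: Linfty_norm_ge0. Qed.

Lemma initial_bound s : `|xi s| <= N /\ `|ui s| <= N.
Proof.
have [n1 n2 n3] := initial_norms_ge0; case: st => _ h1 h2 _.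
have := normoo_r_sup h1 s; have := normoo_r_sup h2 s; lra.
Qed.

(** Absolute continuity is given on the open interval only; [lipschitz_closure] adds the
    endpoints. *)
Lemma initial_derivative_bound s t : - r <= s -> s <= t -> t <= 0 ->
  `|xi t - xi s| <= normoo_r r (derive1 x0) * (t - s).
Proof.
have rp := r0; have [cx _] := initial_continuous.
case: st => [[acx _ [g /Lfun_ae[mg [B B0 gB]] dx]] _ _ _].
have dB : {ae mu, forall t, `]- r, 0[%classic t -> `|derive1 x0 t| <= B}.
  by apply: ae_imp2 dx gB => v H1 H2 /H1 h;
    rewrite derive1E (@derive_val _ _ _ _ _ _ _ h).
have dN := Linfty_norm_ae dB; rewrite -/(normoo_r r (derive1 x0)) in dN.
have rneg : - r < 0 by lra.
apply: (lipschitz_closure rneg cx) => {}s {}t rs st_ t0.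
rewrite /= !hist_clamp_id; [|apply/andP; split; lra..].
apply: ae_derive_lipschitz => //.
  apply: ac_subset acx => v; rewrite /= !in_itv /= => /andP[h1 h2]; apply/andP; split;
    lra.
apply: ae_imp2 dx dN => v H1 H2 /andP[v1 v2].
have vI : `]- r, 0[%classic v by rewrite /= in_itv /=; apply/andP; split; lra.
have h := H1 vI; exists (g v) => //.
by have := H2 vI; rewrite derive1E (@derive_val _ _ _ _ _ _ _ h).
Qed.

Lemma initial_sqr_lip s : - r <= s <= 0 -> xi 0 ^+ 2 - xi s ^+ 2 <= 2 * N ^+ 2 * - s.
Proof.
move=> /andP[rs s0]; have [n1 n2 n3] := initial_norms_ge0.
have N0 : 0 <= N by lra.
have := initial_derivative_bound rs s0 (lexx 0); rewrite sub0r => h.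
have h2 : `|xi 0 - xi s| <= N * - s.
  by apply: le_trans h _; rewrite ler_wpM2r ?oppr_ge0 //; lra.
rewrite subr_sqr; apply: le_trans (ler_norm _) _; rewrite normrM.
have -> : 2 * N ^+ 2 * - s = (N * - s) * (N + N) by ring.
apply: ler_pM => //; apply: le_trans (ler_normD _ _) _.
by apply: lerD; [case: (initial_bound 0)|case: (initial_bound s)].
Qed.

Variable dd : R -> R.

(** The last clause of [state_space] in eliminated form. At time 0 the integral over [0, t] vanishes
    and [hist_excess] is the original expression, whatever dd is. *)
Lemma initial_compat : ui 0 = feedback eps c r theta xi ui dd (fun=> 0) xi 0.
Proof.
have [cx cu] := initial_continuous; have rp := r0.
have h0 : hist_clamp 0 = 0 by apply: hist_clamp_id; rewrite lexx andbT; lra.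
have hr : hist_clamp (- r) = - r by apply: hist_clamp_id; rewrite lexx; lra.
case: st => _ _ _; rewrite /feedback /= h0 => ->; rewrite addrC; congr (- (_ + _) * _).
have -> : p_fun eps c r x0 u0 = p_fun eps c r (history xi 0) (history ui 0).
  have E f s : - r <= s <= 0 -> history (f \o hist_clamp) 0 s = f s.
    by move=> hs; rewrite /history add0r /= hist_clamp_id.
  rewrite /p_fun !E ?lexx ?(ltW r0) ?andbT //=; try lra.
  congr ((pos_part (_ - 2 * _) + _) / (2 * (Num.sqrt _ ^+ 2 + _)));
    apply: eq_itg => s hs; by rewrite !E.
apply: p_funE => //.
rewrite /excess /hist_excess /power win_le ?(ltW r0) // itg_xx mulr0 addr0.
rewrite min_l; last lra.
by rewrite /past min_l ?sub0r ?itg_xx ?subr0 //; lra.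
Qed.

End with_data.

Variables (x0 u0 d dd : R -> R).
Local Notation xi := (x0 \o hist_clamp).
Local Notation ui := (u0 \o hist_clamp).
Hypotheses (cxi : continuous xi) (cui : continuous ui) (hdd : loc_bounded dd).
Hypothesis d_dd : {ae mu, forall t, 0 <= t -> d t = dd t}.
Local Notation closed_loop := (closed_loop eps c r theta xi ui dd).

Lemma p_fun_ext x u y v : (forall s, - r <= s <= 0 -> x s = y s) ->
  (forall s, - r <= s <= 0 -> u s = v s) -> p_fun eps c r x u = p_fun eps c r y v.
Proof.
move=> xy uv; have rp := r0.
have h0 : - r <= 0 <= (0 : R) by apply/andP; split; lra.
have hr : - r <= - r <= (0 : R) by apply/andP; split; lra.
rewrite /p_fun !xy //.
congr ((pos_part (_ - 2 * _) + _) / (2 * (Num.sqrt _ ^+ 2 + _)));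
  apply: eq_itg => s hs; by rewrite ?xy ?uv.
Qed.

(** [primitive_derive] speaks of t > 0, the problem of t >= 0. *)
Lemma ae_neq0 : {ae mu, forall t : R, t != 0}.
Proof.
exists [set 0]; split=> //; first exact: lebesgue_measure_set1.
by move=> t /= /negP; rewrite negbK => /eqP.
Qed.

(** The global bounds X and U put x and its derivative into L^oo of the half-line. *)
Lemma closed_loop_is_solution x u (X U D : R) : closed_loop x u ->
  (forall t, `|x t| <= X) -> (forall t, `|u t| <= U) -> (forall t, `|dd t| <= D) ->
  closed_loop_solution eps c r theta x0 u0 d x u.
Proof.
move=> [[cx cu] xn un px uE] xX uU dD; have rp := r0.
have X0 : 0 <= X by exact: le_trans (xX 0).
have U0 : 0 <= U by exact: le_trans (uU 0).
have D0 : 0 <= D by exact: le_trans (dD 0).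
have gB t : `|theta * x t + u t + dd t| <= `|theta| * X + U + D.
  apply: le_trans (ler_normD _ _) _; apply: lerD => //.
  apply: le_trans (ler_normD _ _) _; apply: lerD => //.
  by rewrite normrM ler_wpM2l.
have B0 : 0 <= `|theta| * X + U + D by rewrite !addr_ge0 // mulr_ge0.
have dx : {ae mu, forall t, 0 <= t -> is_derive t (1 : R) x (theta * x t + u t + dd t)}.
  apply: ae_imp2 (primitive_derive px) ae_neq0 => t H t0;
    rewrite le_eqVlt => /predU1P[t0'|/H //].
  by rewrite -t0' eqxx in t0.
split.
- by split; apply: continuous_subspaceT.
- split.
  + apply: (@ac_lipschitz _ _ _ (`|theta| * X + U + D)) => s t.
    rewrite /= !in_itv /= !andbT => s0 t0 st; rewrite px.2 //.
    by apply: norm_itg_le_cst => //; exact: px.1.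
  + exists x; last by apply: aeW => t _.
    by apply: (Lfun_bounded X0) => //; exact: (loc_bounded_cont cx).1.
  + exists (fun t => theta * x t + u t + dd t);
    first by apply: (Lfun_bounded B0) => //; exact: px.1.1.
    by apply: ae_imp dx => t H; rewrite /= in_itv /= andbT => /H.
- move=> s; rewrite in_itv /= => hs; have /andP[_ s0] := hs.
  by rewrite xn // un // /= !hist_clamp_id.
- by apply: ae_imp2 dx d_dd => t H Hd t0; rewrite Hd //; exact: H.
- move=> t t0; rewrite uE // /feedback; congr (- (_ + _) * _).
  by symmetry; apply: p_funE => //; apply: excessE => //.
Qed.

Definition right_clamp s : R := Num.max (- r) s.

Lemma right_clamp_id s : - r <= s -> right_clamp s = s.
Proof. by move=> h; rewrite /right_clamp max_r. Qed.

(** Values before - r are arbitrary in a solution, while [closed_loop] prescribes them; composing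
    with [right_clamp] freezes them at the value in - r. *)
Lemma solution_is_closed_loop x u : closed_loop_solution eps c r theta x0 u0 d x u ->
  closed_loop (x \o right_clamp) (u \o right_clamp).
Proof.
move=> [[cx cu] [acx _ _] ini dx uE]; have rp := r0.
have crc : continuous right_clamp.
  move=> t; rewrite /right_clamp.
  by apply: (@continuous_max _ _ (fun=> - r) id); [exact: cvg_cst|exact: cvg_id].
have rcA t : `[- r, +oo[%classic (right_clamp t) by rewrite /= in_itv /= andbT
  /right_clamp le_max lexx.
have cxe : continuous (x \o right_clamp) by exact: retract_continuous cx.
have cue : continuous (u \o right_clamp) by exact: retract_continuous cu.
have past s : s <= 0 -> x (right_clamp s) = xi s /\ u (right_clamp s) = ui s.
  move=> s0; have E : right_clamp s = hist_clamp s by rewrite /hist_clamp min_l.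
  by rewrite /= -E; apply: ini; rewrite E in_itv /=; exact: hist_clamp_in.
have pos t : 0 <= t -> right_clamp t = t by move=> t0; apply: right_clamp_id; lra.
have xn s : s <= 0 -> (x \o right_clamp) s = xi s by move=> /past[].
have un s : s <= 0 -> (u \o right_clamp) s = ui s by move=> /past[].
have pe : primitive (x \o right_clamp)
    (fun t => theta * (x \o right_clamp) t + (u \o right_clamp) t + dd t).
  apply: primitive_of_ac.
  + by apply: loc_boundedD => //; apply: loc_boundedD; [apply: loc_boundedZ|];
    exact: loc_bounded_cont.
  + move=> b b0; apply: (@ac_ext _ _ x).
      by move=> t; rewrite /= in_itv /= => /andP[t0 _]; rewrite pos.
    apply: ac_subset acx => t; rewrite /= !in_itv /= => /andP[-> _]; exact: isT.
  + apply: ae_imp2 dx d_dd => t H Hd tp; have t0 := ltW tp; have := H t0.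
    rewrite Hd //= !pos // => Dx; apply: (near_eq_is_derive _ Dx).
    near=> v; have v0 : 0 < v by near: v; exact: lt_nbhsr.
    by rewrite /= (pos v (ltW v0)).
split=> // t t0; have xt : (x \o right_clamp) t = x t by rewrite /= pos.
have -> : (u \o right_clamp) t = u t by rewrite /= pos.
rewrite uE // /feedback xt; congr (- (_ + _) * _).
have hE (f : R -> R) s : - r <= s <= 0 -> history f t s = history (f \o right_clamp) t s.
  by move=> /andP[s1 s2]; rewrite /history /= right_clamp_id //; lra.
rewrite (p_fun_ext (hE x) (hE u)); apply: p_funE => //; exact: excessE.
Unshelve. all: by end_near. Qed.

End bridge.

(** * Gains *)

Section gains.
Variable R : realType.

(** Stable under sums, products and powers, so that the regularity of the gains follows their shape;
    nonnegativity is what products need. *)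
Definition ge0_monotone (f : R -> R) := continuous f /\
  forall s t : R, 0 <= s -> s <= t -> 0 <= f s <= f t.

Lemma ge0_monotone_cst (k : R) : 0 <= k -> ge0_monotone (fun=> k).
Proof. by move=> k0; split=> [t|s t _ _]; [exact: cvg_cst|rewrite k0 lexx]. Qed.

Lemma ge0_monotone_id : ge0_monotone id.
Proof. by split=> [t|s t s0 st]; [exact: cvg_id|rewrite s0]. Qed.

Lemma ge0_monotoneD f g : ge0_monotone f -> ge0_monotone g ->
  ge0_monotone (fun t => f t + g t).
Proof.
move=> [cf mf] [cg mg]; split=> [t|s t s0 st]; first exact: cvgD (cf t) (cg t).
by have /andP[f0 fm] := mf s t s0 st; have /andP[g0 gm] := mg s t s0 st;
  rewrite addr_ge0 // lerD.
Qed.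

Lemma ge0_monotoneM f g : ge0_monotone f -> ge0_monotone g ->
  ge0_monotone (fun t => f t * g t).
Proof.
move=> [cf mf] [cg mg]; split=> [t|s t s0 st]; first exact: cvgM (cf t) (cg t).
by have /andP[f0 fm] := mf s t s0 st; have /andP[g0 gm] := mg s t s0 st;
  rewrite mulr_ge0 // ler_pM.
Qed.

Lemma ge0_monotoneX f n : ge0_monotone f -> ge0_monotone (fun t => f t ^+ n).
Proof.
move=> mf; elim: n => [|n IH]; first by under eq_fun do rewrite expr0;
  exact: ge0_monotone_cst.
by under eq_fun do rewrite exprS; exact: ge0_monotoneM.
Qed.

Variables (eps c r theta omega : R).
Hypotheses (eps0 : 0 < eps) (c0 : 0 < c) (r0 : 0 < r) (omega0 : 0 < omega) (omega_le :
  omega <= c).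

Local Notation G := (early_gain r theta).
Local Notation C1 := (disturbance_gain r theta).
Local Notation H := (expR (growth_rate theta * (2 * r))).

Definition late_slope : R := 2 * `|theta| + c * (r + 5) / 2.

(** The three thresholds ensure, in this order, [D_small], [D_small'] and the smallness condition of
    [feedback_small]. *)
Definition small_radius : R := Num.min (eps * expR (- (growth_rate theta * r)) / 2)
  (Num.min (c * eps / (C1 + 1)) (eps / (2 * H))).

Local Notation delta := small_radius.

(* The bound feedback_bound with both N and D replaced by S. *)
Definition coarse_bound (S : R) : R :=
  (2 * c + gain_bound c r theta S S (sqr_max eps c r theta S S)
     (denom_bound eps r theta S S (sqr_max eps c r theta S S)))
  * (1 + sqr_max eps c r theta S S).

Definition small_slope : R :=
  (2 * c + gain_bound c r theta delta delta (eps ^+ 2 / 2) (2 / eps ^+ 2)) * H.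

(** The linear part serves t >= 2 r and small histories; exp(c r) stems from the delayed decay exp(-
    c (t - r)). The last summand vanishes at 0 and dominates the coarse bound once s >= delta. The
    factors exp(2 omega r) offset exp(- omega t) on [0, 2 r]. *)
Definition initial_gain (s : R) : R := (late_slope * G * expR (c * r) + small_slope *
  expR (omega * (2 * r))) * s
  + s / delta * coarse_bound (s + delta) * expR (omega * (2 * r)).

(** The first summand times D exceeds the coarse bound once D >= delta; the others collect the
    coefficients of D in the linear estimates. *)
Definition input_gain (q s : R) : R :=
  coarse_bound s / delta + (late_slope * G + late_slope * q / c + C1 + small_slope).

Lemma growth_rate_ge0 : 0 <= growth_rate theta. Proof. exact: ltW (growth_rate_gt0 _).
  Qed.

Lemma disturbance_gain_gt0 : 0 < C1.
Proof.
by have rp := r0; have := expR_ge0 (growth_rate theta * r);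
  rewrite /disturbance_gain /early_gain; lra.
Qed.

Lemma H_ge1 : 1 <= H.
Proof. by rewrite -expR0 ler_expR mulr_ge0 ?growth_rate_ge0 // mulr_ge0 // ltW. Qed.

Lemma small_radius_gt0 : 0 < delta.
Proof.
have C10 := disturbance_gain_gt0.
rewrite !lt_min !divr_gt0 ?mulr_gt0 ?expR_gt0 //; lra.
Qed.

(** Applied to D and to N: the two quarters add up to the eps^2 / 2 of [feedback_small]. *)
Lemma small_radius_sqr (D : R) : 0 <= D -> D <= delta ->
  [/\ 4 * D ^+ 2 <= expR (- (growth_rate theta * r)) * eps ^+ 2, (C1 + 1) * D <= c * eps &
      H * D ^+ 2 <= eps ^+ 2 / 4].
Proof.
move=> D0; rewrite !le_min => /and3P[h1 h2 h3]; have e0 := eps0; have rp := r0.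
have C10 := disturbance_gain_gt0; have H1 := H_ge1.
split.
- set e := expR _ in h1 *; have ep : 0 < e by exact: expR_gt0.
  have e1 : e <= 1 by rewrite -expR0 ler_expR oppr_le0 mulr_ge0 ?growth_rate_ge0 // ltW.
  have h : D ^+ 2 <= (eps * e / 2) ^+ 2 by rewrite ler_pXn2r // nnegrE divr_ge0 //
    mulr_ge0 // ltW.
  apply: (@le_trans _ _ (e ^+ 2 * eps ^+ 2)).
    have -> : e ^+ 2 * eps ^+ 2 = 4 * (eps * e / 2) ^+ 2 by field.
    by rewrite ler_wpM2l.
  by rewrite ler_wpM2r ?sqr_ge0 // expr2 ler_piMl // ltW.
- by rewrite mulrC -ler_pdivlMr //; lra.
- have Hp : 0 < H by lra.
  have h : D ^+ 2 <= (eps / (2 * H)) ^+ 2.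
    by rewrite ler_pXn2r // nnegrE divr_ge0 ?mulr_ge0 // ltW.
  have := ler_wpM2l (ltW Hp) h.
  have -> : H * (eps / (2 * H)) ^+ 2 = eps ^+ 2 / 4 / H by field; rewrite gt_eqF.
  have e4 : 0 <= eps ^+ 2 / 4 by rewrite divr_ge0 // sqr_ge0.
  by move=> /le_trans; apply; rewrite ler_pdivrMr // ler_peMr.
Qed.

Lemma sqr_max_monotone : ge0_monotone (fun S => sqr_max eps c r theta S S).
Proof.
apply: ge0_monotoneD; first by apply: ge0_monotone_cst; exact: sqr_ge0.
apply: ge0_monotoneM.
  by apply: ge0_monotone_cst; rewrite addr_ge0 ?expR_ge0 // divr_ge0 // sqr_ge0.
by apply: ge0_monotoneX; apply: ge0_monotoneD; exact: ge0_monotone_id.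
Qed.

Lemma gain_bound_monotone (V Q : R -> R) : ge0_monotone V -> ge0_monotone Q ->
  ge0_monotone (fun S => gain_bound c r theta S S (V S) (Q S)).
Proof.
move=> mV mQ; have rp := ltW r0.
have cst k : 0 <= k -> ge0_monotone (fun=> k) by exact: ge0_monotone_cst.
have m2 : ge0_monotone (fun S => S ^+ 2) by apply: ge0_monotoneX; exact: ge0_monotone_id.
apply: ge0_monotoneM; last by apply: cst.
apply: ge0_monotoneM => //; apply: ge0_monotoneD.
  apply: ge0_monotoneD; first by apply: ge0_monotoneM => //; apply: cst; lra.
  apply: ge0_monotoneM; first exact: cst.
  apply: ge0_monotoneM; first exact: cst.
  apply: ge0_monotoneD => //; apply: ge0_monotoneM => //.
  by apply: cst; rewrite addr_ge0.
by apply: ge0_monotoneM => //; apply: cst; rewrite mulr_ge0 // ltW.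
Qed.

Lemma coarse_bound_monotone : ge0_monotone coarse_bound.
Proof.
have cst k : 0 <= k -> ge0_monotone (fun=> k) by exact: ge0_monotone_cst.
have m2 : ge0_monotone (fun S => S ^+ 2) by apply: ge0_monotoneX; exact: ge0_monotone_id.
have mV := sqr_max_monotone.
apply: ge0_monotoneM; last by apply: ge0_monotoneD => //; exact: cst.
apply: ge0_monotoneD; first by apply: cst; rewrite mulr_ge0 // ltW.
apply: gain_bound_monotone => //.
apply: ge0_monotoneD; first by apply: cst; rewrite divr_ge0 // sqr_ge0.
apply: ge0_monotoneM; first by apply: cst; rewrite divr_ge0 // sqr_ge0.
apply: ge0_monotoneD; first by apply: cst; rewrite divr_ge0 // ltW.
apply: ge0_monotoneM; last by apply: cst; rewrite invr_ge0 sqr_ge0.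
apply: ge0_monotoneM; first exact: cst.
apply: ge0_monotoneD; last by apply: ge0_monotoneM => //; exact: cst.
by apply: ge0_monotoneD => //; apply: ge0_monotoneM => //; apply: cst;
  exact: growth_rate_ge0.
Qed.

Lemma coarse_bound_ge0 S : 0 <= S -> 0 <= coarse_bound S.
Proof. by move=> S0; have /andP[] := coarse_bound_monotone.2 S S S0 (lexx S). Qed.

Lemma late_slope_ge0 : 0 <= late_slope.
Proof.
have cp := c0; have rp := r0; have h : 0 <= c * (r + 5) by rewrite mulr_ge0 //; lra.
by have := normr_ge0 theta; rewrite /late_slope; lra.
Qed.

Lemma small_slope_ge0 : 0 <= small_slope.
Proof.
rewrite mulr_ge0 ?expR_ge0 // addr_ge0 //; first by rewrite mulr_ge0 // ltW.
have k1 : ge0_monotone (fun=> eps ^+ 2 / 2).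
  by apply: ge0_monotone_cst; rewrite divr_ge0 // sqr_ge0.
have k2 : ge0_monotone (fun=> 2 / eps ^+ 2).
  by apply: ge0_monotone_cst; rewrite divr_ge0 // sqr_ge0.
by have /andP[] := (gain_bound_monotone k1 k2).2 delta delta (ltW small_radius_gt0)
  (lexx _).
Qed.

Lemma initial_gain_monotone : ge0_monotone initial_gain.
Proof.
have cst k : 0 <= k -> ge0_monotone (fun=> k) by exact: ge0_monotone_cst.
have [cB mB] := coarse_bound_monotone; have d0 := ltW small_radius_gt0.
apply: ge0_monotoneD.
  apply: ge0_monotoneM; last exact: ge0_monotone_id.
  apply: cst; apply: addr_ge0; apply: mulr_ge0; rewrite ?expR_ge0 ?small_slope_ge0 //.
  by apply: mulr_ge0; [exact: late_slope_ge0|exact: expR_ge0].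
apply: ge0_monotoneM; last by apply: cst; exact: expR_ge0.
apply: ge0_monotoneM.
  by apply: ge0_monotoneM; [exact: ge0_monotone_id|apply: cst; rewrite invr_ge0].
split=> [t|s t s0 st]; last by apply: mB; [rewrite addr_ge0|rewrite lerD2r].
apply: (@continuous_comp _ _ _ (fun s => s + delta) coarse_bound); last exact: cB.
by apply: cvgD; [exact: cvg_id|exact: cvg_cst].
Qed.

Lemma initial_gain0 : initial_gain 0 = 0.
Proof. by rewrite /initial_gain mulr0 !mul0r addr0. Qed.

Lemma input_gain_monotone q : 0 <= q -> ge0_monotone (input_gain q).
Proof.
move=> q0; have d0 := ltW small_radius_gt0.
apply: ge0_monotoneD.
  apply: ge0_monotoneM; first exact: coarse_bound_monotone.
  by apply: ge0_monotone_cst; rewrite invr_ge0.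
apply: ge0_monotone_cst; have := ltW disturbance_gain_gt0; have := small_slope_ge0.
have : 0 <= late_slope * G by rewrite mulr_ge0 ?late_slope_ge0 // expR_ge0.
have : 0 <= late_slope * q / c by rewrite divr_ge0 ?mulr_ge0 ?late_slope_ge0 // ltW.
lra.
Qed.

Variables (xi ui dd : R -> R).
Hypotheses (cxi : continuous xi) (cui : continuous ui) (hdd : loc_bounded dd).
Variables (N D : R).
Hypotheses (N0 : 0 <= N) (D0 : 0 <= D).
Hypotheses (dD : forall t : R, `|dd t| <= D).
Hypotheses (xiN : forall s : R, `|xi s| <= N) (uiN : forall s : R, `|ui s| <= N).
Hypothesis xi_lip : forall s : R, - r <= s <= 0 ->
  xi 0 ^+ 2 - xi s ^+ 2 <= 2 * N ^+ 2 * - s.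
Variables x u : R -> R.
Hypothesis cl : closed_loop eps c r theta xi ui dd x u.

(** The second summand of M absorbs the growth G D due to d on [0, r]: the product of sqrt r, G c /
    (q sqrt r) and q D / c is G D. *)
Lemma state_estimate (q M t : R) : 0 < q -> 2 / 3 <= q ^+ 2 ->
  M = G * (1 + c / q / Num.sqrt r) -> 0 <= t ->
  `|x t| <= M * expR (- c * pos_part (t - r)) * `|xi 0| + eps
    + (1 + Num.sqrt r * M * expR (- c * pos_part (t - r))) * (q * (D / c)).
Proof.
move=> q0 q23 ME t0; have cp := c0; have rp := r0; have e0 := eps0; have D0' := D0.
have sr : 0 < Num.sqrt r by rewrite sqrtr_gt0.
have G0 : 0 < G by exact: expR_gt0.
have ax := normr_ge0 (xi 0).
have qd : 0 <= q * (D / c) by rewrite mulr_ge0 ?(ltW q0) // divr_ge0 // ltW.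
have M1 : G <= M.
  by rewrite ME ler_peMr ?(ltW G0) // lerDl !divr_ge0 // ltW.
have M2 : G * D <= Num.sqrt r * M * (q * (D / c)).
  have -> : Num.sqrt r * M * (q * (D / c)) = G * D + Num.sqrt r * G * (q * (D / c)).
    by rewrite ME; field; rewrite !gt_eqF.
  by rewrite lerDl mulr_ge0 // mulr_ge0 // ltW.
have base : G * (`|xi 0| + D) <= M * `|xi 0| + Num.sqrt r * M * (q * (D / c)).
  by rewrite mulrDr lerD // ler_wpM2r.
set E := expR _.
have -> : M * E * `|xi 0| + eps + (1 + Num.sqrt r * M * E) * (q * (D / c)) =
   eps + E * (M * `|xi 0| + Num.sqrt r * M * (q * (D / c))) + q * (D / c) by ring.
have [tr|/ltW rt] := leP t r.
  have -> : E = 1 by rewrite /E /pos_part max_r ?mulr0 ?expR0 // subr_le0.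
  have := norm_early c0 r0 D0 dD cl (t := t); rewrite t0 tr => /(_ isT); lra.
have EE : E = expR (- c * (t - r)) by rewrite /E /pos_part max_l // subr_ge0.
have := norm_late eps0 c0 r0 hdd N0 D0 dD xiN xi_lip cl (ltW q0) q23 rt; rewrite -EE => h.
by apply: le_trans h _; rewrite lerD2r lerD2l ler_wpM2l // expR_ge0.
Qed.

Lemma coarse_estimate t : 0 <= t -> `|u t| <= coarse_bound (N + D).
Proof.
move=> t0; have N0' := N0; have D0' := D0.
have S0 : 0 <= N + D by lra.
have dS s : `|dd s| <= N + D by apply: le_trans (dD s) _; lra.
have xS s : `|xi s| <= N + D by apply: le_trans (xiN s) _; lra.
have uS s : `|ui s| <= N + D by apply: le_trans (uiN s) _; lra.
have lS s : - r <= s <= 0 -> xi 0 ^+ 2 - xi s ^+ 2 <= 2 * (N + D) ^+ 2 * - s.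
  move=> hs; apply: le_trans (xi_lip hs) _; have /andP[_ s0] := hs.
  rewrite ler_wpM2r ?oppr_ge0 // ler_wpM2l // ler_pXn2r ?nnegrE //; lra.
exact: (feedback_bound eps0 c0 r0 cxi cui hdd S0 S0 dS xS uS lS cl).
Qed.

(** Four regimes: D >= delta, by the coarse bound; otherwise t >= 2 r, by [feedback_late] and
    [norm_late]; before 2 r, the coarse bound if N >= delta and [feedback_small] if N < delta. *)
Lemma input_estimate (q t : R) : 0 < q -> 2 / 3 <= q ^+ 2 -> 0 <= t ->
  `|u t| <= expR (- omega * t) * initial_gain N + input_gain q (N + D) * D + eps *
    late_slope.
Proof.
move=> q0 q23 t0; have cp := c0; have rp := r0; have e0 := eps0; have wp := omega0.
have N0' := N0; have D0' := D0; have d0 := small_radius_gt0.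
have w0 := expR_ge0 (- omega * t); have G0 : 0 <= G by exact: expR_ge0.
have s0 := small_slope_ge0; have l0 := late_slope_ge0;
  have C10 := ltW disturbance_gain_gt0.
have S0 : 0 <= N + D by lra.
have ig0 : 0 <= initial_gain N by have /andP[] := initial_gain_monotone.2 N N N0 (lexx _).
have B0 := coarse_bound_ge0 S0.
have el : 0 <= eps * late_slope by rewrite mulr_ge0 // ltW.
have t1 : 0 <= late_slope * G by rewrite mulr_ge0.
have t2 : 0 <= late_slope * q / c by rewrite divr_ge0 ?mulr_ge0 // ltW.
have wi : 0 <= expR (- omega * t) * initial_gain N by rewrite mulr_ge0.
have k0 : 0 <= late_slope * G + late_slope * q / c + C1 + small_slope by lra.
have BD : 0 <= coarse_bound (N + D) / delta * D by rewrite mulr_ge0 // divr_ge0 // ltW.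
have kD : 0 <= (late_slope * G + late_slope * q / c + C1 + small_slope) * D by rewrite
  mulr_ge0.
have cE := coarse_estimate t0.
have [dlD|Dd] := leP delta D.
  have : coarse_bound (N + D) <= coarse_bound (N + D) / delta * D.
    by rewrite -mulrA ler_peMr // mulrC ler_pdivlMr // mul1r.
  by rewrite /input_gain mulrDl; lra.
have [h1 h2 h3] := small_radius_sqr D0 (ltW Dd).
pose a := (late_slope * G * expR (c * r) + small_slope * expR (omega * (2 * r))) * N.
pose b := N / delta * coarse_bound (N + delta) * expR (omega * (2 * r)).
have Bd0 : 0 <= coarse_bound (N + delta) by apply: coarse_bound_ge0; lra.
have b0 : 0 <= expR (- omega * t) * b.
  by rewrite mulr_ge0 // mulr_ge0 ?expR_ge0 // mulr_ge0 // divr_ge0 // ltW.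
have a1 : 0 <= expR (- omega * t) * (late_slope * G * expR (c * r) * N).
  by rewrite !mulr_ge0 // expR_ge0.
have a2 : 0 <= expR (- omega * t) * (small_slope * expR (omega * (2 * r)) * N).
  by apply: (mulr_ge0 w0); apply: mulr_ge0 => //; apply: (mulr_ge0 s0); exact: expR_ge0.
have lG : 0 <= late_slope * G * D by rewrite mulr_ge0.
have lq : 0 <= late_slope * q / c * D by rewrite mulr_ge0.
have lC : 0 <= C1 * D by rewrite mulr_ge0.
have lS : 0 <= small_slope * D by rewrite mulr_ge0.
have -> : expR (- omega * t) * initial_gain N =
  expR (- omega * t) * (late_slope * G * expR (c * r) * N)
  + expR (- omega * t) * (small_slope * expR (omega * (2 * r)) * N) + expR (- omega *
    t) * b.
  by rewrite /initial_gain /b; ring.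
have -> : input_gain q (N + D) * D = coarse_bound (N + D) / delta * D
  + (late_slope * G * D + late_slope * q / c * D + C1 * D + small_slope * D).
  by rewrite /input_gain; ring.
have [t2r|/ltW t2r] := leP t (2 * r); last first.
  have fl := feedback_late eps0 c0 r0 hdd N0 D0 dD xiN xi_lip cl h1 h2 t2r.
  have rt : r <= t by lra.
  have xl := norm_late eps0 c0 r0 hdd N0 D0 dD xiN xi_lip cl (ltW q0) q23 rt.
  have E1 : expR (- c * (t - r)) * D <= D.
    by rewrite ler_piMl // -expR0 ler_expR mulNr oppr_le0 mulr_ge0 ?(ltW cp) // subr_ge0.
  (* The place where omega <= c enters. *)
  have E2 : expR (- c * (t - r)) <= expR (- omega * t) * expR (c * r).
    rewrite -expRD ler_expR; have := ler_wpM2r t0 omega_le; lra.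
  have x2 : `|x t| <= eps + G * (expR (- omega * t) * expR (c * r) * N + D) + q * (D / c).
    apply: le_trans xl _; rewrite lerD2r lerD2l mulrCA ler_wpM2l //.
    apply: (@le_trans _ _ (expR (- c * (t - r)) * (N + D))).
      by rewrite ler_wpM2l ?expR_ge0 // lerD2r.
    by rewrite mulrDr lerD // ler_wpM2r.
  have := ler_wpM2l l0 x2; rewrite -/late_slope in fl.
  have -> : late_slope * (eps + G * (expR (- omega * t) * expR (c * r) * N + D) + q *
    (D / c)) =
    eps * late_slope + expR (- omega * t) * (late_slope * G * expR (c * r) * N) +
      late_slope * G * D + late_slope * q / c * D.
    by ring.
  lra.
have ew : 1 <= expR (- omega * t) * expR (omega * (2 * r)).
  rewrite -expRD -[leLHS]expR0 ler_expR;
    have : omega * t <= omega * (2 * r) by rewrite ler_wpM2l // ltW.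
  lra.
have [dN|Nd] := leP delta N.
  have : coarse_bound (N + D) <= expR (- omega * t) * b.
    have m1 : coarse_bound (N + D) <= coarse_bound (N + delta).
      have le : N + D <= N + delta by lra.
      by have /andP[] := coarse_bound_monotone.2 (N + D) (N + delta) S0 le.
    have m2 : coarse_bound (N + delta) <= N / delta * coarse_bound (N + delta).
      by rewrite ler_peMl // ler_pdivlMr // mul1r.
    have -> : expR (- omega * t) * b = (expR (- omega * t) * expR (omega * (2 * r))) *
      (N / delta * coarse_bound (N + delta)) by rewrite /b; ring.
    have nd : 0 <= N / delta by rewrite divr_ge0 // ltW.
    by apply: le_trans m1 (le_trans m2 _); rewrite ler_peMl // mulr_ge0.
  lra.
have [_ _ h4] := small_radius_sqr N0 (ltW Nd).
have hs : H * (N ^+ 2 + D ^+ 2) <= eps ^+ 2 / 2 by rewrite mulrDr; lra.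
have := feedback_small eps0 c0 r0 cxi cui hdd N0 D0 dD xiN uiN xi_lip cl (t := t).
rewrite t0 t2r => /(_ isT hs) fs.
have gb : gain_bound c r theta N D (eps ^+ 2 / 2) (2 / eps ^+ 2) <=
    gain_bound c r theta delta delta (eps ^+ 2 / 2) (2 / eps ^+ 2).
  have sq v : 0 <= v -> v < delta -> v ^+ 2 <= delta ^+ 2.
    by move=> v0 vd; rewrite ler_pXn2r ?nnegrE // ltW.
  rewrite /gain_bound ler_wpM2r ?invr_ge0 // ler_wpM2r ?divr_ge0 ?sqr_ge0 // lerD2r.
  rewrite /excess_bound; apply: lerD; first by rewrite ler_wpM2l ?sq //; lra.
  by rewrite !ler_wpM2l ?(ltW rp) // lerD2l sq.
have : `|u t| <= small_slope * (N + D).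
  apply: le_trans fs _; rewrite /small_slope -mulrA ler_wpM2r ?lerD2l //.
  by rewrite mulr_ge0 ?expR_ge0.
have : small_slope * N <= expR (- omega * t) * (small_slope * expR (omega * (2 * r)) * N).
  have -> : expR (- omega * t) * (small_slope * expR (omega * (2 * r)) * N) =
    (expR (- omega * t) * expR (omega * (2 * r))) * (small_slope * N) by ring.
  by rewrite ler_peMl // mulr_ge0.
rewrite mulrDr; lra.
Qed.

End gains.

(** * Assembling the constants *)

Lemma powR_quarter (R : realType) : 0 < (2 : R) `^ (1 / 4) /\ ((2 : R) `^ (1 / 4)) ^+ 4
  = 2.
Proof.
have z0 : 0 < (2 : R) `^ (1 / 4) by rewrite powR_gt0.
split=> //; rewrite -powR_mulrn ?ltW // -powRrM.
have -> : 1 / 4 * 4%:R = 1 :> R by field.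
by rewrite powRr1.
Qed.

Lemma within_history_bound (R : realType) (r t B : R) (u : R -> R) : 0 <= B ->
  (forall s, - r < s < 0 -> `|u (t + s)| <= B) -> normoo_r r (history u t) <= B.
Proof.
move=> B0 uB; apply: Linfty_norm_le => //; apply: aeW => s; rewrite /= in_itv /=.
exact: uB.
Qed.

Theorem theorem2 (R : realType) (eps c r : R)
    (eps_gt0 : 0 < eps) (c_gt0 : 0 < c) (r_gt0 : 0 < r)
    (omega : R) (omega_gt0 : 0 < omega) (omega_le : omega <= c)
    (omega_r : expR (omega * r) < 2) (theta : R) :
  exists (M : R) (a gamma : R -> R),
    [/\ 0 < M,
        K_infty a,
        {in `[0, +oo[ &, {homo gamma : s t / s <= t}},
        (forall s : R, 0 <= s -> 0 <= gamma s) &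
        forall x0 u0 d : R -> R,
          state_space eps c r x0 u0 ->
          Linfty_on `[0, +oo[ d ->
          let N0 := normoo_r r x0 + normoo_r r (derive1 x0) + normoo_r r u0 in
          let Nd := Linfty_norm `[0, +oo[ d in
          let rho := 2 * `|theta| + 1 / (2 * Num.sqrt 2 * r) + c * (r + 3) in
          exists x u : R -> R,
            [/\ closed_loop_solution eps c r theta x0 u0 d x u,
                (forall x' u' : R -> R,
                   closed_loop_solution eps c r theta x0 u0 d x' u' ->
                   forall s : R, - r <= s -> x' s = x s /\ u' s = u s),
                (forall t : R, 0 <= t ->
                   `|x t| <=
                     M * expR (- c * pos_part (t - r)) * `|x0 0| + eps
                     + (1 + Num.sqrt r * M * expR (- c * pos_part (t - r)))
                       * (Nd / (2 `^ (1 / 4) * c))) &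
                (forall t : R, 0 <= t ->
                   normoo_r r (history u t) <=
                     expR (- omega * t) * a N0 + gamma (N0 + Nd) * Nd
                     + eps * rho)]].
Proof.
have [z0 z4] := powR_quarter R; set z := (2 : R) `^ (1 / 4) in z0 z4 *.
pose q := z^-1; have q0 : 0 < q by rewrite invr_gt0.
(* Here q^2 = 1 / sqrt 2; the comparison reduces to z^4 = 2 <= 9 / 4. *)
have q23 : 2 / 3 <= q ^+ 2.
  have z2 : z ^+ 2 <= 3 / 2.
    rewrite -(@ler_pXn2r _ 2) ?nnegrE ?sqr_ge0 // -exprM z4.
    have -> : (3 / 2 : R) ^+ 2 = 9 / 4 by field.
    lra.
  by rewrite /q exprVn -[2 / 3]invf_div lef_pV2 ?posrE ?exprn_gt0 ?divr_gt0.
pose M := early_gain r theta * (1 + c / q / Num.sqrt r).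
pose ig := initial_gain eps c r theta omega.
(* The factor pays for times v in [t - r, t], where exp(- omega v) may exceed exp(- omega t). The
   summand s makes a strictly increasing and unbounded, and bounds u on the initial history. *)
pose a s := expR (omega * r) * (ig s + s).
pose gamma := input_gain eps c r theta q.
have sr0 : 0 < Num.sqrt r by rewrite sqrtr_gt0.
have M0 : 0 < M by rewrite mulr_gt0 ?expR_gt0 // ltr_wpDr // !divr_ge0 // ltW.
have mig := initial_gain_monotone theta omega eps_gt0 c_gt0 r_gt0.
have mgam := input_gain_monotone theta eps_gt0 c_gt0 r_gt0 (ltW q0).
have ew0 : 0 < expR (omega * r) by exact: expR_gt0.
have ma : ge0_monotone a.
  apply: ge0_monotoneM; first by apply: ge0_monotone_cst; exact: ltW.
  by apply: ge0_monotoneD => //; exact: ge0_monotone_id.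
exists M, a, gamma; split=> //.
- split.
  + by apply: continuous_subspaceT; exact: ma.1.
  + move=> s t; rewrite !in_itv /= !andbT => s0 t0 st.
    have /andP[_ ist] := mig.2 s t s0 (ltW st).
    by rewrite /a ltr_pM2l // ler_ltD.
  + move=> B; exists (`|B| + 1); first by rewrite addr_ge0.
    have B1 : 0 <= `|B| + 1 by rewrite addr_ge0.
    have /andP[ig0 _] := mig.2 _ _ B1 (lexx _).
    have w1 : 1 <= expR (omega * r) by rewrite -expR0 ler_expR mulr_ge0 // ltW.
    have : ig (`|B| + 1) + (`|B| + 1) <= a (`|B| + 1) by rewrite /a ler_peMl // addr_ge0.
    by move: ig0; rewrite -/ig; have := ler_norm B; lra.
  + by rewrite /a /ig initial_gain0 addr0 mulr0.
- by move=> s t; rewrite !in_itv /= !andbT => s0 t0 st; have /andP[] := mgam.2 s t s0 st.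
- by move=> s s0; have /andP[] := mgam.2 s s s0 (lexx s).
move=> x0 u0 d Hst /Linfty_representative[dd [hdd ddD repr]] N D rho.
have d_dd : {ae lebesgue_measure, forall t : R, 0 <= t -> d t = dd t}.
  by apply: ae_imp repr => t H t0; apply: H; rewrite /= in_itv /= andbT.
have [cxi cui] := initial_continuous r_gt0 Hst.
have xiN s := (initial_bound r_gt0 Hst s).1; have uiN s := (initial_bound r_gt0 Hst s).2.
have xil := initial_sqr_lip r_gt0 Hst.
have N0 : 0 <= N by exact: le_trans (normr_ge0 _) (xiN 0).
have D0 : 0 <= D by exact: Linfty_norm_ge0.
have compat := initial_compat theta r_gt0 Hst dd.
have [x [u cl]] := closed_loop_exists eps_gt0 c_gt0 r_gt0 cxi cui hdd N0 D0 ddD xiN xil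
  compat.
have xi0 : (x0 \o hist_clamp r) 0 = x0 0.
  by rewrite /= hist_clamp_id // lexx andbT oppr_le0 ltW.
have coarse := coarse_estimate eps_gt0 c_gt0 r_gt0 cxi cui hdd N0 D0 ddD xiN uiN xil cl.
have un s : s <= 0 -> `|u s| <= N by move=> s0; case: cl => _ _ -> // _ _; exact: uiN.
exists x, u; split.
- apply: (closed_loop_is_solution (X := 1 + sqr_max eps c r theta N D)
    (U := N + coarse_bound eps c r theta (N + D)) r_gt0 hdd d_dd cl) => [t|t|];
      last exact: ddD.
    apply: norm_le_sqr.
    exact: (sqr_le_max eps_gt0 c_gt0 r_gt0 hdd N0 D0 ddD xiN xil cl).
  have cb0 := coarse_bound_ge0 eps theta c_gt0 r_gt0 (addr_ge0 N0 D0).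
  have [t0|/ltW t0] := leP t 0; first by have := un t t0; lra.
  by have := coarse t t0; lra.
- move=> x' u' /(solution_is_closed_loop r_gt0 hdd d_dd) cl' s rs.
  have [xx uu] := closed_loop_unique eps_gt0 c_gt0 r_gt0 cxi cui hdd N0 D0 ddD xiN xil
    cl' cl s.
  by rewrite -xx -uu /= right_clamp_id.
- move=> t t0.
  have := state_estimate eps_gt0 c_gt0 r_gt0 hdd N0 D0 ddD xiN xil cl q0 q23 (erefl M) t0.
  rewrite xi0 /q -/z -/D -/M; congr (_ <= _ + _ * _).
  by field; rewrite !gt_eqF.
- move=> t t0.
  have ie v : 0 <= v -> `|u v| <= expR (- omega * v) * ig N + gamma (N + D) * D + eps *
    late_slope c r theta.
    exact: (input_estimate eps_gt0 c_gt0 r_gt0 omega_gt0 omega_le cxi cui hdd N0 D0 ddD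
      xiN uiN xil cl q0 q23).
  have /andP[ig0 _] := mig.2 N N N0 (lexx N).
  have /andP[gam0 _] := mgam.2 (N + D) (N + D) (addr_ge0 N0 D0) (lexx _).
  have gD : 0 <= gamma (N + D) * D by rewrite mulr_ge0.
  (* Because c (r + 5) / 2 <= c (r + 3). *)
  have lr : eps * late_slope c r theta <= eps * rho.
    rewrite ler_pM2l // /late_slope /rho.
    have : 0 <= 1 / (2 * Num.sqrt 2 * r) by rewrite divr_ge0 // mulr_ge0 ?mulr_ge0
      ?sqrtr_ge0 // ltW.
    have := mulr_gt0 c_gt0 r_gt0; have := c_gt0; lra.
  have er : 0 <= eps * rho.
    by apply: le_trans lr; rewrite mulr_ge0 ?late_slope_ge0 // ltW.
  have key v : t - r <= v -> expR (- omega * v) <= expR (- omega * t) * expR (omega * r).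
    move=> tv; rewrite -expRD ler_expR.
    have := ler_wpM2l (ltW omega_gt0) tv; lra.
  have aE : expR (- omega * t) * a N =
      expR (- omega * t) * expR (omega * r) * ig N + expR (- omega * t) * expR (omega *
        r) * N.
    by rewrite /a; ring.
  have e0 : 0 <= expR (- omega * t) * expR (omega * r) by rewrite mulr_ge0 ?expR_ge0.
  have i1 := mulr_ge0 e0 ig0; have i2 := mulr_ge0 e0 N0; rewrite -/ig in i1.
  apply: within_history_bound; first by rewrite aE; lra.
  move=> s /andP[rs s0]; rewrite aE; have [ts|/ltW ts] := leP 0 (t + s).
    have tv : t - r <= t + s by lra.
    have := ler_wpM2r ig0 (key _ tv); have := ie _ ts; rewrite -/ig; lra.
  (* The window reaches back to the initial history, so t < r and exp(- omega t) exp(omega r) >=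
     1. *)
  have := un _ ts; have := key 0 ltac:(lra); rewrite mulr0 expR0 => k1.
  have := ler_wpM2r N0 k1; lra.
Qed.
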